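(* Let $n=2$, $\Omega=\{x\in\mathbb{R}^2:x_1>0\}$, $\mathcal{S}=\{(0,z_2):z_2\in\mathbb{R}\}$, $\Gamma=\{(0,z_2):-1\le z_2\le 1\}$, $z_\pm=(0,\pm1)$. Let $k\ge 0$ be an integer and let $\chi:\mathcal{S}\to\mathbb{C}$ satisfy $\chi|_\Gamma\in C^\infty(\Gamma)$, $\chi\equiv 0$ on $\mathcal{S}\setminus\Gamma$, with $\chi|_\Gamma$ vanishing to order $k$ at $z_+$ and $z_-$. Let $\mu\in\mathcal{D}'(\Omega\times\Omega)$ be the Schwartz kernel of the operator $\mathcal{T}f(x)=\frac{x_1}{\pi^2}(\mathcal{R}^*\mathcal{P}\chi\mathcal{R}f)(x)$ on $\Omega$. Then $$\mathrm{WF}(\mu)'\subset\Delta_{\mathcal{V}}\cup\Lambda_+\cup\Lambda_-,$$ where $\mathcal{V}=\{(x,\xi)\in T^*\Omega\setminus0:\ell(x,\xi)\text{ intersects }\Gamma\}$, $\Delta_{\mathcal V}=\{(x,\xi;x,\xi):(x,\xi)\in\mathcal V\}$ and $$\Lambda_\pm=\{(x,\tau(x-z_\pm);\,y,\tau(y-z_\pm))\in(T^*\Omega\setminus 0)\times(T^*\Omega\setminus 0):|x-z_\pm|=|y-z_\pm|\}.$$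
   Context: Operators. For $f\in C_c^\infty(\Omega)$, $\mathcal{R}f(z,t)=\int_{S(z,t)}f(y)\,d\sigma(y)$, $(z,t)\in\mathcal{S}\times(0,\infty)$, where $S(z,t)$ is the sphere (circle, for $n=2$) with center $z$ and radius $t$ and $d\sigma$ its surface measure. $\mathcal{R}^*(g)(x)=\int_{\mathcal{S}}g(z,|x-z|)\,d\sigma(z)$, with $d\sigma$ Lebesgue measure on the hyperplane $\mathcal{S}$. $\mathcal{P}$ acts in the radial variable by $\mathcal{P}(h)(r)=\int_{\mathbb{R}}\int_{0}^\infty e^{i(\tau^2-r^2)\lambda}|\lambda|^{n-1}h(\tau)\,d\tau\,d\lambda$ (here $n=2$). $\chi$ acts by multiplication, $(\chi g)(z,t)=\chi(z)g(z,t)$. A function $h$ smooth on a closed interval vanishes to order $k$ at an endpoint $c$ if $h^{(l)}(c)=0$ for $0\le l\le k-1$ and $h^{(k)}(c)\neq 0$. $\ell(x,\xi)$ is the line through $x$ in the direction of $\xi$. For $\mu\in\mathcal{D}'(\Omega\times\Omega)$, $\mathrm{WF}(\mu)'=\{(x,\xi;y,\eta):(x,\xi;y,-\eta)\in\mathrm{WF}(\mu)\}$. *)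

(* Defs.v *)
From HB Require Import structures.
From mathcomp Require Import all_boot all_order all_algebra.
From mathcomp Require Import complex.
From mathcomp Require Import all_classical all_reals all_analysis.

Set Implicit Arguments.
Unset Strict Implicit.
Unset Printing Implicit Defensive.

Import Order.TTheory GRing.Theory Num.Theory.
Import numFieldNormedType.Exports.

Local Open Scope classical_set_scope.
Local Open Scope ring_scope.
Local Open Scope complex_scope.

(* Vectors of R^n are row vectors. Their library norm is the sup norm; it is
   used below only through the topology, lengths being measured by [enorm]. *)
Definition dotp (R : realType) n (x y : 'rV[R]_n) : R :=
  \sum_(i < n) x 0 i * y 0 i.

Definition enorm (R : realType) n (x : 'rV[R]_n) : R := Num.sqrt (dotp x x).

(* exp (i t) *)
Definition expi (R : realType) (t : R) : R[i] := cos t +i* sin t.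

Definition cabs (R : realType) (w : R[i]) : R :=
  Num.sqrt (complex.Re w ^+ 2 + complex.Im w ^+ 2).

Definition cintegral (R : realType) d (T : measurableType d)
    (mu : {measure set T -> \bar R}) (D : set T) (f : T -> R[i]) : R[i] :=
  (\int[mu]_(x in D) complex.Re (f x)) +i* (\int[mu]_(x in D) complex.Im (f x)).

(* pd [:: i1; ...; im] f = d_i1 (... (d_im f)) *)
Definition pd (R : realType) n (s : seq 'I_n) (f : 'rV[R]_n -> R) :
    'rV[R]_n -> R :=
  foldr (fun i g => 'D_(delta_mx 0 i) g) f s.

Definition cpd (R : realType) n (s : seq 'I_n) (f : 'rV[R]_n -> R[i])
    (x : 'rV[R]_n) : R[i] :=
  pd s (fun y => complex.Re (f y)) x +i* pd s (fun y => complex.Im (f y)) x.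

Definition rsmooth (R : realType) n (f : 'rV[R]_n -> R) : Prop :=
  forall s : seq 'I_n,
    (forall (i : 'I_n) x, derivable (pd s f) x (delta_mx 0 i)) /\
    continuous (pd s f).

Definition csmooth (R : realType) n (f : 'rV[R]_n -> R[i]) : Prop :=
  rsmooth (fun y => complex.Re (f y)) /\ rsmooth (fun y => complex.Im (f y)).

Definition tsupp (R : realType) n (f : 'rV[R]_n -> R[i]) : set 'rV[R]_n :=
  closure [set x | f x != 0].

(* C_c^oo(U): functions on U are extended by zero to the whole of R^n. *)
Definition testfun (R : realType) n (U : set 'rV[R]_n)
    (f : 'rV[R]_n -> R[i]) : Prop :=
  [/\ csmooth f, compact (tsupp f) & tsupp f `<=` U].

Definition Cnorm (R : realType) n (N : nat) (f : 'rV[R]_n -> R[i]) : R :=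
  sup [set r | exists2 s : seq 'I_n, (size s <= N)%N &
                 exists x, r = cabs (cpd s f x)].

(* D'(U). A distribution is carried by a map on all functions R^n -> C, of which
   only the values on C_c^oo(U) are meaningful. *)
Definition distribution_on (R : realType) n (U : set 'rV[R]_n)
    (u : ('rV[R]_n -> R[i]) -> R[i]) : Prop :=
  (forall (a : R[i]) f g, testfun U f -> testfun U g ->
     u (fun x => a * f x + g x) = a * u f + u g) /\
  (forall K : set 'rV[R]_n, compact K -> K `<=` U ->
     exists (C : R) (N : nat), forall f, testfun U f -> tsupp f `<=` K ->
       cabs (u f) <= C * Cnorm N f).

Definition conic (R : realType) n (V : set 'rV[R]_n) : Prop :=
  forall (t : R) v, 0 < t -> V v -> V (t *: v).

(* The Fourier transform of the compactly supported distribution phi u. *)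
Definition fourier_loc (R : realType) n (u : ('rV[R]_n -> R[i]) -> R[i])
    (phi : 'rV[R]_n -> R[i]) (theta : 'rV[R]_n) : R[i] :=
  u (fun x => phi x * expi (- dotp x theta)).

Definition microlocally_smooth (R : realType) n (U : set 'rV[R]_n)
    (u : ('rV[R]_n -> R[i]) -> R[i]) (p zeta : 'rV[R]_n) : Prop :=
  exists (phi : 'rV[R]_n -> R[i]) (V : set 'rV[R]_n),
    [/\ testfun U phi, phi p != 0, open V, conic V & V zeta] /\
    forall N : nat, exists C : R, forall theta, V theta ->
      cabs (fourier_loc u phi theta) <= C * (1 + enorm theta) ^- N.

(* WF(u) as a subset of T^*U \ 0, with elements the pairs (p, zeta). *)
Definition WF (R : realType) n (U : set 'rV[R]_n)
    (u : ('rV[R]_n -> R[i]) -> R[i]) : set ('rV[R]_n * 'rV[R]_n) :=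
  [set q | [/\ U q.1, q.2 != 0 & ~ microlocally_smooth U u q.1 q.2]].

(* U x U inside R^(n + n). *)
Definition setsq (R : realType) n (U : set 'rV[R]_n) : set 'rV[R]_(n + n) :=
  [set w | U (lsubmx w) /\ U (rsubmx w)].

(* Elements are ((x, xi), (y, eta)). *)
Definition WFprime (R : realType) n (U : set 'rV[R]_n)
    (mu : ('rV[R]_(n + n) -> R[i]) -> R[i]) :
    set (('rV[R]_n * 'rV[R]_n) * ('rV[R]_n * 'rV[R]_n)) :=
  [set q | WF (setsq U) mu
             (row_mx q.1.1 q.2.1, row_mx q.1.2 (- q.2.2))].

Definition pt (R : realType) (a b : R) : 'rV[R]_2 :=
  \row_(j < 2) (if j == 0 then a else b).

Definition plane_integral (R : realType) (D : set 'rV[R]_2)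
    (f : 'rV[R]_2 -> R[i]) : R[i] :=
  cintegral (@lebesgue_measure R \x @lebesgue_measure R)%E
    [set p | D (pt p.1 p.2)] (fun p => f (pt p.1 p.2)).

(* mu is the kernel of A : C_c^oo(U) -> functions on U, U an open subset of R^2:
   < mu, phi (x) f > = int_U phi A f. *)
Definition schwartz_kernel (R : realType) (U : set 'rV[R]_2)
    (A : ('rV[R]_2 -> R[i]) -> 'rV[R]_2 -> R[i])
    (mu : ('rV[R]_(2 + 2) -> R[i]) -> R[i]) : Prop :=
  forall phi f, testfun U phi -> testfun U f ->
    mu (fun w => phi (lsubmx w) * f (rsubmx w)) =
    plane_integral U (fun x => phi x * A f x).

Definition Omega (R : realType) : set 'rV[R]_2 := [set x | 0 < x 0 0].

Definition bpt (R : realType) (t : R) : 'rV[R]_2 := pt 0 t.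

Definition hplane (R : realType) : set 'rV[R]_2 := range (@bpt R).

Definition Gam (R : realType) : set 'rV[R]_2 := @bpt R @` `[-1, 1].

(* Functions on hplane x (0, oo) are represented by functions on R^2 x R. *)

(* Integral over the circle of centre z and radius t > 0, parametrized by angle. *)
Definition Rop (R : realType) (f : 'rV[R]_2 -> R[i]) (z : 'rV[R]_2) (t : R) :
    R[i] :=
  cintegral (@lebesgue_measure R) `[0, 2 * pi]
    (fun a : R => t%:C * f (z + t *: pt (cos a) (sin a))).

Definition Rstar (R : realType) (g : 'rV[R]_2 -> R -> R[i]) (x : 'rV[R]_2) :
    R[i] :=
  cintegral (@lebesgue_measure R) setT
    (fun s : R => g (bpt s) (enorm (x - bpt s))).

Definition Pop (R : realType) (n : nat) (h : R -> R[i]) (r : R) : R[i] :=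
  cintegral (@lebesgue_measure R) setT (fun lam : R =>
    cintegral (@lebesgue_measure R) `]0, +oo[ (fun tau : R =>
      expi ((tau ^+ 2 - r ^+ 2) * lam) * (`|lam| ^+ n.-1)%:C * h tau)).

Definition Top (R : realType) (chi : 'rV[R]_2 -> R[i]) (f : 'rV[R]_2 -> R[i])
    (x : 'rV[R]_2) : R[i] :=
  (x 0 0 / pi ^+ 2)%:C *
  Rstar (fun z => Pop 2 (fun t => chi z * Rop f z t)) x.

(* Derivative of a function on [a, b], one-sided at a and b; only the values of
   h on [a, b] matter when t is in [a, b]. *)
Definition diffquot (R : realType) (h : R -> R) (t s : R) : R :=
  (h s - h t) / (s - t).

Definition der_on (R : realType) (a b : R) (h : R -> R) (t : R) : R :=
  lim (diffquot h t @ within `[a, b] t^').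

Definition rsmooth_on (R : realType) (a b : R) (h : R -> R) : Prop :=
  forall (l : nat) (t : R), t \in `[a, b] ->
    cvg (diffquot (iter l (der_on a b) h) t @ within `[a, b] t^').

Definition smooth_on (R : realType) (a b : R) (h : R -> R[i]) : Prop :=
  rsmooth_on a b (fun t => complex.Re (h t)) /\
  rsmooth_on a b (fun t => complex.Im (h t)).

Definition cder_on (R : realType) (a b : R) (l : nat) (h : R -> R[i]) (t : R) :
    R[i] :=
  iter l (der_on a b) (fun s => complex.Re (h s)) t +i*
  iter l (der_on a b) (fun s => complex.Im (h s)) t.

Definition vanishes_to_order (R : realType) (a b : R) (h : R -> R[i]) (k : nat)
    (c : R) : Prop :=
  (forall l, (l < k)%N -> cder_on a b l h c = 0) /\ cder_on a b k h c != 0.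

Definition line (R : realType) (x xi : 'rV[R]_2) : set 'rV[R]_2 :=
  range (fun s : R => x + s *: xi).

(* T^*Omega \ 0 *)
Definition cotangent0 (R : realType) : set ('rV[R]_2 * 'rV[R]_2) :=
  [set q | Omega q.1 /\ q.2 != 0].

Definition Vvis (R : realType) : set ('rV[R]_2 * 'rV[R]_2) :=
  [set q | cotangent0 q /\ line q.1 q.2 `&` @Gam R !=set0].

Definition DeltaV (R : realType) :
    set (('rV[R]_2 * 'rV[R]_2) * ('rV[R]_2 * 'rV[R]_2)) :=
  [set q | Vvis q.1 /\ q.2 = q.1].

Definition Lambda (R : realType) (z : 'rV[R]_2) :
    set (('rV[R]_2 * 'rV[R]_2) * ('rV[R]_2 * 'rV[R]_2)) :=
  [set q | [/\ cotangent0 q.1, cotangent0 q.2,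
               enorm (q.1.1 - z) = enorm (q.2.1 - z) &
               exists tau : R, q.1.2 = tau *: (q.1.1 - z) /\
                               q.2.2 = tau *: (q.2.1 - z)]].

Arguments Omega : clear implicits.
Arguments hplane : clear implicits.
Arguments Gam : clear implicits.
Arguments DeltaV : clear implicits.

(* Main.v *)
Require Import Defs.
From HB Require Import structures.
From mathcomp Require Import all_boot all_order all_algebra.
From mathcomp Require Import complex.
From mathcomp Require Import all_classical all_reals all_analysis.
From mathcomp Require Import measurable_realfun.
From mathcomp Require Import ring lra.
Set Implicit Arguments.
Unset Strict Implicit.
Unset Printing Implicit Defensive.
Import Order.TTheory GRing.Theory Num.Theory.
Import numFieldNormedType.Exports.
Local Open Scope classical_set_scope.
Local Open Scope ring_scope.
Local Open Scope complex_scope.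

(** To show that a covector lies outside the wave front set it is enough to
exhibit one cut-off and one conic neighbourhood on which the localized Fourier
transform decays rapidly; a product cut-off u1(x1) u2(x2) h1(y1) h2(y2) will do,
so that the kernel is only ever evaluated on tensor products, where it is
int phi (T f).

Polar coordinates about z_s = (0, s) turn the radial integral of P into an
integral over the half-plane ([polar_cint], [Pop_Rop]), and the localized
transform at theta = (t11, t12, t21, t22) becomes ([plane_Top])

  int int_(s, la) |la| chi(z_s) int int_(x, y) g(x) h(y)
      exp (i (la (|y - z_s|^2 - |x - z_s|^2) - <(x, y), theta>)),

where g contains the factor x1 / pi^2. The quadratic part of the phase separates:
the two terms la s^2 cancel, and for fixed (s, la) the integral over (x, y) is
a product of four integrals int g(t) exp (i (al t^2 + be t)) dt. Such an
integral is rapidly decreasing as long as the derivative 2 al t + be stays away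
from zero on the support ([chirp_int_decay], by repeated integration by parts).
At the base point the four derivatives vanish together exactly when
xi = tau (x - z_s) and eta = tau (y - z_s) with tau = - 2 la, and, x1 being
positive, this happens for at most one (la, s).

If it happens for no |s| <= 1, compactness in s and homogeneity in (la, theta)
give a uniform lower bound for the derivatives ([forms_lower]), and everything
is rapidly decreasing. Otherwise the plane of the (s, la) is divided by a
cut-off around the critical point, scaled with |theta|. Away from that point
the previous argument applies. Near it the order of integration is reversed:
for fixed x and y the integral over (s, la) is estimated.
- If |x - z_s| and |y - z_s| differ, the phase is linear in la with a slope
  bounded away from zero, and one integrates by parts in la
  ([near_lambda_fixed]).
- If x2 <> y2 and |s| < 1, the phase is linear in s with slope
  2 la (x2 - y2), and chi is smooth near z_s: one integrates by parts in s
  ([near_s_fixed]).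

What is left is s = 1 or s = -1 with equal distances, that is Lambda_+ or
Lambda_-, and |s| < 1 with equal distances and x2 = y2; there x = y because
x1 and y1 are positive, and the covector lies in Delta_V. *)

(** * Complex-valued integrals *)
Section cabs.
Context {R : realType}.
Implicit Types z w : R[i].

Lemma cabsE z : cabs z = ComplexField.Normc.normc z.
Proof. by case: z. Qed.

Lemma cabsM z w : cabs (z * w) = cabs z * cabs w.
Proof. by rewrite !cabsE ComplexField.Normc.normcM. Qed.

Lemma cabsD z w : cabs (z + w) <= cabs z + cabs w.
Proof. by rewrite !cabsE; exact: (@le_normcD R). Qed.

Lemma cabs_ge0 z : 0 <= cabs z. Proof. exact: sqrtr_ge0. Qed.

Lemma cabsC (a : R) : cabs a%:C = `|a|.
Proof. by rewrite /cabs /= expr0n addr0 sqrtr_sqr. Qed.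

Lemma cabs0 : cabs (0 : R[i]) = 0.
Proof. by rewrite (cabsC 0) normr0. Qed.

Lemma cabs_expi (t : R) : cabs (expi t) = 1.
Proof. by rewrite /cabs /= cos2Dsin2 sqrtr1. Qed.

Lemma normr_Re_le z : `|complex.Re z| <= cabs z.
Proof. by rewrite -sqrtr_sqr /cabs ler_sqrt ?addr_ge0 ?sqr_ge0 // lerDl sqr_ge0. Qed.

Lemma normr_Im_le z : `|complex.Im z| <= cabs z.
Proof. by rewrite -sqrtr_sqr /cabs ler_sqrt ?addr_ge0 ?sqr_ge0 // lerDr sqr_ge0. Qed.

Lemma cabs_le z : cabs z <= `|complex.Re z| + `|complex.Im z|.
Proof.
rewrite -[leRHS]ger0_norm ?addr_ge0// -sqrtr_sqr ler_sqrt ?sqr_ge0//.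
rewrite sqrrD !real_normK ?num_real// -addrA lerD2l lerDr.
by rewrite mulrn_wge0// mulr_ge0.
Qed.

Lemma expiD (a b : R) : expi (a + b) = expi a * expi b.
Proof.
by rewrite /expi cosD sinD; apply/eqP; rewrite eq_complex/= eqxx/= addrC.
Qed.

Lemma cReM z w : complex.Re (z * w) = complex.Re z * complex.Re w - complex.Im z * complex.Im w.
Proof. by case: z w => [? ?] [? ?]. Qed.
Lemma cImM z w : complex.Im (z * w) = complex.Re z * complex.Im w + complex.Im z * complex.Re w.
Proof. by case: z w => [? ?] [? ?]. Qed.
Lemma cReD z w : complex.Re (z + w) = complex.Re z + complex.Re w.
Proof. by case: z w => [? ?] [? ?]. Qed.
Lemma cImD z w : complex.Im (z + w) = complex.Im z + complex.Im w.
Proof. by case: z w => [? ?] [? ?]. Qed.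

Lemma complexP z w : complex.Re z = complex.Re w -> complex.Im z = complex.Im w -> z = w.
Proof. by case: z w => [? ?] [? ?] /= -> ->. Qed.

End cabs.

Section cmeas.
Context d (T : measurableType d) (R : realType).
Implicit Types f g : T -> R[i].

Definition cmeasurable f :=
  measurable_fun setT (fun x => complex.Re (f x)) /\
  measurable_fun setT (fun x => complex.Im (f x)).

Lemma cmeasurableM f g : cmeasurable f -> cmeasurable g ->
  cmeasurable (fun x => f x * g x).
Proof.
move=> [f1 f2] [g1 g2]; split.
  under eq_fun do rewrite cReM.
  by apply: measurable_funB; apply: measurable_funM.
under eq_fun do rewrite cImM.
by apply: measurable_funD; apply: measurable_funM.
Qed.

Lemma cmeasurable_cst c : cmeasurable (fun=> c).
Proof. by split; exact: measurable_cst. Qed.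

Lemma cmeasurable_real (g : T -> R) : measurable_fun setT g ->
  cmeasurable (fun x => (g x)%:C).
Proof. by move=> mg; split => //=. Qed.

Lemma cmeasurable_expi (g : T -> R) : measurable_fun setT g ->
  cmeasurable (fun x => expi (g x)).
Proof.
move=> mg; split => /=; apply: measurableT_comp => //;
  apply: continuous_measurable_fun; [exact: continuous_cos|exact: continuous_sin].
Qed.

End cmeas.

Lemma cmeasurable_comp d d' (T : measurableType d) (T' : measurableType d')
  (R : realType) (f : T -> R[i]) (h : T' -> T) :
  cmeasurable f -> measurable_fun setT h -> cmeasurable (fun x => f (h x)).
Proof.
by move=> [f1 f2] mh; split; [exact: (measurableT_comp f1 mh)|exact: (measurableT_comp f2 mh)].
Qed.

Section cint.
Context d (T : measurableType d) (R : realType) (mu : {measure set T -> \bar R}).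
Implicit Types f g : T -> R[i].

Definition cint f := cintegral mu setT f.

Definition cintegrable f :=
  mu.-integrable setT (EFin \o (fun x => complex.Re (f x))) /\
  mu.-integrable setT (EFin \o (fun x => complex.Im (f x))).

Lemma integrable_domin (f g : T -> R) : measurable_fun setT f ->
  mu.-integrable setT (EFin \o g) -> (forall x, `|f x| <= g x) ->
  mu.-integrable setT (EFin \o f).
Proof.
move=> mf ig fg; apply: le_integrable ig => //.
  exact/measurable_EFinP.
move=> x _ /=; rewrite lee_fin (le_trans (fg x))// ler_norm//.
Qed.

Lemma cintegrable_domin f (g : T -> R) : cmeasurable f ->
  mu.-integrable setT (EFin \o g) -> (forall x, cabs (f x) <= g x) ->
  cintegrable f.
Proof.
move=> [f1 f2] ig fg; split; apply: integrable_domin ig _ => // x;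
  rewrite (le_trans _ (fg x)) ?normr_Re_le ?normr_Im_le//.
Qed.

(** The factor 2 comes from estimating the real and the imaginary part
separately, which spares a rotation argument. *)
Lemma cabs_cint_le f (g : T -> R) : cmeasurable f ->
  mu.-integrable setT (EFin \o g) -> (forall x, cabs (f x) <= g x) ->
  cabs (cint f) <= 2 * \int[mu]_x g x.
Proof.
move=> mf ig fg; have [i1 i2] := cintegrable_domin mf ig fg.
apply: le_trans (cabs_le _) _; rewrite mulr2n mulrDl mul1r /=.
have H (h : T -> R) : mu.-integrable setT (EFin \o h) -> (forall x, `|h x| <= cabs (f x)) ->
    `|\int[mu]_x h x| <= \int[mu]_x g x.
  move=> ih hf; apply: le_trans (le_normr_Rintegral _ ih) _ => //.
  apply: le_Rintegral => //; last by move=> x _; exact: le_trans (hf x) (fg x).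
  exact: integrable_norm.
apply: lerD; apply: H => // x; [exact: normr_Re_le|exact: normr_Im_le].
Qed.

Lemma cintZ c f : cintegrable f -> cint (fun x => c * f x) = c * cint f.
Proof.
move=> [i1 i2]; rewrite /cint /cintegral.
have iZ a (h : T -> R) : mu.-integrable setT (EFin \o h) ->
   mu.-integrable setT (EFin \o (fun x => a * h x)).
  by move=> ih; apply: integrableZl ih.
apply: complexP => /=.
  under eq_Rintegral do rewrite cReM.
  by rewrite RintegralB ?RintegralZl ?cReM//; exact: iZ.
under eq_Rintegral do rewrite cImM.
by rewrite RintegralD ?RintegralZl ?cImM//; exact: iZ.
Qed.

Lemma cintD f g : cintegrable f -> cintegrable g ->
  cint (fun x => f x + g x) = cint f + cint g.
Proof.
move=> [i1 i2] [j1 j2]; apply: complexP; rewrite /cint /cintegral /=.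
  by under eq_Rintegral do rewrite cReD; rewrite RintegralD.
by under eq_Rintegral do rewrite cImD; rewrite RintegralD.
Qed.

Lemma eq_cint f g : f =1 g -> cint f = cint g.
Proof. by move=> /funext ->. Qed.

End cint.

Lemma cintegral_mkcond d (T : measurableType d) (R : realType)
   (mu : {measure set T -> \bar R}) (D : set T) (f : T -> R[i]) :
  cintegral mu D f = cint mu (fun x => (\1_D x)%:C * f x).
Proof.
rewrite /cint /cintegral; apply: complexP => /=; rewrite Rintegral_mkcond;
  apply: eq_Rintegral => x _; rewrite ?cReM ?cImM /= patchE indicE;
  by case: ifPn => _; rewrite /= ?mul1r ?mul0r ?subr0 ?addr0.
Qed.

Section param_measurable.
Context d1 d2 (T1 : measurableType d1) (T2 : measurableType d2) (R : realType).
Variable m2 : {sigma_finite_measure set T2 -> \bar R}.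

Lemma measurable_param_Rintegral (f : T1 * T2 -> R) : measurable_fun setT f ->
  measurable_fun setT (fun x => \int[m2]_y f (x, y)).
Proof.
move=> mf; rewrite /Rintegral.
have mf' : measurable_fun setT (EFin \o f) by exact/measurable_EFinP.
apply: measurableT_comp => //.
rewrite [X in measurable_fun _ X](_ : _ = fun x =>
  (\int[m2]_y (EFin \o f)^\+ (x, y) - \int[m2]_y (EFin \o f)^\- (x, y))%E).
  apply: emeasurable_funB; apply: measurable_fun_fubini_tonelli_F => //.
    exact: measurable_funepos.
  exact: measurable_funeneg.
apply/funext => x; rewrite [LHS]integralE.
by congr (_ - _)%E; apply: eq_integral => y _; rewrite ?funeposE ?funenegE.
Qed.

Lemma cmeasurable_param_cint (f : T1 * T2 -> R[i]) : cmeasurable f ->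
  cmeasurable (fun x => cint m2 (fun y => f (x, y))).
Proof.
move=> [f1 f2]; split => /=.
  exact: (measurable_param_Rintegral f1).
exact: (measurable_param_Rintegral f2).
Qed.

End param_measurable.

Section pmeas.
Context d1 d2 (T1 : measurableType d1) (T2 : measurableType d2) (R : realType).
Variable m1 : {sigma_finite_measure set T1 -> \bar R}.
Variable m2 : {sigma_finite_measure set T2 -> \bar R}.

(** The product measure under a name of its own, so that it can carry the
structure of a sigma-finite measure and be used again as a factor. *)
Definition pmeas : set (T1 * T2) -> \bar R := (m1 \x m2)%E.

HB.instance Definition _ := Measure.copy pmeas (m1 \x m2)%E.

Let sigma_finite_pmeas : sigma_finite setT pmeas.
Proof.
have /sigma_finiteP[F [TF ndF Foo]] := sigma_finiteT m1.
have /sigma_finiteP[G [TG ndG Goo]] := sigma_finiteT m2.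
exists (fun n => F n `*` G n).
  rewrite -setXTT TF TG; apply/seteqP; split=> -[x y] /=; last first.
    by move=> [n _ []/= ? ?]; split; exists n.
  move=> [[n _ Fnx] [k _ Gky]]; exists (maxn n k) => //; split => /=.
    by move: x Fnx; exact/subsetPset/ndF/leq_maxl.
  by move: y Gky; exact/subsetPset/ndG/leq_maxr.
move=> k; have [mF Fk] := Foo k; have [mG Gk] := Goo k.
split; first exact: measurableX.
by rewrite /pmeas product_measure1E// lte_mul_pinfty// ge0_fin_numE.
Qed.

HB.instance Definition _ := Measure_isSigmaFinite.Build _ _ _ pmeas sigma_finite_pmeas.

End pmeas.

(** * Fubini for functions dominated by a product *)

(** Domination by p(x) q(y) at every point, and not only almost everywhere,
makes all the sections integrable; the iterated integrals then agree with the
double one without exceptional null sets. *)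
Section fubini_domin.
Context d1 d2 (T1 : measurableType d1) (T2 : measurableType d2) (R : realType).
Variable m1 : {sigma_finite_measure set T1 -> \bar R}.
Variable m2 : {sigma_finite_measure set T2 -> \bar R}.
Variables (p : T1 -> R) (q : T2 -> R).
Hypothesis ip : m1.-integrable setT (EFin \o p).
Hypothesis iq : m2.-integrable setT (EFin \o q).

Lemma integrable_prod :
  (pmeas m1 m2).-integrable setT (EFin \o (fun z => p z.1 * q z.2)).
Proof.
have mp : measurable_fun setT p by apply/measurable_EFinP; exact: measurable_int ip.
have mq : measurable_fun setT q by apply/measurable_EFinP; exact: measurable_int iq.
apply/integrable12ltyP.
  by apply/measurable_EFinP; apply: measurable_funM; apply: measurableT_comp.
rewrite (_ : (\int[m1]_x _)%E = (\int[m1]_x (`|p x|%:E * \int[m2]_y `|q y|%:E))%E); last first.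
  apply: eq_integral => x _ /=; rewrite -ge0_integralZl//; last first.
    by apply/measurable_EFinP; apply: measurableT_comp.
  by apply: eq_integral => y _; rewrite normrM EFinM.
have jp := integrable_norm ip. have jq := integrable_norm iq.
rewrite ge0_integralZr//; last 2 first.
  by apply/measurable_EFinP; apply: measurableT_comp.
  by apply: integral_ge0.
rewrite lte_mul_pinfty ?integral_ge0//.
  exact: (integrable_fin_num measurableT jp).
by rewrite -ge0_fin_numE ?integral_ge0//; exact: (integrable_fin_num measurableT jq).
Qed.

Lemma integrable_section1 (f : T1 * T2 -> R) : measurable_fun setT f ->
  (forall z, `|f z| <= p z.1 * q z.2) ->
  forall x, m2.-integrable setT (EFin \o (fun y => f (x, y))).
Proof.
move=> mf fpq x; apply: (@integrable_domin _ _ _ _ _ (fun y => p x * q y)).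
- exact: measurableT_comp.
- by apply: (integrableZl _ (p x) iq).
- by move=> y; exact: fpq.
Qed.

Lemma integrable_section2 (f : T1 * T2 -> R) : measurable_fun setT f ->
  (forall z, `|f z| <= p z.1 * q z.2) ->
  forall y, m1.-integrable setT (EFin \o (fun x => f (x, y))).
Proof.
move=> mf fpq y; apply: (@integrable_domin _ _ _ _ _ (fun x => q y * p x)).
- exact: measurableT_comp.
- by apply: (integrableZl _ (q y) ip).
- by move=> x; rewrite mulrC; exact: fpq.
Qed.

Lemma Rfubini (f : T1 * T2 -> R) : measurable_fun setT f ->
  (forall z, `|f z| <= p z.1 * q z.2) ->
  \int[m1]_x \int[m2]_y f (x, y) = \int[(pmeas m1 m2)]_z f z /\
  \int[m2]_y \int[m1]_x f (x, y) = \int[(pmeas m1 m2)]_z f z.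
Proof.
move=> mf fpq.
have fi : (pmeas m1 m2).-integrable setT (EFin \o f).
  exact: integrable_domin integrable_prod fpq.
split.
  rewrite [RHS]/Rintegral -(integral12_prod_meas1 fi); congr fine.
  apply: eq_integral => x _; rewrite /fubini_F /Rintegral /= fineK//.
  by have := integrable_fin_num measurableT (integrable_section1 mf fpq x).
rewrite [RHS]/Rintegral -(integral21_prod_meas1 fi); congr fine.
apply: eq_integral => y _; rewrite /fubini_G /Rintegral /= fineK//.
by have := integrable_fin_num measurableT (integrable_section2 mf fpq y).
Qed.

Lemma cfubini (f : T1 * T2 -> R[i]) : cmeasurable f ->
  (forall z, cabs (f z) <= p z.1 * q z.2) ->
  cint m1 (fun x => cint m2 (fun y => f (x, y))) = cint (pmeas m1 m2) f /\
  cint m2 (fun y => cint m1 (fun x => f (x, y))) = cint (pmeas m1 m2) f.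
Proof.
move=> [f1 f2] fpq.
have [a1 a2] := Rfubini f1 (fun z => le_trans (normr_Re_le _) (fpq z)).
have [b1 b2] := Rfubini f2 (fun z => le_trans (normr_Im_le _) (fpq z)).
by split; apply: complexP.
Qed.

Lemma cint_prod (u : T1 -> R[i]) (v : T2 -> R[i]) : cmeasurable u -> cmeasurable v ->
  (forall x, cabs (u x) <= p x) -> (forall y, cabs (v y) <= q y) ->
  cint (pmeas m1 m2) (fun z => u z.1 * v z.2) = cint m1 u * cint m2 v.
Proof.
move=> mu mv up vq.
have [] := @cfubini (fun z => u z.1 * v z.2).
- apply: cmeasurableM; first exact: (cmeasurable_comp mu).
  exact: (cmeasurable_comp mv).
- by move=> z; rewrite cabsM ler_pM ?cabs_ge0.
move=> <- _ /=; rewrite mulrC -cintZ; last exact: cintegrable_domin up.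
by apply: eq_cint => x; rewrite [RHS]mulrC -cintZ//; exact: cintegrable_domin vq.
Qed.

End fubini_domin.

(** * Smooth functions of one variable and cut-offs *)
Section Cn.
Context {R : realType}.
Implicit Types (f g : R -> R).

(** n times differentiable; all the continuity that is needed comes from one
more derivative. *)
Fixpoint Cn (n : nat) (g : R -> R) : Prop :=
  if n is m.+1 then (forall x, derivable g x 1) /\ Cn m (derive1 g) else True.

Definition smooth1 g := forall n, Cn n g.

Lemma CnS_is_derive n g g' : (forall x, is_derive (x : R) 1 g (g' x)) ->
  Cn n g' -> Cn n.+1 g.
Proof.
move=> dg Cg' /=; split => [x|]; first by have [] := dg x.
suff -> : (derive1 g) = g' by [].
by apply/funext => x; rewrite derive1E; exact: (@derive_val _ _ _ _ _ _ _ (dg x)).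
Qed.

Lemma Cn_is_derive n g : Cn n.+1 g -> forall x, is_derive (x : R) 1 g ((derive1 g) x).
Proof. by move=> [dg _] x; rewrite derive1E; exact: DeriveDef. Qed.

Lemma CnW n g : Cn n.+1 g -> Cn n g.
Proof. by elim: n g => [//|n IH] g [dg Cg]; split => //; exact: IH. Qed.

Lemma Cn_cst n (c : R) : Cn n (fun=> c).
Proof.
elim: n c => [//|n IH] c; apply: (@CnS_is_derive _ _ (fun=> 0)) => // x.
Qed.

Lemma CnD n f g : Cn n f -> Cn n g -> Cn n (fun x => f x + g x).
Proof.
elim: n f g => [//|n IH] f g Cf Cg.
have dD x : is_derive (x : R) 1 (fun x => f x + g x) (derive1 f x + derive1 g x).
  exact: (is_deriveD (Cn_is_derive Cf x) (Cn_is_derive Cg x)).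
apply: (CnS_is_derive dD).
by apply: IH; [case: Cf|case: Cg].
Qed.

Lemma CnM n f g : Cn n f -> Cn n g -> Cn n (fun x => f x * g x).
Proof.
elim: n f g => [//|n IH] f g Cf Cg.
have dM x : is_derive (x : R) 1 (fun x => f x * g x) (f x * derive1 g x + g x * derive1 f x).
  exact: (is_deriveM (Cn_is_derive Cf x) (Cn_is_derive Cg x)).
apply: (CnS_is_derive dM).
by apply: CnD; apply: IH; [exact: CnW|case: Cg|exact: CnW|case: Cf].
Qed.

Lemma Cn_comp n f g : Cn n f -> Cn n g -> Cn n (fun x => f (g x)).
Proof.
elim: n f g => [//|n IH] f g Cf Cg.
have dC x : is_derive (x : R) 1 (fun x => f (g x)) (derive1 f (g x) * derive1 g x).
  exact: (is_derive1_comp (Cn_is_derive Cf (g x)) (Cn_is_derive Cg x)).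
apply: (CnS_is_derive dC).
by apply: CnM; [apply: IH; [case: Cf|exact: CnW]|case: Cg].
Qed.

Lemma Cn_id n : Cn n (fun x : R => x).
Proof.
case: n => [//|n]; apply: (@CnS_is_derive _ _ (fun=> 1)); exact: Cn_cst.
Qed.

Lemma CnV n g : (forall x, g x != 0) -> Cn n g -> Cn n (fun x => (g x)^-1).
Proof.
move=> g0; elim: n => [//|n IH] Cg.
have dV (x : R) : is_derive x 1 (fun x => (g x)^-1) ((- derive1 g x) * ((g x)^-1 * (g x)^-1)).
  have dg := Cn_is_derive Cg x.
  by apply: is_derive_eq; rewrite /GRing.scale/=; move: (g0 x) => gx0; field.
apply: (CnS_is_derive dV).
apply: CnM.
  under eq_fun do rewrite -mulN1r.
  by apply: CnM; [exact: Cn_cst|case: Cg].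
by apply: CnM; apply: IH; exact: CnW.
Qed.

Lemma Cn_trig n : Cn n (@cos R) /\ Cn n (@sin R).
Proof.
elim: n => [//|n [IHc IHs]]; split.
  apply: (@CnS_is_derive _ _ (fun x => -1 * sin x)) => [x|].
    by rewrite mulN1r; exact: is_derive_cos.
  by apply: CnM => //; exact: Cn_cst.
by apply: (@CnS_is_derive _ _ cos) => // x; exact: is_derive_sin.
Qed.

Lemma smooth1_cst (c : R) : smooth1 (fun=> c). Proof. by move=> n; exact: Cn_cst. Qed.
Lemma smooth1_id : smooth1 (fun x : R => x). Proof. by move=> n; exact: Cn_id. Qed.
Lemma smooth1D f g : smooth1 f -> smooth1 g -> smooth1 (fun x => f x + g x).
Proof. by move=> sf sg n; exact: CnD. Qed.
Lemma smooth1M f g : smooth1 f -> smooth1 g -> smooth1 (fun x => f x * g x).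
Proof. by move=> sf sg n; exact: CnM. Qed.
Lemma smooth1_comp f g : smooth1 f -> smooth1 g -> smooth1 (fun x => f (g x)).
Proof. by move=> sf sg n; exact: Cn_comp. Qed.
Lemma smooth1_cos : smooth1 (@cos R). Proof. by move=> n; have [] := Cn_trig n. Qed.
Lemma smooth1_sin : smooth1 (@sin R). Proof. by move=> n; have [] := Cn_trig n. Qed.

Lemma smooth1_derivable g x : smooth1 g -> derivable g x 1.
Proof. by move=> /(_ 1%N)[]. Qed.

Lemma smooth1_is_derive g x : smooth1 g -> is_derive (x : R) 1 g ((derive1 g) x).
Proof. by move=> sg; exact: (Cn_is_derive (sg 1%N)). Qed.

Lemma smooth1_derive1 g : smooth1 g -> smooth1 (derive1 g).
Proof. by move=> sg n; case: (sg n.+1). Qed.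

Lemma smooth1_continuous g : smooth1 g -> continuous g.
Proof.
by move=> sg x; apply/differentiable_continuous/derivable1_diffP/smooth1_derivable.
Qed.

Lemma smooth1_measurable g : smooth1 g -> measurable_fun setT g.
Proof. by move=> sg; apply: continuous_measurable_fun; exact: smooth1_continuous. Qed.

End Cn.

Section flat.
Context {R : realType}.

(** The family x^-m exp(-1/x), extended by 0, is closed under differentiation up
to linear combinations, which is why m is carried along. *)
Definition flat (m : nat) (x : R) : R :=
  if 0 < x then x^-1 ^+ m * expR (- x^-1) else 0.

Lemma flat_le0 m x : x <= 0 -> flat m x = 0.
Proof. by rewrite /flat ltNge => ->. Qed.

Lemma flat_ge0 m x : 0 <= flat m x.
Proof.
by rewrite /flat; case: ifP => // x0; rewrite mulr_ge0 ?expR_ge0// exprn_ge0// invr_ge0 ltW.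
Qed.

Lemma flat_gt0 m x : 0 < x -> 0 < flat m x.
Proof. by move=> x0; rewrite /flat x0 mulr_gt0 ?expR_gt0// exprn_gt0// invr_gt0. Qed.

(** From e^u >= u^(m+2) / (m+2)! at u = 1/x. A quadratic bound is what makes the
derivative at 0 vanish. *)
Lemma flat_sqr_bound m x : `|flat m x| <= (m.+2)`!%:R * `|x| ^+ 2.
Proof.
rewrite /flat; case: ifPn => [x0|_]; last by rewrite normr0 mulr_ge0.
have u0 : 0 < x^-1 by rewrite invr_gt0.
rewrite ger0_norm; last by rewrite mulr_ge0 ?expR_ge0 ?exprn_ge0// ltW.
rewrite (gtr0_norm x0) expRN ler_pdivrMr ?expR_gt0//.
have H := @expR_ge1Dxn _ x^-1 m.+1 (ltW u0).
have -> : x^-1 ^+ m = x^+2 * x^-1 ^+ m.+2.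
  by rewrite -[m.+2]addn2 exprD mulrCA -exprMn mulfV ?gt_eqF// expr1n mulr1.
rewrite [leRHS]mulrAC [leLHS]mulrC ler_pM2r ?exprn_gt0//.
rewrite mulrC -ler_pdivrMr ?ltr0n ?fact_gt0//.
by apply: le_trans H; rewrite lerDr.
Qed.

Lemma is_derive_flat (m : nat) (x : R) :
  is_derive (x : R) 1 (flat m) (flat m.+2 x - m%:R * flat m.+1 x).
Proof.
have [x0|x0|->] := ltgtP x 0.
- rewrite !flat_le0 ?ltW// mulr0 subr0.
  apply: (@near_eq_is_derive _ _ _ (cst (0 : R))).
  near=> y; rewrite flat_le0//; apply/ltW; near: y; exact: lt_nbhsl.
- have E : is_derive (x : R) 1 (fun y => y^-1 ^+ m * expR (- y^-1))
     (flat m.+2 x - m%:R * flat m.+1 x).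
    have xn0 : x != 0 by rewrite gt_eqF.
    have dV : is_derive (x : R) 1 (fun y : R => y^-1) (- x^-1 ^+ 2).
      have := is_deriveV (f := fun y : R => y) xn0 (is_derive_id x 1).
      by rewrite /GRing.scale/= mulr1 exprVn.
    have dE : is_derive (x : R) 1 (fun y : R => expR (- y^-1)) (expR (- x^-1) * x^-1 ^+ 2).
      apply: (@is_derive1_comp _ expR (fun y => - y^-1)).
      by rewrite -[X in is_derive _ _ _ X]opprK; exact: is_deriveN.
    have dX : is_derive x 1 (fun y : R => y^-1 ^+ m) (m%:R * x^-1 ^+ m.-1 * (- x^-1 ^+ 2)).
      rewrite (_ : (fun y : R => _) = (fun y => y^-1) ^+ m); first exact: is_deriveX dV.
      by apply/funext => y; rewrite exprfctE.
    have dM := is_deriveM dX dE; apply: is_derive_eq.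
    rewrite /flat x0 /GRing.scale /=.
    case: m {dX dM} => [|m] /=.
      by move: (expR (- x^-1)) (x^-1) => E X; rewrite mul0r !mul0r; ring.
    rewrite !exprS expr0. move: (m.+1%:R) (expR (- x^-1)) (x^-1 ^+ m) (x^-1) => c E A X; ring.
  apply: near_eq_is_derive E.
  near=> y; rewrite /flat ifT//; near: y; exact: lt_nbhsr.
- rewrite !flat_le0// mulr0 subr0.
  have H : h^-1 *: (flat m (h *: 1 + 0) - flat m 0) @[h --> (0:R)^'] --> (0 : R).
    have H2 : (m.+2)`!%:R * `|h| @[h --> (0:R)^'] --> (0:R).
      rewrite -[X in _ --> X](mulr0 (m.+2)`!%:R).
      apply: cvgM; first exact: cvg_cst.
      apply: cvg_within_filter.
      by have := @norm_continuous _ R 0; rewrite /continuous_at normr0.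
    apply/cvgrPdist_lt => e e0.
    move/cvgrPdist_lt : H2 => /(_ _ e0) H2.
    near=> h; have h0 : h != 0 by near: h; exact: (nbhs_dnbhs_neq (0:R)).
    have : `|0 - (m.+2)`!%:R * `|h| | < e by near: h; exact: H2.
    apply: le_lt_trans; rewrite !sub0r !normrN.
    rewrite (flat_le0 _ (lexx _)) subr0 addr0 [h *: 1]mulr1 normrZ [leRHS]ger0_norm ?mulr_ge0//.
    rewrite normfV ler_pdivrMl ?normr_gt0// mulrCA -expr2.
    exact: flat_sqr_bound.
  by split; [apply/cvg_ex; exists 0|exact: cvg_lim].
Unshelve. all: by end_near. Qed.

Lemma smooth1_flat m : smooth1 (flat m).
Proof.
move=> n; elim: n m => [//|n IH] m.
apply: (CnS_is_derive (is_derive_flat m)).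
have -> : (fun x => flat m.+2 x - m%:R * flat m.+1 x) =
  (fun x => flat m.+2 x + (- m%:R) * flat m.+1 x) by apply/funext => x; rewrite mulNr.
by apply: CnD => //; apply: CnM => //; exact: Cn_cst.
Qed.

Lemma step_den_gt0 x : 0 < flat 0 x + flat 0 (1 - x).
Proof.
have [x0|x0] := ltP 0 x; first by rewrite ltr_wpDr ?flat_ge0 ?flat_gt0.
by rewrite ltr_wpDl ?flat_ge0 ?flat_gt0//; lra.
Qed.

Definition step (x : R) : R := flat 0 x / (flat 0 x + flat 0 (1 - x)).

Lemma smooth1_step : smooth1 step.
Proof.
apply: smooth1M; first exact: smooth1_flat.
move=> n; apply: CnV => [x|]; first by rewrite gt_eqF ?step_den_gt0.
apply: CnD; first exact: smooth1_flat.
apply: (@Cn_comp _ _ (flat 0) (fun x => 1 - x)); first exact: smooth1_flat.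
have -> : (fun x : R => 1 - x) = (fun x => 1 + (-1) * x) by apply/funext => x; rewrite mulN1r.
by apply: CnD; [exact: Cn_cst|apply: CnM; [exact: Cn_cst|exact: Cn_id]].
Qed.

Lemma step_le0 x : x <= 0 -> step x = 0.
Proof. by move=> x0; rewrite /step flat_le0// mul0r. Qed.

Lemma step_ge1 x : 1 <= x -> step x = 1.
Proof.
move=> x1; rewrite /step (@flat_le0 _ (1 - x)); last lra.
by rewrite addr0 divff// gt_eqF// flat_gt0//; lra.
Qed.

Lemma step_itv x : 0 <= step x <= 1.
Proof.
rewrite /step divr_ge0 ?flat_ge0 ?(ltW (step_den_gt0 _))//=.
by rewrite ler_pdivrMr ?step_den_gt0// mul1r lerDl flat_ge0.
Qed.

(** Equal to 1 on |t - c| <= e/2 because (4/3)(1 - 1/4) = 1, and to 0 where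
|t - c| >= e. *)
Definition sbump (c e : R) (t : R) : R := step (4 / 3 * (1 - ((t - c) / e) ^+ 2)).

Lemma smooth1_sbump c e : smooth1 (sbump c e).
Proof.
apply: (@smooth1_comp _ step); first exact: smooth1_step.
have -> : (fun t : R => 4 / 3 * (1 - ((t - c) / e) ^+ 2)) =
  (fun t => 4 / 3 * (1 + (-1) * ((t + (- c)) * e^-1 * ((t + (- c)) * e^-1)))).
  by apply/funext => t; rewrite mulN1r expr2.
have s1 : smooth1 (fun t : R => (t + (- c)) * e^-1).
  apply: smooth1M; last exact: smooth1_cst.
  by apply: smooth1D; [exact: smooth1_id|exact: smooth1_cst].
apply: smooth1M; first exact: smooth1_cst.
apply: smooth1D; first exact: smooth1_cst.
by apply: smooth1M; [exact: smooth1_cst|exact: smooth1M].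
Qed.

Lemma sbump_itv c e t : 0 <= sbump c e t <= 1. Proof. exact: step_itv. Qed.

Lemma sbump_out c e t : 0 < e -> e <= `|t - c| -> sbump c e t = 0.
Proof.
move=> e0 te; apply: step_le0.
have : 1 <= ((t - c) / e) ^+ 2.
  rewrite -real_normK ?num_real// expr_ge1// normrM normfV (gtr0_norm e0).
  by rewrite ler_pdivlMr// mul1r.
by move=> h; apply: mulr_ge0_le0; lra.
Qed.

Lemma sbump_in c e t : 0 < e -> `|t - c| <= e / 2 -> sbump c e t = 1.
Proof.
move=> e0 te; apply: step_ge1.
have : ((t - c) / e) ^+ 2 <= 2^-1 ^+ 2.
  rewrite -real_normK ?num_real// lerXn2r ?nnegrE//.
  by rewrite normrM normfV (gtr0_norm e0) ler_pdivrMr// mulrC.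
by move=> h; lra.
Qed.

End flat.

(** * One-dimensional oscillatory integrals *)
Section ibp.
Context {R : realType}.
Notation leb := (@lebesgue_measure R).

Lemma is_derive_continuous (f : R -> R) (x d : R) :
  is_derive x 1 f d -> {for x, continuous f}.
Proof.
by move=> df; apply/differentiable_continuous/derivable1_diffP; exact: ex_derive.
Qed.

Lemma within_itv_continuous (f : R -> R) (a b : R) :
  (forall x, a <= x <= b -> {for x, continuous f}) ->
  {within `[a, b], continuous f}.
Proof.
by move=> cf; apply: continuous_in_subspaceT => x; rewrite inE/= in_itv/= => /cf.
Qed.

Lemma integrable_itv (f : R -> R) (a b : R) :
  (forall x, a <= x <= b -> {for x, continuous f}) ->
  leb.-integrable `[a, b] (EFin \o f).
Proof.
move=> cf; apply: continuous_compact_integrable; first exact: segment_compact.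
exact: within_itv_continuous.
Qed.

Lemma Rintegral_itv_le (f : R -> R) (a b c : R) : a <= b ->
  (forall x, a <= x <= b -> {for x, continuous f}) ->
  (forall x, a <= x <= b -> `|f x| <= c) ->
  `|\int[leb]_(x in `[a, b]) f x| <= c * (b - a).
Proof.
move=> ab cf fc; have fi := integrable_itv cf.
apply: le_trans (le_normr_Rintegral _ fi) _ => //.
apply: (@le_trans _ _ (\int[leb]_(x in `[a, b]) c)).
  have ci : leb.-integrable `[a, b] (EFin \o (fun=> c)).
    by apply: integrable_itv => x _; exact: cst_continuous.
  apply: (le_Rintegral _ (integrable_norm fi) ci) => // x /=.
rewrite Rintegral_cst//= lebesgue_measure_itv/= lte_fin.
move: ab; rewrite le_eqVlt => /predU1P[->|ab]; first by rewrite ltxx subrr.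
by rewrite ab.
Qed.

Lemma ibp0 (F f G g : R -> R) (a b : R) : a < b ->
  (forall x, a <= x <= b -> is_derive x 1 F (f x)) ->
  (forall x, a <= x <= b -> is_derive x 1 G (g x)) ->
  (forall x, a <= x <= b -> {for x, continuous f}) ->
  (forall x, a <= x <= b -> {for x, continuous g}) ->
  F a = 0 -> F b = 0 ->
  \int[leb]_(x in `[a, b]) (F x * g x) = - \int[leb]_(x in `[a, b]) (f x * G x).
Proof.
move=> ab dF dG cf cg Fa Fb.
have D (H h : R -> R) : (forall x, a <= x <= b -> is_derive x 1 H (h x)) ->
    derivable_oo_LRcontinuous H a b /\ {in `]a, b[, derive1 H =1 h}.
  move=> dH; split.
    split.
    - by move=> x; rewrite in_itv/= => /andP[ax xb]; have [] := dH x; rewrite ?(ltW ax) ?(ltW xb).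
    - by apply: cvg_at_right_filter; apply: (is_derive_continuous (dH a _)); rewrite lexx ltW.
    - by apply: cvg_at_left_filter; apply: (is_derive_continuous (dH b _)); rewrite lexx ltW.
  move=> x; rewrite in_itv/= => /andP[ax xb]; rewrite derive1E.
  have xab : a <= x <= b by rewrite (ltW ax) (ltW xb).
  by have := dH x xab => ?; exact: derive_val.
have [F1 F2] := D _ _ dF; have [G1 G2] := D _ _ dG.
rewrite (@Rintegration_by_parts _ F G f g)//; try exact: within_itv_continuous.
by rewrite Fa Fb !mul0r subrr sub0r.
Qed.

End ibp.

Section nonstat.
Context {R : realType}.
Notation leb := (@lebesgue_measure R).

Definition supp_in (a b : R) (g : R -> R) := forall t, ~~ (a <= t <= b) -> g t = 0.

Lemma supp_in_derive1 a b g : supp_in a b g -> supp_in a b (derive1 g).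
Proof.
move=> sg t tab; rewrite derive1E.
rewrite (@near_eq_derive _ _ _ g (cst (0:R)) t 1) ?derive_cst//.
move: tab; rewrite negb_and -!ltNge => /orP[ta|bt].
  near=> y; rewrite sg// negb_and -ltNge; apply/orP; left.
  by near: y; exact: lt_nbhsl.
near=> y; rewrite sg// negb_and -!ltNge; apply/orP; right.
by near: y; exact: lt_nbhsr.
Unshelve. all: by end_near. Qed.

Lemma supp_in_bounded a b g : smooth1 g -> supp_in a b g ->
  exists2 M, 0 <= M & forall t, `|g t| <= M.
Proof.
move=> gs sg; have [ab|ba] := leP a b; last first.
  exists 0 => // t; rewrite sg ?normr0//; apply: contraTN ba => /andP[at_ tb].
  by rewrite -leNgt (le_trans at_).
have [] := @EVT_max _ (fun t => `|g t|) a b ab.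
  apply: within_itv_continuous => x _.
  apply: (@continuous_comp _ _ _ g (fun y : R => `|y|)).
    exact: smooth1_continuous.
  exact: norm_continuous.
move=> c _ H; exists `|g c| => // t.
have [tab|tab] := boolP (a <= t <= b); last by rewrite sg// normr0.
by apply: H; rewrite in_itv.
Qed.

Definition phase (al be ga t : R) := al * t ^+ 2 + be * t + ga.

Lemma is_derive_phase (al be ga t : R) :
  is_derive t 1 (phase al be ga) (2 * al * t + be).
Proof.
have -> : phase al be ga = fun t => (al * t + be) * t + ga.
  by apply/funext => s; rewrite /phase expr2; ring.
have d1 : is_derive t 1 (fun t : R => al * t + be) (al * 1 + 0).
  exact: (is_deriveD (is_deriveZ al (is_derive_id t 1)) (is_derive_cst be t 1)).
have d2 : is_derive t 1 (fun t : R => (al * t + be) * t) ((al * t + be) * 1 + t * (al * 1 + 0)).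
  exact: (is_deriveM d1 (is_derive_id t 1)).
apply: (is_derive_eq (is_deriveD d2 (is_derive_cst ga t 1))).
by ring.
Qed.

Lemma is_derive_lin (al be t : R) :
  is_derive t 1 (fun t => 2 * al * t + be) (2 * al).
Proof.
apply: (is_derive_eq (is_deriveD (is_deriveZ (2 * al) (is_derive_id t 1)) (is_derive_cst be t 1))).
by rewrite addr0 [_ *: _]mulr1.
Qed.

Lemma sin_cosB (x : R) : sin x = cos (x - pi / 2).
Proof. by rewrite cosB cos_pihalf sin_pihalf mulr0 mulr1 add0r. Qed.

(** Integration by parts against the derivative q = 2 al t + be of the phase.
With v = rho / q, which is bounded by 1 / del, and v' = - (2 al / rho) v^2 with
|2 al / rho| <= 2, each step gains a factor 1 / rho and leaves integrals of the
same form with exponents m + 1 and m + 2 of v. This is why m is part of the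
induction, and the phase constant ga takes care of sin versus cos. The bound is
uniform in al, be and ga. *)
Lemma nonstationary_real (N : nat) : forall (g : R -> R) (a' b' a b del : R) (m : nat),
  smooth1 g -> supp_in a' b' g -> a < a' -> b' < b -> a < b -> 0 < del ->
  exists2 C, 0 <= C & forall al be ga rho, 1 <= rho -> `|al| <= rho ->
    (forall t, a <= t <= b -> del * rho <= `|2 * al * t + be|) ->
    `|\int[leb]_(t in `[a, b])
       (g t * (rho / (2 * al * t + be)) ^+ m * cos (phase al be ga t))| <= C / rho ^+ N.
Proof.
elim: N => [|N IH] g a' b' a b del m gs sg aa' b'b ab del0.
  have [M M0 gM] := supp_in_bounded gs sg.
  exists (M * del ^- m * (b - a)).
    by rewrite !mulr_ge0 ?subr_ge0 ?invr_ge0 ?exprn_ge0// ?ltW.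
  move=> al be ga rho rho1 alrho H; rewrite expr0 divr1.
  have rho0 : 0 < rho by rewrite (lt_le_trans _ rho1).
  have D0 t : a <= t <= b -> 2 * al * t + be != 0.
    by move=> /H; rewrite -normr_gt0; apply: lt_le_trans; rewrite mulr_gt0.
  apply: Rintegral_itv_le; first exact: ltW.
    move=> x xab; apply: continuousM; last first.
      apply: (@continuous_comp _ _ _ (phase al be ga) cos).
        exact: is_derive_continuous (is_derive_phase _ _ _ _).
      exact: continuous_cos.
    apply: continuousM; first exact: smooth1_continuous.
    apply: (@continuous_comp _ _ _ (fun t => rho / (2 * al * t + be)) (fun y : R => y ^+ m)); last first.
      exact: exprn_continuous.
    apply: continuousM; first exact: cst_continuous.
    apply: (@continuousV _ _ (fun t => 2 * al * t + be)); first exact: D0.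
    exact: is_derive_continuous (is_derive_lin _ _ _).
  move=> x xab; rewrite !normrM -[leRHS]mulr1 ler_pM ?mulr_ge0//; last first.
    by rewrite ler_norml cos_geN1 cos_le1.
  rewrite ler_pM// -exprVn normrX lerXn2r ?nnegrE ?invr_ge0 ?(ltW del0)//.
  rewrite normrM normfV (gtr0_norm rho0) ler_pdivrMr ?normr_gt0 ?D0//.
  by rewrite ler_pdivlMl// H.
have [C1 C10 H1] := IH (derive1 g) a' b' a b del m.+1 (smooth1_derive1 gs)
  (supp_in_derive1 sg) aa' b'b ab del0.
have [C2 C20 H2] := IH g a' b' a b del m.+2 gs sg aa' b'b ab del0.
exists (C1 + 2 * m.+1%:R * C2); first by rewrite addr_ge0// !mulr_ge0.
move=> al be ga rho rho1 alrho H.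
have rho0 : 0 < rho by rewrite (lt_le_trans _ rho1).
have rhon0 : rho != 0 by rewrite gt_eqF.
have D0 t : a <= t <= b -> 2 * al * t + be != 0.
  by move=> /H; rewrite -normr_gt0; apply: lt_le_trans; rewrite mulr_gt0.
pose v t := rho / (2 * al * t + be).
have dv t : a <= t <= b -> is_derive t 1 v (- (2 * al / rho) * v t ^+ 2).
  move=> tab; have Dt := D0 t tab; 
  have dVt := is_deriveV (f := fun t => 2 * al * t + be) Dt (is_derive_lin al be t).
  apply: (is_derive_eq (is_deriveZ rho dVt)).
  by rewrite /v /GRing.scale/= -exprVn; field; rewrite Dt rhon0.
have dvm n t : a <= t <= b ->
    is_derive t 1 (fun t => v t ^+ n.+1) (- (n.+1%:R * (2 * al / rho)) * v t ^+ n.+2).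
  move=> tab; rewrite (_ : (fun t => _) = v ^+ n.+1); last first.
    by apply/funext => y; rewrite exprfctE.
  apply: is_derive_eq; first exact: (is_deriveX n.+1 (dv t tab)).
  rewrite /GRing.scale/= [v t ^+ n.+2]exprS [v t ^+ n.+1]exprS expr2.
  by move: (v t ^+ n) (v t) (n.+1%:R) => A B c; ring.
have cv n t : a <= t <= b -> {for t, continuous (fun t => v t ^+ n)}.
  move=> tab; apply: (@continuous_comp _ _ _ v (fun y : R => y ^+ n)); last exact: exprn_continuous.
  exact: is_derive_continuous (dv t tab).
(* g v^m cos(phase) = (g v^(m+1) / rho) (q cos(phase)), the second factor being the derivative of sin(phase) *)
pose F t := rho^-1 * (g t * v t ^+ m.+1).
pose f t := rho^-1 * (g t * (- (m.+1%:R * (2 * al / rho)) * v t ^+ m.+2) + v t ^+ m.+1 * derive1 g t).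
pose G t := sin (phase al be ga t).
pose g_ t := cos (phase al be ga t) * (2 * al * t + be).
have cph (c : R) t : {for t, continuous (fun t => cos (phase al be c t))}.
  apply: (@continuous_comp _ _ _ (phase al be c) cos).
    exact: is_derive_continuous (is_derive_phase _ _ _ _).
  exact: continuous_cos.
have cg := smooth1_continuous gs.
have cg' := smooth1_continuous (smooth1_derive1 gs).
have -> : \int[leb]_(t in `[a, b]) (g t * v t ^+ m * cos (phase al be ga t)) =
  \int[leb]_(t in `[a, b]) (F t * g_ t).
  apply: eq_Rintegral => t; rewrite inE/= in_itv/= => tab.
  rewrite /F /g_ [v t ^+ m.+1]exprS {2}/v.
  by move: (D0 t tab) => Dt; field; rewrite Dt rhon0.
have IB : \int[leb]_(t in `[a, b]) (F t * g_ t) = - \int[leb]_(t in `[a, b]) (f t * G t).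
  apply: ibp0 => //.
  - move=> x xab; apply: (is_deriveZ rho^-1 (f := fun t => g t * v t ^+ m.+1)).
    exact: (is_deriveM (smooth1_is_derive x gs) (dvm m x xab)).
  - move=> x xab; apply: (@is_derive1_comp _ sin (phase al be ga)).
    exact: is_derive_phase.
  - move=> x xab; apply: continuousM; first exact: cst_continuous.
    apply: continuousD; last by apply: continuousM; [exact: cv|exact: cg'].
    apply: continuousM; first exact: cg.
    by apply: continuousM; [exact: cst_continuous|exact: cv].
  - move=> x xab; apply: continuousM; first exact: cph.
    exact: is_derive_continuous (is_derive_lin _ _ _).
  - by rewrite /F sg ?mul0r ?mulr0// negb_and -ltNge aa'.
  - by rewrite /F sg ?mul0r ?mulr0// negb_and -!ltNge b'b orbT.
rewrite IB normrN.
  have -> : \int[leb]_(x in `[a, b]) (f x * G x) =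
    rho^-1 * (\int[leb]_(t in `[a, b]) (derive1 g t * v t ^+ m.+1 * cos (phase al be (ga - pi / 2) t)) +
     (- (m.+1%:R * (2 * al / rho))) *
      \int[leb]_(t in `[a, b]) (g t * v t ^+ m.+2 * cos (phase al be (ga - pi / 2) t))).
    have i1 n (h : R -> R) : continuous h -> leb.-integrable `[a, b]
        (EFin \o (fun t => h t * v t ^+ n * cos (phase al be (ga - pi / 2) t))).
      move=> ch; apply: integrable_itv => x xab.
      apply: continuousM; last exact: cph.
      by apply: continuousM; [exact: ch|exact: cv].
    rewrite -RintegralZl//; last exact: i1.
    rewrite -RintegralD//; last 2 first.
    - exact: i1.
    - exact: (integrableZl _ _ (i1 _ _ cg)).
    rewrite -RintegralZl//; last first.
      by apply: (integrableD _ (i1 _ _ cg') (integrableZl _ _ (i1 _ _ cg))).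
    apply: eq_Rintegral => t _; rewrite /f /G sin_cosB.
    have -> : phase al be ga t - pi / 2 = phase al be (ga - pi / 2) t by rewrite /phase; ring.
    by move: (v t ^+ m.+1) (v t ^+ m.+2) (cos _) (m.+1%:R) => A B c d; ring.
  rewrite [rho ^+ N.+1]exprS invfM [leRHS]mulrCA normrM normfV (gtr0_norm rho0) ler_pM2l ?invr_gt0//.
  apply: le_trans (ler_normD _ _) _; rewrite [leRHS]mulrDl; apply: lerD.
    exact: H1.
  rewrite normrM -!mulrA [C2 / _]mulrC; apply: (@le_trans _ _ (2 * m.+1%:R * (C2 / rho ^+ N))).
    rewrite ler_pM//; last exact: H2.
    rewrite normrN normrM ger0_norm// mulrC ler_pM2r ?ltr0n//.
    rewrite normrM normr_nat -[leRHS]mulr1 ler_pM2l// normrM normfV (gtr0_norm rho0).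
    by rewrite ler_pdivrMr// mul1r.
  by rewrite -!mulrA [C2 / _]mulrC.
Qed.

End nonstat.

Section chirp_int.
Context {R : realType}.
Notation leb := (@lebesgue_measure R).

(** The building block of the proof: at fixed (s, la) the whole oscillatory
integral is a product of four of these. *)
Definition chirp_int (g : R -> R) (al be : R) : R[i] :=
  cint leb (fun t => (g t)%:C * expi (al * t ^+ 2 + be * t)).

Lemma smooth1_integrable a b (g : R -> R) : smooth1 g -> supp_in a b g ->
  leb.-integrable setT (EFin \o g).
Proof.
move=> gs sg.
have := @integrable_itv R g a b (fun x _ => smooth1_continuous gs (x := x)).
move/integrable_mkcond => H; have := H (measurable_itv _).
congr (_.-integrable _ _); apply/funext => x; rewrite restrict_EFin /= patchE.
by case: ifPn => //; rewrite notin_setE/= in_itv/= => /negP/sg ->.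
Qed.

Lemma Rintegral_supp (g h : R -> R) (a b : R) : supp_in a b g ->
  \int[leb]_t (g t * h t) = \int[leb]_(t in `[a, b]) (g t * h t).
Proof.
move=> sg; rewrite [RHS]Rintegral_mkcond; apply: eq_Rintegral => t _.
rewrite patchE; case: ifPn => //; rewrite notin_setE/= in_itv/= => /negP/sg ->.
by rewrite mul0r.
Qed.

Lemma supp_inW a b a' b' (g : R -> R) : a <= a' -> b' <= b -> supp_in a' b' g -> supp_in a b g.
Proof.
move=> aa bb sg t; move=> tab; apply: sg; apply: contra tab => /andP[h1 h2].
by rewrite (le_trans aa h1) (le_trans h2 bb).
Qed.

Lemma chirp_int_ReE (g : R -> R) a b al be : supp_in a b g ->
  complex.Re (chirp_int g al be) = \int[leb]_(t in `[a, b]) (g t * cos (phase al be 0 t)).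
Proof.
move=> sg; rewrite /chirp_int /cint /cintegral /= -Rintegral_supp//.
by apply: eq_Rintegral => t _; rewrite /= mul0r subr0 /phase addr0.
Qed.

Lemma chirp_int_ImE (g : R -> R) a b al be : supp_in a b g ->
  complex.Im (chirp_int g al be) = \int[leb]_(t in `[a, b]) (g t * cos (phase al be (- (pi / 2)) t)).
Proof.
move=> sg; rewrite /chirp_int /cint /cintegral /= -Rintegral_supp//.
by apply: eq_Rintegral => t _; rewrite /= mul0r addr0 /phase sin_cosB.
Qed.

Lemma chirp_int_bounded (g : R -> R) a b : smooth1 g -> supp_in a b g ->
  exists2 C, 0 <= C & forall al be, cabs (chirp_int g al be) <= C.
Proof.
move=> gs sg; have ig := smooth1_integrable gs sg.
have ing := integrable_norm ig.
exists (2 * \int[leb]_t `|g t|).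
  by rewrite mulr_ge0// Rintegral_ge0.
move=> al be; apply: cabs_cint_le => //.
  apply: cmeasurableM; first by apply: cmeasurable_real; exact: smooth1_measurable.
  apply: cmeasurable_expi; rewrite [X in measurable_fun _ X](_ : _ = phase al be 0).
    by apply: continuous_measurable_fun => x; exact: is_derive_continuous (is_derive_phase al be 0 x).
  by apply/funext => t; rewrite /phase addr0.
by move=> x; rewrite cabsM cabs_expi mulr1 cabsC.
Qed.

(** The support is enlarged from [a', b'] to [a, b] so that the boundary terms
vanish; for rho < 1 the trivial bound is enough. *)
Lemma chirp_int_decay (N : nat) (g : R -> R) (a' b' a b del : R) :
  smooth1 g -> supp_in a' b' g -> a < a' -> b' < b -> a < b -> 0 < del ->
  exists2 C, 0 <= C & forall al be rho, 0 <= rho -> `|al| <= rho ->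
    (forall t, a <= t <= b -> del * rho <= `|2 * al * t + be|) ->
    cabs (chirp_int g al be) <= C / (1 + rho) ^+ N.
Proof.
move=> gs sg aa' b'b ab del0.
have [C1 C10 H1] := nonstationary_real N 0 gs sg aa' b'b ab del0.
have [C2 C20 H2] := chirp_int_bounded gs sg.
have sab : supp_in a b g by apply: supp_inW sg; exact: ltW.
exists (2 ^+ N * (2 * C1 + C2)); first by rewrite mulr_ge0// addr_ge0// mulr_ge0.
move=> al be rho rho0 alrho H.
have rho1 : 0 < 1 + rho by rewrite ltr_pwDl.
rewrite ler_pdivlMr ?exprn_gt0//.
have [rhole|rhogt] := leP 1 rho; last first.
  rewrite mulrC; apply: ler_pM; rewrite ?cabs_ge0 ?exprn_ge0 ?(ltW rho1)//.
    by rewrite lerXn2r ?nnegrE ?(ltW rho1)//; lra.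
  by apply: le_trans (H2 _ _) _; rewrite lerDr mulr_ge0.
have rhop : 0 < rho by rewrite (lt_le_trans _ rhole).
have B : cabs (chirp_int g al be) <= 2 * C1 / rho ^+ N.
  apply: le_trans (cabs_le _) _.
  rewrite (chirp_int_ReE _ _ sab) (chirp_int_ImE _ _ sab) mulr2n !mulrDl mul1r.
  have E (c : R) : \int[leb]_(t in `[a, b]) (g t * cos (phase al be c t)) =
    \int[leb]_(t in `[a, b]) (g t * (rho / (2 * al * t + be)) ^+ 0 * cos (phase al be c t)).
    by apply: eq_Rintegral => t _; rewrite expr0 mulr1.
  by rewrite !E; apply: lerD; exact: H1.
apply: (@le_trans _ _ (2 * C1 / rho ^+ N * (2 * rho) ^+ N)).
  apply: ler_pM; rewrite ?cabs_ge0 ?exprn_ge0 ?(ltW rho1)//.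
  by rewrite lerXn2r ?nnegrE ?mulr_ge0 ?(ltW rho1)//; lra.
rewrite exprMn [_ * rho ^+ N]mulrC mulrA divfK ?expf_neq0 ?gt_eqF// mulrC.
by rewrite ler_wpM2l ?exprn_ge0// lerDl.
Qed.

Lemma cmeasurable_chirp_int (g : R -> R) : measurable_fun setT g ->
  cmeasurable (fun z : R * R => chirp_int g z.1 z.2).
Proof.
move=> mg; apply: (@cmeasurable_param_cint _ _ _ _ _ leb
  (fun w : (R * R) * R => (g w.2)%:C * expi (w.1.1 * w.2 ^+ 2 + w.1.2 * w.2))).
apply: cmeasurableM.
  by apply: cmeasurable_real; apply: measurableT_comp => //.
apply: cmeasurable_expi; apply: measurable_funD; apply: measurable_funM.
- by apply: (measurableT_comp (@measurable_fst _ _ _ _)).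
- by apply: measurable_funX; exact: measurable_snd.
- by apply: (measurableT_comp (@measurable_snd _ _ _ _)).
- exact: measurable_snd.
Qed.

End chirp_int.

(** * Polar coordinates in a half-plane *)
Section Rint_aux.
Context {R : realType}.
Notation leb := (@lebesgue_measure R).

Lemma Rintegral_indic d (T : measurableType d) (mu : {measure set T -> \bar R})
   (D : set T) (f : T -> R) :
  \int[mu]_(x in D) f x = \int[mu]_x (\1_D x * f x).
Proof.
rewrite Rintegral_mkcond; apply: eq_Rintegral => x _.
by rewrite patchE indicE; case: ifP => _; rewrite ?mul1r ?mul0r.
Qed.

Lemma Rintegral_eq0 d (T : measurableType d) (mu : {measure set T -> \bar R})
   (f : T -> R) : (forall x, f x = 0) -> \int[mu]_x f x = 0.
Proof. by move=> f0; rewrite /Rintegral integral0_eq// => x _; rewrite f0. Qed.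

Lemma Rintegral_eq_supp d (T : measurableType d) (mu : {measure set T -> \bar R})
   (D E : set T) (f : T -> R) :
  (forall x, f x != 0 -> D x <-> E x) ->
  \int[mu]_(x in D) f x = \int[mu]_(x in E) f x.
Proof.
move=> DE; rewrite [LHS]Rintegral_indic [RHS]Rintegral_indic; apply: eq_Rintegral => x _.
have [->|/DE fx0] := eqVneq (f x) 0; first by rewrite !mulr0.
suff e : (x \in D) = (x \in E) by rewrite !indicE e.
by apply/idP/idP; rewrite !inE => /fx0.
Qed.

Lemma integrable_cst_indic_itv (c a b : R) :
  leb.-integrable setT (EFin \o (fun x => c * \1_`[a, b] x)).
Proof.
have H := @integrable_indic_itv R a b true false.
exact: (integrableZl _ c H).
Qed.

Lemma measurable_indic_itv (i : interval R) : measurable_fun setT (\1_[set` i] : R -> R).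
Proof. exact: measurable_indic. Qed.

Lemma Rsubst (F f g : R -> R) (a b a2 b2 : R) : a2 < a -> a <= b -> b < b2 ->
  (forall x, a2 < x < b2 -> is_derive x 1 F (f x)) ->
  (forall x, a2 < x < b2 -> {for x, continuous f}) ->
  {in `[a, b] &, {homo F : x y / x < y}} ->
  continuous g ->
  \int[leb]_(x in `[F a, F b]) g x = \int[leb]_(x in `[a, b]) (g (F x) * f x).
Proof.
move=> a2a ab bb2 dF cf incr cg.
have inab x : a <= x <= b -> a2 < x < b2.
  by move=> /andP[ax xb]; rewrite (lt_le_trans a2a ax) (le_lt_trans xb bb2).
have cF x : a <= x <= b -> {for x, continuous F}.
  by move=> /inab xab; exact: is_derive_continuous (dF x xab).
have E x : a2 < x < b2 -> derive1 F x = f x.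
  by move=> xab; have ? := dF x xab; rewrite derive1E derive_val.
have cF' x : a <= x <= b -> {for x, continuous (derive1 F)}.
  move=> /inab xab; rewrite /prop_for/continuous_at E//.
  apply: cvg_trans (cf x xab); apply: near_eq_cvg.
  move/andP : xab => [ax xb]; near=> y; rewrite E//; apply/andP; split.
    by near: y; exact: lt_nbhsr.
  by near: y; exact: lt_nbhsl.
have aab : a <= a <= b by rewrite lexx.
have bab : a <= b <= b by rewrite lexx andbT.
rewrite /Rintegral (@integration_by_substitution_increasing _ F g a b)//.
- congr fine; apply: eq_integral => x; rewrite inE/= in_itv/= => /inab xab.
  by rewrite -E.
- by move=> x; rewrite in_itv/= => /andP[ax xb]; apply: cF'; rewrite !ltW.
- by apply/cvg_ex; exists (derive1 F a); apply: cvg_at_right_filter; exact: cF'.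
- by apply/cvg_ex; exists (derive1 F b); apply: cvg_at_left_filter; exact: cF'.
- split.
  + move=> x; rewrite in_itv/= => /andP[ax xb].
    by have [] := dF x (inab x _); rewrite ?(ltW ax) ?(ltW xb).
  + by apply: cvg_at_right_filter; exact: cF.
  + by apply: cvg_at_left_filter; exact: cF.
- exact: continuous_subspaceT.
Unshelve. all: by end_near. Qed.

End Rint_aux.

(** The change of variables is carried out one variable at a time. The support
of G lies in c <= y <= d, |u - s| <= m, hence in the sector |a| <= A about the
point (0, s), on which cos a >= cos A > 0. After exchanging the integrals,
y = t cos a replaces t for fixed a, and, after a second exchange,
u = s + y tan a replaces a for fixed y. *)
Section polar.
Context {R : realType}.
Notation leb := (@lebesgue_measure R).
Variables (G : R * R -> R) (s c d m M : R).
Hypothesis c0 : 0 < c.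
Hypothesis cd : c <= d.
Hypothesis m0 : 0 <= m.
Hypothesis mG : measurable_fun setT G.
Hypothesis ctG : continuous G.
Hypothesis GM : forall z, `|G z| <= M.
Hypothesis suppG : forall y u, G (y, u) != 0 -> c <= y <= d /\ `|u - s| <= m.

Let continuous_G (f g : R -> R) x : {for x, continuous f} -> {for x, continuous g} ->
  {for x, continuous (fun a => G (f a, g a))}.
Proof.
move=> cf cg; apply: (@continuous_comp _ _ _ (fun a => (f a, g a)) G); last exact: ctG.
exact: (cvg_pair cf cg).
Qed.

Let cid (x : R) : {for x, continuous (fun y : R => y)}.
Proof. exact: cvg_id. Qed.

(* the 1 added to m / c makes A positive even when m = 0 *)
Let A : R := atan (m / c + 1).
Let T : R := d / cos A.
Let Gpolar t a := G (t * cos a, s + t * sin a).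

Let tanA : tan A = m / c + 1. Proof. exact: atanK. Qed.
Let A_pihalf : A < pi / 2. Proof. exact: atan_ltpi2. Qed.
Let A0 : 0 < A.
Proof.
rewrite -ltr_tan ?tan0 ?tanA ?ltr_wpDl// ?divr_ge0 ?(ltW c0)// in_itv/=.
  by rewrite oppr_lt0 divr_gt0 ?pi_gt0.
by rewrite atan_gtNpi2 atan_ltpi2.
Qed.
Let cosA : 0 < cos A.
Proof. by rewrite cos_gt0_pihalf// A_pihalf atan_gtNpi2. Qed.
Let pi2 : pi / 2 < pi :> R.
Proof. by have := pi_gt0 R; lra. Qed.
Let d0 : 0 < d. Proof. exact: lt_le_trans cd. Qed.

Let cos_norm (a : R) : cos `|a| = cos a.
Proof. by have [a0|a0] := leP 0 a; [rewrite ger0_norm|rewrite ltr0_norm// cosN]. Qed.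

Let cosA_le a : `|a| <= A -> cos A <= cos a.
Proof.
move=> aA; rewrite -(cos_norm a) leNgt; apply/negP => h.
have : `|a| < A \/ `|a| = A by move: aA; rewrite le_eqVlt => /orP[/eqP|]; [right|left].
case=> [aA'|aA']; last by rewrite aA' ltxx in h.
have : cos A < cos `|a|.
  rewrite ltr_cos// in_itv/=.
    by rewrite normr_ge0 (le_trans aA)// ltW// (lt_trans A_pihalf).
  by rewrite (ltW A0) ltW// (lt_trans A_pihalf).
by rewrite ltNge ltW.
Qed.

Let Gpolar_supp t a : 0 < t -> `|a| <= pi -> Gpolar t a != 0 -> `|a| <= A.
Proof.
move=> t0 api /suppG[/andP[ct td]]; rewrite [s + _]addrC addrK => um.
have ca : 0 < cos a by rewrite -(pmulr_rgt0 _ t0) (lt_le_trans c0).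
have api2 : `|a| < pi / 2.
  rewrite ltNge; apply/negP => h.
  have : cos `|a| <= cos (pi / 2).
    move: h; rewrite le_eqVlt => /orP[/eqP<-//|h]; apply: ltW.
    by rewrite ltr_cos// in_itv/= ?normr_ge0 ?api// divr_ge0 ?pi_ge0//= ltW.
  by rewrite cos_pihalf cos_norm leNgt ca.
rewrite leNgt; apply/negP => Aa.
have : tan A < tan `|a|.
  rewrite ltr_tan// in_itv/=.
    by rewrite A_pihalf andbT (lt_trans _ A0)// oppr_lt0 divr_gt0// pi_gt0.
  by rewrite api2 andbT (lt_le_trans _ (normr_ge0 _))// oppr_lt0 divr_gt0// pi_gt0.
rewrite tanA; apply/negP; rewrite -leNgt.
apply: (@le_trans _ _ (m / c)); last by rewrite lerDl.
rewrite /tan cos_norm.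
have -> : sin `|a| / cos a = (t * sin `|a|) / (t * cos a).
  by field; rewrite !gt_eqF.
apply: (@le_trans _ _ (m / (t * cos a))).
  rewrite ler_pM2r ?invr_gt0 ?mulr_gt0//; apply: le_trans um.
  rewrite normrM (gtr0_norm t0) ler_pM2l//; have [a0|a0] := leP 0 a.
    by rewrite (ger0_norm a0) ler_norm.
  by rewrite (ltr0_norm a0) sinN -normrN ler_norm.
by rewrite ler_wpM2l// lef_pV2// posrE ?mulr_gt0.
Qed.

Let Gpolar_suppT t a : `|a| <= A -> Gpolar t a != 0 -> 0 < t <= T.
Proof.
move=> aA /suppG[/andP[ct td] _].
have ca := lt_le_trans cosA (cosA_le aA).
have t0 : 0 < t by rewrite -(pmulr_lgt0 _ ca) (lt_le_trans c0).
rewrite t0 /T ler_pdivlMr//; apply: le_trans td.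
by rewrite ler_pM2l// cosA_le.
Qed.

Let continuous_Gpolar t x : {for x, continuous (fun a => t * Gpolar t a)}.
Proof.
apply: (@continuousM _ _ (fun=> t)); first exact: cst_continuous.
apply: continuous_G.
  by apply: (@continuousM _ _ (fun=> t)); [exact: cst_continuous|exact: continuous_cos].
apply: (@continuousD _ _ _ (fun=> s)); first exact: cst_continuous.
by apply: (@continuousM _ _ (fun=> t)); [exact: cst_continuous|exact: continuous_sin].
Qed.

(** By periodicity the circle may be parametrized by [-pi, pi], which the support
cuts down to [-A, A]. *)
Let polar_angle_range t : 0 < t -> \int[leb]_(a in `[0, 2 * pi]) (t * Gpolar t a) =
  \int[leb]_(a in `[-A, A]) (t * Gpolar t a).
Proof.
move=> t0; set h := fun a => t * Gpolar t a.
have pi0 := pi_gt0 R.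
have hi a b : leb.-integrable `[a, b] (EFin \o h) by apply: integrable_itv => x _; exact: continuous_Gpolar.
have e1 : \int[leb]_(a in `[0, 2 * pi]) h a =
    \int[leb]_(a in `[0, pi]) h a + \int[leb]_(a in `[pi, 2 * pi]) h a.
  have := @Rintegral_itvB _ h (BLeft 0) (BRight (2 * pi)) pi (hi _ _).
  rewrite !bnd_simp => /(_ (ltW pi0)) HH1.
  have p2 : pi <= 2 * pi :> R by rewrite ler_peMl ?ler1n// ltW.
  have := HH1 p2; rewrite (Rintegral_itv_obnd_cbnd (b := BRight (2 * pi))); last first.
    by apply: integrableS (hi pi (2 * pi)) => //; exact: subset_itv_oc_cc.
  by move=> <-; rewrite addrC subrK.
have e2 : \int[leb]_(a in `[-pi, pi]) h a =
    \int[leb]_(a in `[-pi, 0]) h a + \int[leb]_(a in `[0, pi]) h a.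
  have := @Rintegral_itvB _ h (BLeft (-pi)) (BRight pi) 0 (hi _ _).
  rewrite !bnd_simp oppr_le0 => /(_ (ltW pi0) (ltW pi0)).
  rewrite (Rintegral_itv_obnd_cbnd (b := BRight pi)); last first.
    by apply: integrableS (hi 0 pi) => //; exact: subset_itv_oc_cc.
  by move=> <-; rewrite addrC subrK.
have e3 : \int[leb]_(a in `[pi, 2 * pi]) h a = \int[leb]_(a in `[-pi, 0]) h a.
  have -> : \int[leb]_(a in `[pi, 2 * pi]) h a =
      \int[leb]_(a in `[-pi + 2 * pi, 0 + 2 * pi]) h a.
    by rewrite add0r (_ : - pi + 2 * pi = pi)//; ring.
  rewrite (_ : \int[leb]_(a in _) _ = \int[leb]_(x in `[-pi, 0]) (h (x + 2 * pi) * 1)); last first.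
    apply: (@Rsubst _ (fun x => x + 2 * pi) (fun=> 1) h (-pi) 0 (-pi - 1) 1) => //.
    - by rewrite ltrBlDr ltrDl.
    - by rewrite oppr_le0 ltW.
    - move=> x _; apply: (is_derive_eq (is_deriveD (is_derive_id x 1) (is_derive_cst (2 * pi) x 1))).
      by rewrite addr0.
    - by move=> x _; exact: cst_continuous.
    - by move=> x y _ _; rewrite ltrD2r.
    - by move=> x; exact: continuous_Gpolar.
  apply: eq_Rintegral => x _; rewrite mulr1 /h /Gpolar.
  by rewrite mulr_natl (cosD2pi x) (sinD2pi x).
rewrite e1 e3 addrC -e2; apply: Rintegral_eq_supp => a; rewrite /h mulf_eq0 negb_or => /andP[_ Ha].
rewrite /= !in_itv/= -!ler_norml; split => [api|aA]; first exact: Gpolar_supp Ha.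
by rewrite (le_trans aA)// ltW// (lt_trans A_pihalf).
Qed.

Let polar_radial_subst a : `|a| <= A -> \int[leb]_(t in `]0, +oo[) (t * Gpolar t a) =
  \int[leb]_(y in `[c, d]) (y * (cos a)^-1 ^+ 2 * G (y, s + y * tan a)).
Proof.
move=> aA; have ca := lt_le_trans cosA (cosA_le aA).
have T0 : 0 < T by rewrite divr_gt0 ?d0 ?cosA.
transitivity (\int[leb]_(t in `[0, T]) (t * Gpolar t a)).
  apply: Rintegral_eq_supp => t; rewrite mulf_eq0 negb_or => /andP[_ /(Gpolar_suppT aA) /andP[t0 tT]].
  by rewrite /= !in_itv/= t0 tT (ltW t0).
set g := fun y => y * (cos a)^-1 ^+ 2 * G (y, s + y * tan a).
have gs y : g y != 0 -> c <= y <= d.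
  by rewrite /g mulf_eq0 negb_or => /andP[_ /suppG[]].
transitivity (\int[leb]_(y in `[0 * cos a, T * cos a]) g y); last first.
  apply: Rintegral_eq_supp => y /gs ycd; rewrite /= !in_itv/= ycd mul0r.
  move/andP : ycd => [cy yd]; split => // _.
  rewrite (le_trans (ltW c0) cy) (le_trans yd)//.
  by rewrite /T mulrAC ler_pdivlMr// ler_pM2l// cosA_le.
transitivity (\int[leb]_(t in `[0, T]) (g (t * cos a) * cos a)); last first.
  apply/esym; apply: (@Rsubst _ (fun t => t * cos a) (fun=> cos a) g 0 T (-1) (T + 1)) => //.
  - exact: ltW.
  - by rewrite ltrDl.
  - move=> x _; have := is_deriveM (is_derive_id x 1) (is_derive_cst (cos a) x 1).
    by move=> D; apply: (is_derive_eq D); rewrite scaler0 add0r [_ *: _]mulr1.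
  - by move=> x _; exact: cst_continuous.
  - by move=> x y _ _ xy; rewrite ltr_pM2r.
  - move=> y; suff: {for y, continuous g} by []. rewrite /g; apply: (@continuousM _ _ (fun y : R => y * (cos a)^-1 ^+ 2) (fun y : R => G (y, s + y * tan a)) y).
      by apply: continuousM; [exact: cid|exact: cst_continuous].
    apply: continuous_G; first exact: cid.
    apply: (@continuousD _ _ _ (fun=> s)); first exact: cst_continuous.
    by apply: continuousM; [exact: cid|exact: cst_continuous].
apply: eq_Rintegral => t _; rewrite /g /Gpolar.
rewrite -[t * cos a * tan a]mulrA [cos a * tan a]mulrC divfK ?gt_eqF//.
by field; rewrite gt_eqF.
Qed.

Let cos_itv (x : R) : - (pi / 2) < x < pi / 2 -> cos x != 0.
Proof. by move=> xp; rewrite gt_eqF// cos_gt0_pihalf. Qed.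

Let polar_angular_subst y : c <= y <= d -> \int[leb]_(a in `[-A, A])
    (y * (cos a)^-1 ^+ 2 * G (y, s + y * tan a)) = \int[leb]_u G (y, u).
Proof.
move=> /andP[cy yd]; have y0 : 0 < y := lt_le_trans c0 cy.
have AA : - (pi / 2) < - A by rewrite ltrN2.
pose F a := s + y * tan a.
transitivity (\int[leb]_(u in `[F (-A), F A]) G (y, u)).
  transitivity (\int[leb]_(a in `[-A, A]) (G (y, F a) * (y * (cos a)^-1 ^+ 2))).
    by apply: eq_Rintegral => a _; rewrite mulrC.
  apply/esym.
  apply: (@Rsubst _ F (fun a => y * (cos a)^-1 ^+ 2) (fun u => G (y, u)) (-A) A (-(pi/2)) (pi/2)) => //.
  - by rewrite (le_trans _ (ltW A0))// oppr_le0 ltW.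
  - move=> x xp; have D := is_derive_tan (cos_itv xp).
    apply: (is_derive_eq (is_deriveD (is_derive_cst s x 1) (is_deriveZ y D))).
    by rewrite add0r /GRing.scale/= exprVn.
  - move=> x xp; apply: (@continuousM _ _ (fun=> y)); first exact: cst_continuous.
    apply: (@continuous_comp _ _ _ (fun a => (cos a)^-1) (fun z : R => z ^+ 2)).
      by apply: continuousV; [exact: cos_itv|exact: continuous_cos].
    exact: exprn_continuous.
  - move=> x x'; rewrite !in_itv/= => /andP[x1 x2] /andP[x3 x4] xx'.
    rewrite /F ltrD2l ltr_pM2l// ltr_tan// in_itv/=.
      by rewrite (lt_le_trans AA x1) (le_lt_trans x2).
    by rewrite (lt_le_trans AA x3) (le_lt_trans x4).
  - by move=> u; apply: continuous_G; [exact: cst_continuous|exact: cid].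
apply: Rintegral_eq_supp => u /suppG[_ um]; split => // _.
rewrite /= in_itv/= /F tanN mulrN -ler_distl; apply: (le_trans um).
rewrite tanA; apply: (@le_trans _ _ (c * (m / c + 1))).
  (* c tan A = m + c exceeds the radius m of the support *)
  by rewrite mulrDr mulrC divfK ?gt_eqF// lerDl mulr1 ltW.
by rewrite ler_pM2r// ltr_wpDl// divr_ge0// ltW.
Qed.

Let M0 : 0 <= M. Proof. exact: le_trans (normr_ge0 _) (GM (0, 0)). Qed.

Let m_trig : measurable_fun setT (@cos R) /\ measurable_fun setT (@sin R).
Proof.
by split; apply: continuous_measurable_fun; [exact: continuous_cos|exact: continuous_sin].
Qed.

(* cos and tan are cut off outside [-A, A] to be measurable on the line *)
Let secsq := (fun a : R => (cos a)^-1 ^+ 2) \_ `[-A, A].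
Let tn := (@tan R) \_ `[-A, A].

Let A_in x : x \in `[- A, A] -> - (pi / 2) < x < pi / 2.
Proof.
rewrite in_itv/= => /andP[x1 x2]; rewrite (le_lt_trans x2)// andbT.
by rewrite (lt_le_trans _ x1)// ltrN2.
Qed.

Let m_secsq : measurable_fun setT secsq.
Proof.
apply/(measurable_restrictT _ _).1 => //.
apply: subspace_continuous_measurable_fun => //.
apply: within_itv_continuous => x xA.
have xp : - (pi / 2) < x < pi / 2 by apply: A_in; rewrite in_itv.
apply: (@continuous_comp _ _ _ (fun a => (cos a)^-1) (fun z : R => z ^+ 2)).
  by apply: continuousV; [exact: cos_itv|exact: continuous_cos].
exact: exprn_continuous.
Qed.

Let m_tn : measurable_fun setT tn.
Proof.
apply/(measurable_restrictT _ _).1 => //.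
apply: subspace_continuous_measurable_fun => //.
apply: within_itv_continuous => x xA.
have xp : - (pi / 2) < x < pi / 2 by apply: A_in; rewrite in_itv.
exact: is_derive_continuous (is_derive_tan (cos_itv xp)).
Qed.

Let secsq_le a : `|secsq a| <= (cos A)^-1 ^+ 2.
Proof.
rewrite /secsq patchE; case: ifPn => [|_]; last by rewrite normr0 exprn_ge0// invr_ge0 ltW.
rewrite inE/= in_itv/= -ler_norml => aA; have ca := lt_le_trans cosA (cosA_le aA).
rewrite ger0_norm ?exprn_ge0 ?invr_ge0 ?(ltW ca)//.
rewrite lerXn2r ?nnegrE ?invr_ge0 ?(ltW ca) ?(ltW cosA)//.
by rewrite lef_pV2 ?posrE// cosA_le.
Qed.

Lemma polar_Rintegral :
  \int[leb]_(t in `]0, +oo[) \int[leb]_(a in `[0, 2 * pi]) (t * G (t * cos a, s + t * sin a)) =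
  \int[leb]_y \int[leb]_u G (y, u).
Proof.
have T0 : 0 < T by rewrite divr_gt0 ?d0 ?cosA.
have [mc ms] := m_trig.
pose f1 (z : R * R) : R := (\1_`]0, +oo[ z.1 * \1_`[-A, A] z.2) * (z.1 * Gpolar z.1 z.2).
have mf1 : measurable_fun setT f1.
  apply: measurable_funM.
    apply: measurable_funM; [apply: (measurableT_comp (measurable_indic_itv _) (@measurable_fst _ _ _ _))|
      apply: (measurableT_comp (measurable_indic_itv _) (@measurable_snd _ _ _ _))].
  apply: measurable_funM; first exact: measurable_fst.
  apply: (measurableT_comp mG); apply: measurable_fun_pair.
    by apply: measurable_funM; [exact: measurable_fst|exact: (measurableT_comp mc (@measurable_snd _ _ _ _))].
  apply: measurable_funD => //.
  by apply: measurable_funM; [exact: measurable_fst|exact: (measurableT_comp ms (@measurable_snd _ _ _ _))].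
have bf1 z : `|f1 z| <= (fun t => T * \1_`[0, T] t) z.1 * (fun a => M * \1_`[-A, A] a) z.2.
  case: z => [t a]; rewrite /f1 !indicE /=.
  have [aA|aA] := boolP (a \in `[-A, A]%classic); last first.
    by rewrite mulr0 mul0r normr0 !mulr0.
  rewrite !mulr1; have [H0|H0] := eqVneq (Gpolar t a) 0.
    by rewrite H0 !mulr0 normr0; apply: mulr_ge0 M0; apply: mulr_ge0 (ltW T0) _; exact: ler0n.
  have aA' : `|a| <= A by move: aA; rewrite inE/= in_itv/= -ler_norml.
  have /andP[t0 tT] := Gpolar_suppT aA' H0.
  rewrite !mem_set/= ?in_itv/= ?t0 ?(ltW t0)// mul1r mulr1 normrM (gtr0_norm t0).
  by apply: ler_pM => //; [exact: ltW|exact: GM].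
have [f1a f1b] := Rfubini (integrable_cst_indic_itv _ _ _) (integrable_cst_indic_itv _ _ _) mf1 bf1.
pose f2 (z : R * R) : R := (\1_`[-A, A] z.1 * \1_`[c, d] z.2) * (z.2 * secsq z.1 * G (z.2, s + z.2 * tn z.1)).
have mf2 : measurable_fun setT f2.
  apply: measurable_funM.
    apply: measurable_funM; [apply: (measurableT_comp (measurable_indic_itv _) (@measurable_fst _ _ _ _))|
      apply: (measurableT_comp (measurable_indic_itv _) (@measurable_snd _ _ _ _))].
  apply: measurable_funM.
    by apply: measurable_funM; [exact: measurable_snd|exact: (measurableT_comp m_secsq (@measurable_fst _ _ _ _))].
  apply: (measurableT_comp mG); apply: measurable_fun_pair; first exact: measurable_snd.
  apply: measurable_funD => //.
  by apply: measurable_funM; [exact: measurable_snd|exact: (measurableT_comp m_tn (@measurable_fst _ _ _ _))].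
have bf2 z : `|f2 z| <= (fun a => (cos A)^-1 ^+ 2 * \1_`[-A, A] a) z.1 * (fun y => (d * M) * \1_`[c, d] y) z.2.
  case: z => [a y]; rewrite /f2 !indicE /=.
  have [aA|aA] := boolP (a \in `[-A, A]%classic); last by rewrite !mul0r normr0 mulr0 mul0r.
  have [ycd|ycd] := boolP (y \in `[c, d]%classic); last by rewrite mulr0 mul0r normr0 !mulr0.
  rewrite !mul1r !mulr1 !normrM mulrAC.
  have : `|y| <= d.
    move: ycd; rewrite inE/= in_itv/= => /andP[cy yd].
    by rewrite ger0_norm// (le_trans (ltW c0) cy).
  move=> yd; rewrite mulrC; apply: ler_pM; rewrite ?mulr_ge0//.
  by apply: ler_pM.
have [f2a f2b] := Rfubini (integrable_cst_indic_itv _ _ _) (integrable_cst_indic_itv _ _ _) mf2 bf2.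
transitivity (\int[leb]_t \int[leb]_a (\1_`]0, +oo[ t * \1_`[-A, A] a * (t * Gpolar t a))).
  rewrite Rintegral_indic; apply: eq_Rintegral => t _.
  rewrite indicE; case: (boolP (t \in _)) => t0; last first.
    by rewrite mul0r; under eq_Rintegral do rewrite !mul0r; rewrite Rintegral_cst//= mul0r.
  rewrite mul1r polar_angle_range; last by move: t0; rewrite inE/= in_itv/= andbT.
  by rewrite Rintegral_indic; apply: eq_Rintegral => a _; rewrite mul1r.
rewrite f1a -f1b /f1 /=.
transitivity (\int[leb]_a \int[leb]_y ((\1_`[-A, A] a * \1_`[c, d] y) * (y * secsq a * G (y, s + y * tn a)))).
  apply: eq_Rintegral => a _.
  rewrite indicE; case: (boolP (a \in _)) => aA; last first.
    rewrite [LHS]Rintegral_eq0 ?[RHS]Rintegral_eq0// => x.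
      by rewrite mulr0n !mul0r.
    by rewrite mulr0n mulr0 mul0r.
  have aA' : `|a| <= A by move: aA; rewrite inE/= in_itv/= -ler_norml.
  transitivity (\int[leb]_(t in `]0, +oo[) (t * Gpolar t a)).
    by rewrite [RHS]Rintegral_indic; apply: eq_Rintegral => t _; rewrite mulr1.
  rewrite polar_radial_subst//.
  rewrite Rintegral_indic; apply: eq_Rintegral => y _.
  by rewrite mul1r /secsq /tn !patchE aA.
rewrite f2a -f2b /f2 /=; apply: eq_Rintegral => y _.
rewrite [\1_`[c, d] y]indicE; case: (boolP (y \in _)) => ycd; last first.
  rewrite [LHS]Rintegral_eq0 => [|x]; last by rewrite mulr0n mulr0 mul0r.
  rewrite [RHS]Rintegral_eq0// => u; apply/eqP; apply: contraNT ycd => /suppG[ycd _].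
  by rewrite inE.
rewrite -polar_angular_subst; last by move: ycd; rewrite inE/= in_itv.
rewrite Rintegral_indic; apply: eq_Rintegral => a _; rewrite mulr1.
rewrite indicE; case: (boolP (a \in _)) => aA; last by rewrite !mul0r.
by rewrite /secsq /tn !patchE aA.
Qed.

End polar.

(** * Test functions of product form *)
Section tensor.
Context {R : realType}.

Lemma is_derive_line n (f : 'rV[R]_n -> R) (x v : 'rV[R]_n) (d : R) :
  is_derive (0 : R) 1 (fun h => f (h *: v + x)) d -> is_derive x v f d.
Proof.
move=> [df dv]; split; first exact/derivable1P.
rewrite -dv /derive.
suff -> : (fun h : R => h^-1 *: ((f \o shift x) (h *: v) - f x)) =
  (fun h : R => h^-1 *: (((fun h : R => f (h *: v + x)) \o shift 0) (h *: 1) - f (0 *: v + x))) by [].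
by apply/funext => h /=; rewrite addr0 [h *: 1]mulr1 scale0r add0r.
Qed.

Lemma continuous_sum (T : topologicalType) (I : Type) (r : seq I) (F : I -> T -> R) :
  (forall k, continuous (F k)) -> continuous (fun x => \sum_(k <- r) F k x).
Proof.
move=> cF; elim: r => [|a r IH].
  by under eq_fun do rewrite big_nil; exact: cst_continuous.
under eq_fun do rewrite big_cons; move=> x.
by apply: continuousD; [exact: cF|exact: IH].
Qed.

Lemma continuous_prod (T : topologicalType) (I : Type) (r : seq I) (F : I -> T -> R) :
  (forall k, continuous (F k)) -> continuous (fun x => \prod_(k <- r) F k x).
Proof.
move=> cF; elim: r => [|a r IH].
  by under eq_fun do rewrite big_nil; exact: cst_continuous.
under eq_fun do rewrite big_cons; move=> x.
by apply: continuousM; [exact: cF|exact: IH].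
Qed.

(** Sums of products of functions of one variable are stable under partial
derivatives, so their smoothness in the iterated sense follows from that of
the factors. *)
Definition sumprod m n (G : 'I_m -> 'I_n -> R -> R) (x : 'rV[R]_n) : R :=
  \sum_(k < m) \prod_(i < n) G k i (x 0 i).

Definition dsumprod m n (i : 'I_n) (G : 'I_m -> 'I_n -> R -> R) : 'I_m -> 'I_n -> R -> R :=
  fun k j => if j == i then derive1 (G k j) else G k j.

Lemma is_derive_sumprod m n (G : 'I_m -> 'I_n -> R -> R) (i : 'I_n) (x : 'rV[R]_n) :
  (forall k j, smooth1 (G k j)) ->
  is_derive x (delta_mx 0 i) (sumprod G) (sumprod (dsumprod i G) x).
Proof.
move=> sG; apply: is_derive_line.
pose c k := \prod_(j < n | j != i) G k j (x 0 j).
have -> : (fun h : R => sumprod G (h *: delta_mx 0 i + x)) =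
    \sum_(k < m) (fun h => c k * G k i (h + x 0 i)).
  apply/funext => h; rewrite fct_sumE; apply: eq_bigr => k _.
  rewrite (bigD1 i)//= mulrC !mxE !eqxx mulr1; congr (_ * _).
  by apply: eq_bigr => j ji; rewrite !mxE eqxx (negPf ji) mulr0 add0r.
have -> : sumprod (dsumprod i G) x = \sum_(k < m) (c k * derive1 (G k i) (x 0 i)).
  apply: eq_bigr => k _; rewrite (bigD1 i)//= /dsumprod eqxx mulrC; congr (_ * _).
  by apply: eq_bigr => j ji; rewrite (negPf ji).
apply: is_derive_sum => k.
have ds : is_derive (0 : R) 1 (fun h => h + x 0 i) (1 + 0).
  exact: (is_deriveD (is_derive_id (0 : R) 1) (is_derive_cst (x 0 i) (0 : R) 1)).
have dG : is_derive (0 + x 0 i) 1 (G k i) (derive1 (G k i) (x 0 i)).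
  by rewrite add0r; exact: smooth1_is_derive.
have dc := @is_derive1_comp _ (G k i) (fun h => h + x 0 i) _ _ _ dG ds.
apply: (is_derive_eq (is_deriveZ (c k) dc)).
by rewrite addr0 mulr1.
Qed.

Lemma continuous_sumprod m n (G : 'I_m -> 'I_n -> R -> R) :
  (forall k j, smooth1 (G k j)) -> continuous (sumprod G).
Proof.
move=> sG; apply: continuous_sum => k; apply: continuous_prod => i x.
apply: (@continuous_comp _ _ _ (fun x : 'rV[R]_n => x 0 i) (G k i)).
  exact: coord_continuous.
exact: smooth1_continuous.
Qed.

Lemma rsmooth_sumprod m n (G : 'I_m -> 'I_n -> R -> R) :
  (forall k j, smooth1 (G k j)) -> rsmooth (sumprod G).
Proof.
move=> sG s.
have [G' sG' ->] : exists2 G' : 'I_m -> 'I_n -> R -> R, (forall k j, smooth1 (G' k j)) & pd s (sumprod G) = sumprod G'.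
  elim: s => [|i s [G' sG' /= ->]]; first by exists G.
  exists (dsumprod i G').
    by move=> k j; rewrite /dsumprod; case: ifP => // _; exact: smooth1_derive1.
  by apply/funext => x; have [_ ->] := is_derive_sumprod i x sG'.
split; last exact: continuous_sumprod.
by move=> i x; have [] := is_derive_sumprod i x sG'.
Qed.

Lemma rsmooth2 (u v u' v' : R -> R) :
  smooth1 u -> smooth1 v -> smooth1 u' -> smooth1 v' ->
  rsmooth (fun x : 'rV[R]_2 => u (x 0 0) * v (x 0 1) + u' (x 0 0) * v' (x 0 1)).
Proof.
move=> su sv su' sv'.
pose G (k i : 'I_2) : R -> R := if k == 0 then (if i == 0 then u else v) else (if i == 0 then u' else v').
rewrite (_ : (fun x => _) = sumprod G).
  by apply: rsmooth_sumprod => k j; rewrite /G; do 2 case: ifP.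
apply/funext => x; rewrite /sumprod !big_ord_recl !big_ord0 /G /= !mulr1 addr0.
by rewrite (_ : lift ord0 ord0 = 1)//; exact/val_inj.
Qed.

Lemma tsupp_box n (U : set 'rV[R]_n) (c : 'rV[R]_n) (e : R) (f : 'rV[R]_n -> R[i]) :
  csmooth f -> (forall x : 'rV[R]_n, f x != 0 -> forall i, `|x 0 i - c 0 i| <= e) ->
  (forall x : 'rV[R]_n, (forall i, `|x 0 i - c 0 i| <= e) -> U x) -> testfun U f.
Proof.
move=> sf fB BU.
pose B := [set x : 'rV[R]_n | forall i, `[c 0 i - e, c 0 i + e]%classic (x 0 i)].
have BE x : B x <-> forall i, `|x 0 i - c 0 i| <= e.
  by split=> H i; move: (H i); rewrite /= in_itv/= ler_distl.
have cB : compact B.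
  have H := @rV_compact R n (fun i => `[c 0 i - e, c 0 i + e]%classic).
  by apply: H => i; exact: segment_compact.
have clB : closed B by apply: compact_closed => //; exact: norm_hausdorff.
have sB : tsupp f `<=` B.
  rewrite [X in _ `<=` X](closure_id B).1//; apply: closure_subset => x /= /fB H; exact/BE.
split => //; last by move=> x /sB/BE/BU.
by apply: subclosed_compact sB => //; exact: closed_closure.
Qed.

Lemma smooth1N (u : R -> R) : smooth1 u -> smooth1 (fun t => - u t).
Proof.
by move=> su; under eq_fun do rewrite -mulN1r; apply: smooth1M => //; exact: smooth1_cst.
Qed.

Lemma smooth1_cos_lin (u : R -> R) (k : R) : smooth1 u -> smooth1 (fun t => u t * cos (t * k)).
Proof.
move=> su; apply: smooth1M => //; apply: (@smooth1_comp _ cos); first exact: smooth1_cos.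
by apply: smooth1M; [exact: smooth1_id|exact: smooth1_cst].
Qed.

Lemma smooth1_sin_lin (u : R -> R) (k : R) : smooth1 u -> smooth1 (fun t => u t * sin (t * k)).
Proof.
move=> su; apply: smooth1M => //; apply: (@smooth1_comp _ sin); first exact: smooth1_sin.
by apply: smooth1M; [exact: smooth1_id|exact: smooth1_cst].
Qed.

Definition tens (u v : R -> R) (x : 'rV[R]_2) : R[i] := (u (x 0 0) * v (x 0 1))%:C.

Lemma dotp2 (x y : 'rV[R]_2) : dotp x y = x 0 0 * y 0 0 + x 0 1 * y 0 1.
Proof.
rewrite /dotp !big_ord_recl big_ord0 addr0.
by rewrite (_ : lift ord0 ord0 = 1)//; exact/val_inj.
Qed.

(** The real and the imaginary part of the exponential of a sum are sums of two
products, by the addition formulas. *)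
Lemma csmooth_osc (u v : R -> R) (th : 'rV[R]_2) : smooth1 u -> smooth1 v ->
  csmooth (fun x => tens u v x * expi (- dotp x th)).
Proof.
move=> su sv; split.
- rewrite (_ : (fun x => _) = (fun x : 'rV[R]_2 =>
     (u (x 0 0) * cos (x 0 0 * th 0 0)) * (v (x 0 1) * cos (x 0 1 * th 0 1)) +
     (- (u (x 0 0) * sin (x 0 0 * th 0 0))) * (v (x 0 1) * sin (x 0 1 * th 0 1)))).
    apply: (@rsmooth2 (fun t => u t * cos (t * th 0 0)) (fun t => v t * cos (t * th 0 1))
      (fun t => - (u t * sin (t * th 0 0))) (fun t => v t * sin (t * th 0 1))).
    + exact: smooth1_cos_lin.
    + exact: smooth1_cos_lin.
    + exact/smooth1N/smooth1_sin_lin.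
    + exact: smooth1_sin_lin.
  apply/funext => x; rewrite /tens /= cosN sinN dotp2 cosD mul0r subr0.
  by ring.
- rewrite (_ : (fun x => _) = (fun x : 'rV[R]_2 =>
     (- (u (x 0 0) * sin (x 0 0 * th 0 0))) * (v (x 0 1) * cos (x 0 1 * th 0 1)) +
     (- (u (x 0 0) * cos (x 0 0 * th 0 0))) * (v (x 0 1) * sin (x 0 1 * th 0 1)))).
    apply: (@rsmooth2 (fun t => - (u t * sin (t * th 0 0))) (fun t => v t * cos (t * th 0 1))
      (fun t => - (u t * cos (t * th 0 0))) (fun t => v t * sin (t * th 0 1))).
    + exact/smooth1N/smooth1_sin_lin.
    + exact: smooth1_cos_lin.
    + exact/smooth1N/smooth1_cos_lin.
    + exact: smooth1_sin_lin.
  apply/funext => x; rewrite /tens /= cosN sinN dotp2 sinD mul0r addr0.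
  by ring.
Qed.

Lemma forall_ord2 (P : 'I_2 -> Prop) : P 0 -> P 1 -> forall i, P i.
Proof.
by move=> P0 P1 i; case: (unliftP 0 i) => [j ->|->//]; rewrite ord1 (_ : lift 0 0 = 1)//; exact/val_inj.
Qed.

Lemma testfun_osc (u v : R -> R) (th p : 'rV[R]_2) (e : R) : smooth1 u -> smooth1 v ->
  0 < e -> e < p 0 0 ->
  supp_in (p 0 0 - e) (p 0 0 + e) u -> supp_in (p 0 1 - e) (p 0 1 + e) v ->
  testfun (Omega R) (fun x => tens u v x * expi (- dotp x th)).
Proof.
move=> su sv e0 ep hu hv; apply: (@tsupp_box _ _ p e); first exact: csmooth_osc.
  move=> x fx0; apply: forall_ord2; rewrite ler_distl; apply: contraNT fx0 => h.
    by rewrite /tens hu// mul0r (rmorph0 (real_complex R)) mul0r.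
  by rewrite /tens hv// mulr0 (rmorph0 (real_complex R)) mul0r.
move=> x /(_ 0); rewrite ler_distl => /andP[h _]; rewrite /Omega /=.
by apply: lt_le_trans h; rewrite subr_gt0.
Qed.

Lemma tens_neq0 (u v : R -> R) (x : 'rV[R]_2) : tens u v x != 0 -> u (x 0 0) != 0 /\ v (x 0 1) != 0.
Proof.
rewrite /tens => h; split; apply: contraNN h => /eqP ->; rewrite ?mul0r ?mulr0; exact/eqP.
Qed.

Lemma testfun_tens4 (u v u' v' : R -> R) (p q : 'rV[R]_2) (e : R) :
  smooth1 u -> smooth1 v -> smooth1 u' -> smooth1 v' ->
  0 < e -> e < p 0 0 -> e < q 0 0 ->
  supp_in (p 0 0 - e) (p 0 0 + e) u -> supp_in (p 0 1 - e) (p 0 1 + e) v ->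
  supp_in (q 0 0 - e) (q 0 0 + e) u' -> supp_in (q 0 1 - e) (q 0 1 + e) v' ->
  testfun (setsq (Omega R)) (fun w : 'rV[R]_(2 + 2) => tens u v (lsubmx w) * tens u' v' (rsubmx w)).
Proof.
move=> su sv su' sv' e0 ep eq hu hv hu' hv'.
apply: (@tsupp_box _ _ (row_mx p q) e).
- pose G (k : 'I_1) (i : 'I_(2 + 2)) : R -> R :=
    match fintype.split i with inl j => if j == 0 then u else v | inr j => if j == 0 then u' else v' end.
  split.
    rewrite (_ : (fun x => _) = sumprod G).
      by apply: rsmooth_sumprod => k j; rewrite /G; case: (fintype.split j) => j'; case: ifP.
    apply/funext => w; rewrite /sumprod big_ord_recl big_ord0 addr0 big_split_ord.
    rewrite !big_ord_recl !big_ord0 /= !mulr1 /G.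
    have sl (j : 'I_2) : fintype.split (lshift 2 j) = inl j := unsplitK (inl j).
    have sr (j : 'I_2) : fintype.split (rshift 2 j) = inr j := unsplitK (inr j).
    rewrite !sl !sr /= !mxE mulr0 subr0.
    by rewrite (_ : lift ord0 ord0 = 1)//; exact/val_inj.
  rewrite (_ : (fun x => _) = sumprod (fun (k : 'I_0) (i : 'I_(2 + 2)) => idfun)).
    by apply: rsmooth_sumprod => -[].
  by apply/funext => w; rewrite /sumprod big_ord0 /tens /= mulr0 mul0r addr0.
- move=> w; rewrite mulf_eq0 negb_or => /andP[/tens_neq0[u0 v0] /tens_neq0[u0' v0']] i.
  have H (g : R -> R) c t : supp_in (c - e) (c + e) g -> g t != 0 -> `|t - c| <= e.
    by move=> sg; apply: contraNT; rewrite ler_distl => /sg ->.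
  case: (split_ordP i) => j ->; rewrite ?row_mxEl ?row_mxEr; move: j.
    by apply: forall_ord2; [move: (H _ _ _ hu u0)|move: (H _ _ _ hv v0)]; rewrite !mxE.
  by apply: forall_ord2; [move: (H _ _ _ hu' u0')|move: (H _ _ _ hv' v0')]; rewrite !mxE.
- move=> w H; split; rewrite /Omega /= mxE.
    move: (H (lshift 2 0)); rewrite row_mxEl ler_distl => /andP[h _].
    by apply: lt_le_trans h; rewrite subr_gt0.
  move: (H (rshift 2 0)); rewrite row_mxEr ler_distl => /andP[h _].
  by apply: lt_le_trans h; rewrite subr_gt0.
Qed.

End tensor.

(** * Functions smooth on a closed interval *)
Section chi.
Context {R : realType}.
Variables (a b : R) (h : R -> R).
Hypothesis hs : rsmooth_on a b h.

Let H l := iter l (der_on a b) h.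

Lemma rsmooth_on_diffquot l t : a <= t <= b -> forall e, 0 < e ->
  exists2 d, 0 < d & forall s, s != t -> `|t - s| < d -> a <= s <= b ->
    `|H l.+1 t - (H l s - H l t) / (s - t)| < e.
Proof.
move=> tab e e0.
have /(_ l t) := hs; rewrite in_itv/= => /(_ tab) c.
have : diffquot (H l) t @ within `[a, b] t^' --> H l.+1 t by exact: c.
move=> /cvgrPdist_lt /(_ e e0); rewrite near_withinE /dnbhs near_withinE.
move=> /nbhs_ballP[d d0 dB]; exists d => // s st std sab.
by apply: dB => //; rewrite /= in_itv.
Qed.

Lemma rsmooth_on_continuous : {within `[a, b], continuous h}.
Proof.
apply/subspace_continuousP => t; rewrite /= in_itv/= => tab.
have [d d0 dB] := rsmooth_on_diffquot 0 tab ltr01.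
set L := H 1 t in dB.
apply/cvgrPdist_lt => e e0; rewrite near_withinE.
have L0 : 0 < `|L| + 1 by rewrite ltr_wpDl.
near=> s; rewrite /= in_itv/= => sab.
have [->|st] := eqVneq s t; first by rewrite subrr normr0.
have std : `|t - s| < d.
  by near: s; apply/nbhs_ballP; exists d.
have ste : `|t - s| < e / (`|L| + 1).
  by near: s; apply/nbhs_ballP; exists (e / (`|L| + 1)) => //=; rewrite divr_gt0.
have := dB s st std sab; rewrite /H /= => q.
have qL : `|(h s - h t) / (s - t)| <= `|L| + 1.
  move: q; set dq := (_ / _) => q; rewrite -[dq](subrK L) addrC.
  by rewrite (le_trans (ler_normD _ _))// lerD2l distrC ltW.
have -> : h t - h s = - ((h s - h t) / (s - t) * (s - t)).
  by rewrite divfK ?subr_eq0// opprB.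
rewrite normrN normrM [`|s - t|]distrC.
apply: (@le_lt_trans _ _ ((`|L| + 1) * `|t - s|)); first by rewrite ler_wpM2r.
by rewrite mulrC -ltr_pdivlMr.
Unshelve. all: by end_near. Qed.

Lemma rsmooth_on_is_derive l t : a < t < b -> is_derive t 1 (H l) (H l.+1 t).
Proof.
move=> /andP[at_ tb].
have c : h0^-1 *: (H l (h0 *: 1 + t) - H l t) @[h0 --> (0:R)^'] --> H l.+1 t.
  apply/cvgrPdist_lt => e e0; rewrite /dnbhs near_withinE.
  have tab : a <= t <= b by rewrite !ltW.
  have [d d0 dB] := rsmooth_on_diffquot l tab e0.
  near=> k => k0; have kd : `|k| < d.
    by near: k; apply/nbhs_ballP; exists d => //= y; rewrite /ball/= sub0r normrN.
  have ka : `|k| < Order.min (t - a) (b - t).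
    near: k; apply/nbhs_ballP; exists (Order.min (t - a) (b - t)) => /=.
      by rewrite lt_min !subr_gt0 at_ tb.
    by move=> y; rewrite /ball/= sub0r normrN.
  move: ka; rewrite lt_min => /andP[ka kb].
  have := dB (k + t); rewrite [k *: 1]mulr1 -subr_eq0 addrK => /(_ k0).
  rewrite opprD addrCA subrr addr0 normrN => /(_ kd).
  rewrite [_ *: _]mulrC; apply.
  move: ka kb; rewrite !ltr_norml => /andP[k1 k2] /andP[k3 k4]; apply/andP; split; lra.
by split; [apply/cvg_ex; exists (H l.+1 t)|exact: cvg_lim].
Unshelve. all: by end_near. Qed.

(** A cut-off supported in the open interval turns one-sided smoothness into
smoothness on the line. *)
Lemma rsmooth_on_mul_smooth1 (ka : R -> R) (a' b' : R) : a < a' -> b' < b ->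
  smooth1 ka -> supp_in a' b' ka -> smooth1 (fun t => h t * ka t).
Proof.
move=> aa' b'b sk kab n.
suff : forall l ka, smooth1 ka -> supp_in a' b' ka -> Cn n (fun t => H l t * ka t).
  by move=> /(_ 0%N ka); exact.
elim: n => [//|n IH] l {}ka {}sk {}kab.
have D (t : R) : is_derive t 1 (fun t => H l t * ka t) (H l t * derive1 ka t + ka t * H l.+1 t).
  have [tab|tab] := boolP (a < t < b).
    exact: (is_deriveM (rsmooth_on_is_derive l tab) (smooth1_is_derive t sk)).
  have tab' : ~~ (a' <= t <= b').
    by apply: contra tab => /andP[h1 h2]; rewrite (lt_le_trans aa' h1) (le_lt_trans h2 b'b).
  rewrite kab// mul0r addr0 (supp_in_derive1 kab)// mulr0.
  apply: (@near_eq_is_derive _ _ _ (cst (0 : R))).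
  move: tab'; rewrite negb_and -!ltNge => /orP[ta|bt].
    near=> y; rewrite kab ?mulr0// negb_and -ltNge; apply/orP; left.
    by near: y; exact: lt_nbhsl.
  near=> y; rewrite kab ?mulr0// negb_and -!ltNge; apply/orP; right.
  by near: y; exact: lt_nbhsr.
apply: (CnS_is_derive D); apply: CnD.
  by apply: IH; [exact: smooth1_derive1|exact: supp_in_derive1].
by under eq_fun do rewrite mulrC; exact: IH.
Unshelve. all: by end_near. Qed.

Lemma rsmooth_on_bounded : exists2 M, 0 <= M & forall t, a <= t <= b -> `|h t| <= M.
Proof.
have [ab|ba] := leP a b; last first.
  exists 0 => // t /andP[at_ tb]; by move: (le_trans at_ tb); rewrite leNgt ba.
have [] := @EVT_max _ (fun t => `|h t|) a b ab.
  apply/subspace_continuousP => x xab; apply: cvg_norm.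
  by have /subspace_continuousP := rsmooth_on_continuous; exact.
by move=> c _ Hc; exists `|h c|.
Qed.

Lemma rsmooth_on_measurable : (forall t, ~~ (a <= t <= b) -> h t = 0) ->
  measurable_fun setT h.
Proof.
move=> h0; have -> : h = h \_ `[a, b].
  apply/funext => t; rewrite patchE; case: ifPn => //.
  by rewrite notin_setE/= in_itv/= => /negP/h0.
apply/(measurable_restrictT _ _).1 => //.
by apply: subspace_continuous_measurable_fun => //; exact: rsmooth_on_continuous.
Qed.

End chi.

(** * The operator applied to a modulated product *)
Section cont.
Context {R : realType} {T : topologicalType}.
Implicit Types f g : T -> R.
Lemma contD f g : continuous f -> continuous g -> continuous (fun x => f x + g x).
Proof. by move=> cf cg x; exact: (continuousD (cf x) (cg x)). Qed.
Lemma contB f g : continuous f -> continuous g -> continuous (fun x => f x - g x).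
Proof. by move=> cf cg x; exact: (continuousB (cf x) (cg x)). Qed.
Lemma contM f g : continuous f -> continuous g -> continuous (fun x => f x * g x).
Proof. by move=> cf cg x; exact: (continuousM (cf x) (cg x)). Qed.
Lemma contN f : continuous f -> continuous (fun x => - f x).
Proof. by move=> cf x; exact: (continuousN (cf x)). Qed.
Lemma cont_cst (c : R) : continuous (fun _ : T => c).
Proof. by move=> x; exact: cst_continuous. Qed.
Lemma cont_comp (h : R -> R) f : continuous h -> continuous f -> continuous (fun x => h (f x)).
Proof. by move=> ch cf x; exact: (continuous_comp (cf x) (ch (f x))). Qed.
End cont.

Section ccont.
Context {R : realType} {T : topologicalType}.
Implicit Types f g : T -> R[i].

Definition ccontinuous f :=
  continuous (fun x => complex.Re (f x)) /\ continuous (fun x => complex.Im (f x)).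

Lemma ccontinuousM f g : ccontinuous f -> ccontinuous g -> ccontinuous (fun x => f x * g x).
Proof.
move=> [f1 f2] [g1 g2]; split.
  by under eq_fun do rewrite cReM; apply: contB; exact: contM.
by under eq_fun do rewrite cImM; apply: contD; exact: contM.
Qed.

Lemma ccontinuous_real (g : T -> R) : continuous g -> ccontinuous (fun x => (g x)%:C).
Proof. by move=> cg; split => //= x; exact: cst_continuous. Qed.

Lemma ccontinuous_cst (c : R[i]) : ccontinuous (fun=> c).
Proof. by split => x; exact: cst_continuous. Qed.

Lemma ccontinuous_expi (g : T -> R) : continuous g -> ccontinuous (fun x => expi (g x)).
Proof.
move=> cg; split => x; [apply: (@continuous_comp _ _ _ g cos)|apply: (@continuous_comp _ _ _ g sin)];
  [exact: cg|exact: continuous_cos|exact: cg|exact: continuous_sin].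
Qed.

End ccont.

Section plane_functions.
Context {R : realType}.

Lemma Re_neq0 (z : R[i]) : complex.Re z != 0 -> z != 0.
Proof. by apply: contraNneq => ->. Qed.

Lemma Im_neq0 (z : R[i]) : complex.Im z != 0 -> z != 0.
Proof. by apply: contraNneq => ->. Qed.

Notation leb := (@lebesgue_measure R).

Lemma polar_cint (G : R * R -> R[i]) (s c d m M : R) :
  0 < c -> c <= d -> 0 <= m -> cmeasurable G -> ccontinuous G ->
  (forall z, cabs (G z) <= M) ->
  (forall y u, G (y, u) != 0 -> c <= y <= d /\ `|u - s| <= m) ->
  cintegral leb `]0, +oo[ (fun t => cintegral leb `[0, 2 * pi]
     (fun a => t%:C * G (t * cos a, s + t * sin a))) =
  cint leb (fun y => cint leb (fun u => G (y, u))).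
Proof.
move=> c0 cd m0 [mG1 mG2] [cG1 cG2] GM sG.
have P1 := @polar_Rintegral R (fun z => complex.Re (G z)) s c d m M c0 cd m0 mG1 cG1
  (fun z => le_trans (normr_Re_le _) (GM z)) (fun y u h => sG y u (Re_neq0 h)).
have P2 := @polar_Rintegral R (fun z => complex.Im (G z)) s c d m M c0 cd m0 mG2 cG2
  (fun z => le_trans (normr_Im_le _) (GM z)) (fun y u h => sG y u (Im_neq0 h)).
apply: complexP; rewrite /cint /cintegral /=.
  rewrite -P1; apply: eq_Rintegral => t _; apply: eq_Rintegral => a _.
  by case: (G _) => x y /=; rewrite mul0r subr0.
rewrite -P2; apply: eq_Rintegral => t _; apply: eq_Rintegral => a _.
by case: (G _) => x y /=; rewrite mul0r addr0.
Qed.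

Lemma cintegral_itvZ (f : R -> R[i]) (a b : R) (k : R[i]) : ccontinuous f ->
  cintegral leb `[a, b] (fun x => k * f x) = k * cintegral leb `[a, b] f.
Proof.
move=> [f1 f2].
have i1 : leb.-integrable `[a, b] (EFin \o (fun x => complex.Re (f x))).
  by apply: integrable_itv => x _; exact: f1.
have i2 : leb.-integrable `[a, b] (EFin \o (fun x => complex.Im (f x))).
  by apply: integrable_itv => x _; exact: f2.
have iZ c (g : R -> R) : leb.-integrable `[a, b] (EFin \o g) ->
   leb.-integrable `[a, b] (EFin \o (fun x => c * g x)).
  by move=> ig; apply: integrableZl ig.
apply: complexP; rewrite /cintegral /=.
  under eq_Rintegral do rewrite cReM.
  by rewrite RintegralB ?RintegralZl ?cReM//; exact: iZ.
under eq_Rintegral do rewrite cImM.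
by rewrite RintegralD ?RintegralZl ?cImM//; exact: iZ.
Qed.

End plane_functions.

Section chirp_plane.
Context {R : realType}.
Notation leb := (@lebesgue_measure R).
Notation leb2 := (pmeas leb leb).

Definition wave (g1 g2 : R -> R) (la be1 be2 : R) (z : R * R) : R[i] :=
  ((g1 z.1)%:C * expi (la * z.1 ^+ 2 + be1 * z.1)) * ((g2 z.2)%:C * expi (la * z.2 ^+ 2 + be2 * z.2)).

Lemma cmeasurable_chirp (g : R -> R) (la be : R) : measurable_fun setT g ->
  cmeasurable (fun t : R => (g t)%:C * expi (la * t ^+ 2 + be * t)).
Proof.
move=> mg; apply: cmeasurableM; first exact: cmeasurable_real.
apply: cmeasurable_expi; rewrite [X in measurable_fun _ X](_ : _ = phase la be 0).
  by apply: continuous_measurable_fun => x; exact: is_derive_continuous (is_derive_phase la be 0 x).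
by apply/funext => t; rewrite /phase addr0.
Qed.

Lemma cint_wave (g1 g2 : R -> R) (a b a' b' la be1 be2 : R) :
  smooth1 g1 -> smooth1 g2 -> supp_in a b g1 -> supp_in a' b' g2 ->
  cint leb2 (wave g1 g2 la be1 be2) = chirp_int g1 la be1 * chirp_int g2 la be2.
Proof.
move=> s1 s2 h1 h2.
apply: (cint_prod (integrable_norm (smooth1_integrable s1 h1)) (integrable_norm (smooth1_integrable s2 h2))).
- by apply: cmeasurable_chirp; exact: smooth1_measurable.
- by apply: cmeasurable_chirp; exact: smooth1_measurable.
- by move=> x; rewrite cabsM cabs_expi cabsC mulr1.
- by move=> x; rewrite cabsM cabs_expi cabsC mulr1.
Qed.

Lemma cmeasurable_wave (g1 g2 : R -> R) (la be1 be2 : R) :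
  measurable_fun setT g1 -> measurable_fun setT g2 -> cmeasurable (wave g1 g2 la be1 be2).
Proof.
move=> m1 m2; apply: cmeasurableM.
  exact: (cmeasurable_comp (cmeasurable_chirp la be1 m1) (@measurable_fst _ _ _ _)).
exact: (cmeasurable_comp (cmeasurable_chirp la be2 m2) (@measurable_snd _ _ _ _)).
Qed.

Lemma cabs_wave (g1 g2 : R -> R) (la be1 be2 : R) z :
  cabs (wave g1 g2 la be1 be2 z) = `|g1 z.1| * `|g2 z.2|.
Proof. by rewrite /wave !cabsM !cabs_expi !cabsC !mulr1. Qed.

Lemma continuous_poly2 (la be : R) : continuous (fun t : R => la * t ^+ 2 + be * t).
Proof.
rewrite (_ : (fun t : R => _) = phase la be 0).
  by move=> t; exact: is_derive_continuous (is_derive_phase la be 0 t).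
by apply/funext => t; rewrite /phase addr0.
Qed.

Lemma ccontinuous_wave (g1 g2 : R -> R) (la be1 be2 : R) :
  continuous g1 -> continuous g2 -> ccontinuous (wave g1 g2 la be1 be2).
Proof.
move=> c1 c2.
have cf (f : R -> R) : continuous f -> continuous (fun z : R * R => f z.1).
  by move=> cf z; apply: (@continuous_comp _ _ _ fst f); [exact: cvg_fst|exact: cf].
have cs (f : R -> R) : continuous f -> continuous (fun z : R * R => f z.2).
  by move=> cs z; apply: (@continuous_comp _ _ _ snd f); [exact: cvg_snd|exact: cs].
apply: ccontinuousM; apply: ccontinuousM.
- exact/ccontinuous_real/cf.
- by apply: ccontinuous_expi; apply: (cf (fun t : R => la * t ^+ 2 + be1 * t)); exact: continuous_poly2.
- exact/ccontinuous_real/cs.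
- by apply: ccontinuous_expi; apply: (cs (fun t : R => la * t ^+ 2 + be2 * t)); exact: continuous_poly2.
Qed.

End chirp_plane.

Section Top_formula.
Context {R : realType}.
Notation leb := (@lebesgue_measure R).
Notation leb2 := (pmeas leb leb).
Variables (h1 h2 : R -> R) (c d a2 b2 : R).
Hypothesis s1 : smooth1 h1.
Hypothesis s2 : smooth1 h2.
Hypothesis c0 : 0 < c.
Hypothesis cd : c <= d.
Hypothesis supp1 : supp_in c d h1.
Hypothesis supp2 : supp_in a2 b2 h2.

(** This is int f(y) exp (i la |y - z_s|^2) dy for
f(y) = h1(y1) h2(y2) exp (- i <y, th>): expanding (y2 - s)^2 produces the
factor exp (i la s^2) and the shift - 2 la s of the second frequency. *)
Definition source_transform (th1 th2 s la : R) : R[i] :=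
  expi (la * s ^+ 2) * (chirp_int h1 la (- th1) * chirp_int h2 la (- th2 - 2 * la * s)).

(** The factor t in the circular mean is the Jacobian of polar coordinates, and
the radius tau in P is the distance to z_s. *)
Lemma Pop_Rop (k : R[i]) (th : 'rV[R]_2) (s r : R) :
  Pop 2 (fun t => k * Rop (fun y => tens h1 h2 y * expi (- dotp y th)) (bpt s) t) r =
  cint leb (fun la => `|la|%:C * expi (- (r ^+ 2 * la)) * k * source_transform (th 0 0) (th 0 1) s la).
Proof.
rewrite /Pop; apply: eq_cint => la.
pose C0 := expi (- (r ^+ 2 * la)) * `|la|%:C * k * expi (la * s ^+ 2).
pose W := wave h1 h2 la (- th 0 0) (- th 0 1 - 2 * la * s).
transitivity (cintegral leb `]0, +oo[ (fun t => cintegral leb `[0, 2 * pi]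
     (fun a => t%:C * (C0 * W (t * cos a, s + t * sin a))))).
  congr (cintegral _ _ _); apply/funext => t.
  have E a : tens h1 h2 (bpt s + t *: pt (cos a) (sin a)) *
      expi (- dotp (bpt s + t *: pt (cos a) (sin a)) th) =
      (h1 (t * cos a) * h2 (s + t * sin a))%:C *
      expi (- (t * cos a * th 0 0 + (s + t * sin a) * th 0 1)).
    by rewrite /tens dotp2 !mxE /= add0r.
  have ct : ccontinuous (fun a => t%:C * (tens h1 h2 (bpt s + t *: pt (cos a) (sin a)) *
      expi (- dotp (bpt s + t *: pt (cos a) (sin a)) th))).
    have c1 : continuous (fun a : R => t * cos a).
      by apply: contM; [exact: cont_cst|exact: continuous_cos].
    have c2 : continuous (fun a : R => s + t * sin a).
      by apply: contD; [exact: cont_cst|apply: contM; [exact: cont_cst|exact: continuous_sin]].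
    under eq_fun do rewrite E.
    apply: ccontinuousM; first exact: ccontinuous_cst.
    apply: ccontinuousM.
      apply: ccontinuous_real; apply: contM; apply: cont_comp => //; exact: smooth1_continuous.
    by apply: ccontinuous_expi; apply: contN; apply: contD; apply: contM => //; exact: cont_cst.
  rewrite /Rop mulrA -cintegral_itvZ//; congr (cintegral _ _ _); apply/funext => a.
  rewrite E /C0 /W /wave /= expr1 rmorphM /=.
  have -> : expi ((t ^+ 2 - r ^+ 2) * la) * `|la|%:C * k * (t%:C * ((h1 (t * cos a))%:C * (h2 (s + t * sin a))%:C *
     expi (- (t * cos a * th 0 0 + (s + t * sin a) * th 0 1)))) =
     t%:C * `|la|%:C * k * (h1 (t * cos a))%:C * (h2 (s + t * sin a))%:C *
     expi ((t ^+ 2 - r ^+ 2) * la - (t * cos a * th 0 0 + (s + t * sin a) * th 0 1)).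
    by rewrite expiD; ring.
  have -> : (t ^+ 2 - r ^+ 2) * la - (t * cos a * th 0 0 + (s + t * sin a) * th 0 1) =
     - (r ^+ 2 * la) + la * s ^+ 2 + (la * (t * cos a) ^+ 2 + - th 0 0 * (t * cos a)) +
      (la * (s + t * sin a) ^+ 2 + (- th 0 1 - 2 * la * s) * (s + t * sin a)).
    (* t^2 is |y - z_s|^2 at y = (t cos a, s + t sin a) *)
    have -> : t ^+ 2 = t ^+ 2 * (cos a ^+ 2 + sin a ^+ 2) by rewrite cos2Dsin2 mulr1.
    by ring.
  by rewrite !expiD; ring.
have [M1 M10 hM1] := supp_in_bounded s1 supp1.
have [M2 M20 hM2] := supp_in_bounded s2 supp2.
rewrite (@polar_cint _ (fun z => C0 * W z) s c d (`|a2 - s| + `|b2 - s|) (cabs C0 * (M1 * M2)))//.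
- have m1 := smooth1_measurable s1; have m2 := smooth1_measurable s2.
  have i1 : cintegrable leb (fun t => (h1 t)%:C * expi (la * t ^+ 2 + - th 0 0 * t)).
    apply: (cintegrable_domin _ (integrable_norm (smooth1_integrable s1 supp1))).
      exact: cmeasurable_chirp.
    by move=> x; rewrite cabsM cabs_expi cabsC mulr1.
  have i2 : cintegrable leb (fun t => (h2 t)%:C * expi (la * t ^+ 2 + (- th 0 1 - 2 * la * s) * t)).
    apply: (cintegrable_domin _ (integrable_norm (smooth1_integrable s2 supp2))).
      exact: cmeasurable_chirp.
    by move=> x; rewrite cabsM cabs_expi cabsC mulr1.
  transitivity (cint leb (fun y => (C0 * chirp_int h2 la (- th 0 1 - 2 * la * s)) *
     ((h1 y)%:C * expi (la * y ^+ 2 + - th 0 0 * y)))).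
    apply: eq_cint => y; rewrite /W /wave /=; under eq_fun do rewrite mulrA.
    by rewrite cintZ// /chirp_int; ring.
  by rewrite cintZ// /source_transform /C0 -/(chirp_int _ _ _); ring.
- apply: cmeasurableM; first exact: cmeasurable_cst.
  by apply: cmeasurable_wave; exact: smooth1_measurable.
- apply: ccontinuousM; first exact: ccontinuous_cst.
  by apply: ccontinuous_wave; exact: smooth1_continuous.
- by move=> z; rewrite cabsM ler_wpM2l ?cabs_ge0// cabs_wave ler_pM.
- move=> y u; rewrite mulf_eq0 negb_or => /andP[_]; rewrite /W /wave /= !mulf_eq0 !negb_or.
  move=> /andP[/andP[y0 _] /andP[u0 _]]; split.
    by apply: contraNT y0 => /supp1 ->.
  have : a2 <= u <= b2 by apply: contraNT u0 => /supp2 ->.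
  move=> /andP[u1 u2]; rewrite ler_norml; apply/andP; split.
    rewrite lerNl opprB; apply: (@le_trans _ _ `|a2 - s|); last by rewrite lerDl.
    by rewrite distrC; apply: le_trans (ler_norm _); rewrite lerD2l lerN2.
  apply: (@le_trans _ _ `|b2 - s|); last by rewrite lerDr.
  by apply: le_trans (ler_norm _); rewrite lerD2r.
Qed.

Lemma enorm_bpt (x : 'rV[R]_2) (s : R) :
  enorm (x - bpt s) ^+ 2 = x 0 0 ^+ 2 + (x 0 1 - s) ^+ 2.
Proof.
rewrite /enorm sqr_sqrtr dotp2 !mxE /= subr0 -!expr2//.
by rewrite addr_ge0 ?sqr_ge0.
Qed.

Definition Top_integrand (chi : 'rV[R]_2 -> R[i]) (th1 th2 : R) (p : R * R) (s la : R) : R[i] :=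
  `|la|%:C * chi (bpt s) * source_transform th1 th2 s la * expi (- (la * (p.1 ^+ 2 + (p.2 - s) ^+ 2))).

Lemma Top_tens (chi : 'rV[R]_2 -> R[i]) (th x : 'rV[R]_2) :
  Top chi (fun y => tens h1 h2 y * expi (- dotp y th)) x =
  (x 0 0 / pi ^+ 2)%:C *
    cint leb (fun s => cint leb (fun la => Top_integrand chi (th 0 0) (th 0 1) (x 0 0, x 0 1) s la)).
Proof.
rewrite /Top; congr (_ * _); apply: eq_cint => s.
rewrite Pop_Rop; apply: eq_cint => la.
by rewrite enorm_bpt /Top_integrand /= [la * _]mulrC; ring.
Qed.

Lemma plane_Top (chi : 'rV[R]_2 -> R[i]) (u v : R -> R) (c' d' : R) (th1 th2 : 'rV[R]_2) :
  0 < c' -> supp_in c' d' u ->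
  plane_integral (Omega R) (fun x => (tens u v x * expi (- dotp x th1)) *
     Top chi (fun y => tens h1 h2 y * expi (- dotp y th2)) x) =
  cint leb2 (fun p => ((p.1 * u p.1 / pi ^+ 2 * v p.2)%:C *
      expi (- (p.1 * th1 0 0 + p.2 * th1 0 1))) *
    cint leb (fun s => cint leb (fun la => Top_integrand chi (th2 0 0) (th2 0 1) p s la))).
Proof.
move=> c'0 su; rewrite /plane_integral cintegral_mkcond.
apply: (@eq_cint _ _ _ leb2) => -[p1 p2].
rewrite Top_tens /tens dotp2 !mxE /= /Omega /= indicE.
have [p10|p10] := boolP (0 < p1).
  by rewrite mem_set/= ?mxE// mul1r mulrA; congr (_ * _); rewrite !rmorphM /=; ring.
rewrite memNset/= ?mxE//; last exact/negP.
rewrite (rmorph0 (real_complex R)) mul0r (su p1).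
  by rewrite mulr0 !mul0r.
by apply: contra p10 => /andP[h _]; exact: lt_le_trans h.
Qed.

End Top_formula.

(** * Splitting the integral at the critical point *)
Section est_aux.
Context {R : realType}.
Notation leb := (@lebesgue_measure R).

(** The integrable weight 1 / (1 + la^2) dominates all integrals over la. *)
Lemma integrable_oneDsqrV : leb.-integrable setT (EFin \o (fun x : R => (oneDsqr x)^-1)).
Proof.
have k0 (x : R) : 0 <= (oneDsqr x)^-1 by rewrite invr_ge0.
have ck : continuous (fun x : R => (oneDsqr x)^-1) by exact: continuous_oneDsqrV.
apply/integrableP; split.
  by apply/measurable_EFinP; exact: continuous_measurable_fun.
under eq_integral => x _ do rewrite /= ger0_norm//.
rewrite (ge0_symfun_integralT k0 ck); last first.
  by move=> x; rewrite /= /oneDsqr sqrrN.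
by rewrite -set_itvcy integral0y_oneDsqr -EFinM ltry.
Qed.

Lemma norm_oneDsqr_le (la : R) : `|la| / (1 + `|la|) ^+ 3 <= (oneDsqr la)^-1.
Proof.
have n0 := normr_ge0 la.
have p : 0 < 1 + `|la| by rewrite ltr_pwDl.
have q : 0 < oneDsqr la by rewrite (lt_le_trans ltr01).
rewrite ler_pdivrMr ?exprn_gt0// mulrC ler_pdivlMr// /oneDsqr.
rewrite -(real_normK (num_real la)); set x := `|la| in n0 *.
by nra.
Qed.

(** Reversing the order of integration before taking absolute values keeps the
oscillation of the inner integral. *)
Lemma cint_swap_le d1 d2 (T1 : measurableType d1) (T2 : measurableType d2)
  (m1 : {sigma_finite_measure set T1 -> \bar R})
  (m2 : {sigma_finite_measure set T2 -> \bar R}) (p : T1 -> R) (q r : T2 -> R)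
  (f : T1 * T2 -> R[i]) :
  m1.-integrable setT (EFin \o p) -> m2.-integrable setT (EFin \o q) ->
  m2.-integrable setT (EFin \o r) ->
  cmeasurable f -> (forall z, cabs (f z) <= p z.1 * q z.2) ->
  (forall y, cabs (cint m1 (fun x => f (x, y))) <= r y) ->
  cabs (cint m1 (fun x => cint m2 (fun y => f (x, y)))) <= 2 * \int[m2]_y r y.
Proof.
move=> ip iq ir mf fpq H.
have [-> <-] := cfubini ip iq mf fpq.
apply: cabs_cint_le => //.
apply: (@cmeasurable_param_cint _ _ _ _ _ m1 (fun z => f (z.2, z.1))).
exact: (cmeasurable_comp mf (@measurable_swap _ _ _ _)).
Qed.

Lemma mfst11 : measurable_fun setT (fun z : (R * R) * (R * R) => z.1.1).
Proof. exact: (measurableT_comp (@measurable_fst _ _ _ _) (@measurable_fst _ _ _ _)). Qed.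
Lemma mfst12 : measurable_fun setT (fun z : (R * R) * (R * R) => z.1.2).
Proof. exact: (measurableT_comp (@measurable_snd _ _ _ _) (@measurable_fst _ _ _ _)). Qed.
Lemma mfst21 : measurable_fun setT (fun z : (R * R) * (R * R) => z.2.1).
Proof. exact: (measurableT_comp (@measurable_fst _ _ _ _) (@measurable_snd _ _ _ _)). Qed.
Lemma mfst22 : measurable_fun setT (fun z : (R * R) * (R * R) => z.2.2).
Proof. exact: (measurableT_comp (@measurable_snd _ _ _ _) (@measurable_snd _ _ _ _)). Qed.
Lemma mfst1 : measurable_fun setT (fun z : R * R => z.1).
Proof. exact: measurable_fst. Qed.
Lemma mfst2 : measurable_fun setT (fun z : R * R => z.2).
Proof. exact: measurable_snd. Qed.

Lemma measurable_fun_opp d (T : measurableType d) (f : T -> R) :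
  measurable_fun setT f -> measurable_fun setT (fun x => - f x).
Proof. by move=> mf; apply: measurableT_comp. Qed.

End est_aux.

Ltac mreal := repeat first
  [ exact: mfst11 | exact: mfst12 | exact: mfst21 | exact: mfst22
  | exact: mfst1 | exact: mfst2 | exact: measurable_cst
  | assumption
  | apply: measurable_fun_opp | apply: measurable_funB | apply: measurable_funD
  | apply: measurable_funX | apply: measurable_funM ].

Section est.
Context {R : realType}.
Notation leb := (@lebesgue_measure R).
Notation leb2 := (pmeas leb leb).
Variables (g1 g2 h1 h2 : R -> R) (c1 d1 c2 d2 c3 d3 c4 d4 : R).
Hypothesis sg1 : smooth1 g1.
Hypothesis sg2 : smooth1 g2.
Hypothesis sh1 : smooth1 h1.
Hypothesis sh2 : smooth1 h2.
Hypothesis pg1 : supp_in c1 d1 g1.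
Hypothesis pg2 : supp_in c2 d2 g2.
Hypothesis ph1 : supp_in c3 d3 h1.
Hypothesis ph2 : supp_in c4 d4 h2.
Hypothesis c30 : 0 < c3.
Hypothesis c3d3 : c3 <= d3.
Variables (chi : 'rV[R]_2 -> R[i]) (MX : R).
Hypothesis mX : cmeasurable (fun s : R => chi (bpt s)).
Hypothesis bX : forall s, cabs (chi (bpt s)) <= MX.
Hypothesis X0 : forall s, ~~ (-1 <= s <= 1) -> chi (bpt s) = 0.

Let MX0 : 0 <= MX. Proof. exact: le_trans (cabs_ge0 _) (bX 0). Qed.

Let iota (s : R) : R := \1_`[-1, 1] s.
Let kappa (la : R) : R := (oneDsqr la)^-1.

Let iota01 s : 0 <= iota s.
Proof. by rewrite /iota indicE ler0n. Qed.

Let bX' s : cabs (chi (bpt s)) <= MX * iota s.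
Proof.
rewrite /iota indicE; case: (boolP (s \in _)) => sI; first by rewrite mulr1.
rewrite X0 ?cabs0 ?mulr0//.
by move: sI; rewrite notin_setE/= in_itv/= => /negP.
Qed.

Let imX : leb.-integrable setT (EFin \o (fun s => MX * iota s)).
Proof. exact: integrable_cst_indic_itv. Qed.

(** For fixed theta the first factor decays in la: the derivative
2 la y1 - th1 of its phase is at least |la| c3 / 2 once |la| is large, since
y1 >= c3 / 2 > 0 on the support. This makes the integral over (s, la) absolutely
convergent. *)
Lemma source_transform_decay (th1 th2 : R) :
  exists2 C, 0 <= C & forall s la, `|la| * cabs (source_transform h1 h2 th1 th2 s la) <= C * kappa la.
Proof.
have c32 : c3 / 2 < c3 by rewrite ltr_pdivrMr// ltr_pMr// ltr1n.
have d31 : d3 < d3 + 1 by rewrite ltrDl.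
have cd : c3 / 2 < d3 + 1 by rewrite (lt_trans c32)// (le_lt_trans c3d3).
have c320 : 0 < c3 / 2 by rewrite divr_gt0.
have [C1 C10 H1] := chirp_int_decay 3 sh1 ph1 c32 d31 cd c320.
have [C2 C20 H2] := chirp_int_bounded sh1 ph1.
have [C3 C30 H3] := chirp_int_bounded sh2 ph2.
pose L := `|th1| / (c3 / 2).
have L0 : 0 <= L by rewrite divr_ge0// ltW.
exists ((C1 + C2 * (1 + L) ^+ 3) * C3).
  by rewrite mulr_ge0// addr_ge0// mulr_ge0// exprn_ge0// addr_ge0.
move=> s la; have p : 0 < 1 + `|la| by rewrite ltr_pwDl.
have B1 : cabs (chirp_int h1 la (- th1)) <= (C1 + C2 * (1 + L) ^+ 3) / (1 + `|la|) ^+ 3.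
  have [laL|laL] := leP L `|la|.
    apply: (@le_trans _ _ (C1 / (1 + `|la|) ^+ 3)).
      apply: H1 => // t /andP[t1 _].
      apply: (@le_trans _ _ (`|2 * la * t| - `|th1|)).
        have t0 : 0 < t by rewrite (lt_le_trans c320).
        rewrite !normrM normr_nat (gtr0_norm t0) lerBrDr.
        move: laL; rewrite /L ler_pdivrMr// => laL.
        have := ler_wpM2l (normr_ge0 la) t1; nra.
      by rewrite lerB_dist.
    by rewrite ler_pM2r ?invr_gt0 ?exprn_gt0// lerDl mulr_ge0// exprn_ge0// addr_ge0.
  apply: le_trans (H2 _ _) _; rewrite ler_pdivlMr ?exprn_gt0//.
  apply: (@le_trans _ _ (C2 * (1 + L) ^+ 3)); last by rewrite lerDr.
  by rewrite ler_wpM2l// lerXn2r ?nnegrE ?(ltW p) ?addr_ge0// lerD2l ltW.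
rewrite /source_transform !cabsM cabs_expi mul1r mulrA.
apply: (@le_trans _ _ (`|la| * ((C1 + C2 * (1 + L) ^+ 3) / (1 + `|la|) ^+ 3) * C3)).
  apply: ler_pM; rewrite ?cabs_ge0 ?mulr_ge0 ?cabs_ge0//.
  by rewrite ler_wpM2l.
set K0 := C1 + _; have -> : `|la| * (K0 / (1 + `|la|) ^+ 3) * C3 = K0 * C3 * (`|la| / (1 + `|la|) ^+ 3).
  by ring.
rewrite ler_wpM2l ?norm_oneDsqr_le// mulr_ge0// /K0 addr_ge0// mulr_ge0// exprn_ge0// addr_ge0//.
Qed.

Variables (t11 t12 t21 t22 : R).

Let K (p z : R * R) : R[i] := Top_integrand h1 h2 chi t21 t22 p z.1 z.2.

Let am (p : R * R) : R[i] := (g1 p.1 * g2 p.2)%:C * expi (- (p.1 * t11 + p.2 * t12)).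

Let mg1 := smooth1_measurable sg1.
Let mg2 := smooth1_measurable sg2.
Let mh1 := smooth1_measurable sh1.
Let mh2 := smooth1_measurable sh2.
Let ig1 := integrable_norm (smooth1_integrable sg1 pg1).
Let ig2 := integrable_norm (smooth1_integrable sg2 pg2).
Let ih1 := integrable_norm (smooth1_integrable sh1 ph1).
Let ih2 := integrable_norm (smooth1_integrable sh2 ph2).
Let ig : leb2.-integrable setT (EFin \o (fun z => `|g1 z.1| * `|g2 z.2|)) := integrable_prod ig1 ig2.
Let ih : leb2.-integrable setT (EFin \o (fun z => `|h1 z.1| * `|h2 z.2|)) := integrable_prod ih1 ih2.

Let cabs_am p : cabs (am p) = `|g1 p.1| * `|g2 p.2|.
Proof. by rewrite /am cabsM cabs_expi cabsC mulr1 normrM. Qed.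

Let m_am : cmeasurable am.
Proof.
apply: cmeasurableM.
  apply: cmeasurable_real; apply: measurable_funM.
    exact: (measurableT_comp mg1 mfst1).
  exact: (measurableT_comp mg2 mfst2).
by apply: cmeasurable_expi; mreal.
Qed.

Let Xz (z : R * R) : R[i] := chi (bpt z.1).

Let m_Xz : cmeasurable Xz. Proof. exact: (cmeasurable_comp mX mfst1). Qed.

Let m_normla : measurable_fun setT (fun z : R * R => `|z.2|).
Proof.
apply: (measurableT_comp _ mfst2).
by apply: continuous_measurable_fun; exact: norm_continuous.
Qed.

Let m_source_transform : cmeasurable (fun z : R * R => source_transform h1 h2 t21 t22 z.1 z.2).
Proof.
apply: cmeasurableM; first by apply: cmeasurable_expi; mreal.
apply: cmeasurableM.
  apply: (cmeasurable_comp (h := fun z : R * R => (z.2, - t21)) (cmeasurable_chirp_int mh1)).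
  by apply: measurable_fun_pair; mreal.
apply: (cmeasurable_comp (h := fun z : R * R => (z.2, - t22 - 2 * z.2 * z.1)) (cmeasurable_chirp_int mh2)).
by apply: measurable_fun_pair; mreal.
Qed.

Let m_K : cmeasurable (fun pz : (R * R) * (R * R) => K pz.1 pz.2).
Proof.
have cc2 (f : R * R -> R[i]) : cmeasurable f -> cmeasurable (fun pz : (R * R) * (R * R) => f pz.2).
  by move=> mf; exact: (cmeasurable_comp mf (@measurable_snd _ _ _ _)).
apply: cmeasurableM; last by apply: cmeasurable_expi; mreal.
apply: cmeasurableM; last exact: (cc2 _ m_source_transform).
apply: cmeasurableM; last exact: (cc2 _ m_Xz).
exact: (cc2 _ (cmeasurable_real m_normla)).
Qed.

Let K_decay : exists2 C, 0 <= C & forall p z, cabs (K p z) <= (MX * iota z.1) * (C * kappa z.2).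
Proof.
have [C C0 HC] := source_transform_decay t21 t22; exists C => // p z.
rewrite /K /Top_integrand; have := HC z.1 z.2; move: (source_transform _ _ _ _ _ _) => b Hb.
rewrite !cabsM cabs_expi mulr1 cabsC normr_id.
rewrite mulrAC mulrC; apply: ler_pM; rewrite ?mulr_ge0 ?cabs_ge0//.
Qed.

(** The value of the localized Fourier transform of the kernel, see [plane_Top]. *)
Definition kernel_fourier : R[i] :=
  cint leb2 (fun p => am p * cint leb (fun s => cint leb (fun la => K p (s, la)))).

(** The integral over (x, y) for fixed (s, la). *)
Definition chirp_int4 (s la : R) : R[i] :=
  chirp_int g1 (- la) (- t11) * chirp_int g2 (- la) (- t12 + 2 * la * s) *
  (chirp_int h1 la (- t21) * chirp_int h2 la (- t22 - 2 * la * s)).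

Definition dist_phase (p y z : R * R) : R :=
  z.2 * (y.1 ^+ 2 + (y.2 - z.1) ^+ 2 - (p.1 ^+ 2 + (p.2 - z.1) ^+ 2)).

(** Independent of theta, as it has to be for the decay estimate. *)
Definition est_const : R :=
  2 * (MX * (\int[leb2]_z (iota z.1 * kappa z.2))) +
  (2 * \int[leb2]_p (`|g1 p.1| * `|g2 p.2|)) * (2 * \int[leb2]_p (`|h1 p.1| * `|h2 p.2|)).

(** The weight w isolates the critical point. Its complement is estimated with
the integral over (x, y) innermost, w itself with the integral over (s, la)
innermost. *)
Variables (w : R * R -> R) (La B B' : R).
Hypothesis mw : measurable_fun setT w.
Hypothesis w01 : forall z, 0 <= w z <= 1.
Hypothesis wLa : forall z, La < `|z.2| -> w z = 0.
Hypothesis B0 : 0 <= B.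
Hypothesis B'0 : 0 <= B'.
Hypothesis HB : forall s la, -1 <= s <= 1 ->
  (1 - w (s, la)) * cabs (chirp_int4 s la) <= B / (1 + `|la|) ^+ 3.
Hypothesis HB' : forall p y, g1 p.1 != 0 -> g2 p.2 != 0 -> h1 y.1 != 0 -> h2 y.2 != 0 ->
  cabs (cint leb2 (fun z => (w z * `|z.2|)%:C * chi (bpt z.1) * expi (dist_phase p y z))) <= B'.

Let iiota : leb.-integrable setT (EFin \o iota).
Proof. by have := @integrable_cst_indic_itv R 1 (-1) 1; under eq_fun do rewrite mul1r. Qed.

Let ikap (C : R) : leb.-integrable setT (EFin \o (fun la => C * kappa la)).
Proof. exact: (integrableZl _ C integrable_oneDsqrV). Qed.

Let iK (C : R) : leb2.-integrable setT (EFin \o (fun z => (MX * iota z.1) * (C * kappa z.2))).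
Proof. exact: (integrable_prod imX (ikap C)). Qed.

Let kernel_fourierE : kernel_fourier = cint leb2 (fun p => am p * cint leb2 (fun z => K p z)).
Proof.
have [C C0 HK] := K_decay.
apply: eq_cint => p; congr (_ * _).
have [<- _] := @cfubini _ _ _ _ _ leb leb _ _ imX (ikap C) (K p)
  (cmeasurable_comp m_K (pair1_measurable p)) (HK p).
by [].
Qed.

Let part (v : R * R -> R) (p z : R * R) : R[i] := (v z)%:C * K p z.

Let m_part (v : R * R -> R) : measurable_fun setT v -> cmeasurable (fun pz : (R * R) * (R * R) => part v pz.1 pz.2).
Proof.
move=> mv; apply: cmeasurableM; last exact: m_K.
by apply: cmeasurable_real; exact: (measurableT_comp mv (@measurable_snd _ _ _ _)).
Qed.

Let m_cint_part (v : R * R -> R) : measurable_fun setT v ->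
  cmeasurable (fun p => cint leb2 (part v p)).
Proof.
move=> mv; have := @cmeasurable_param_cint _ _ _ _ _ leb2 (fun pz => part v pz.1 pz.2) (m_part mv).
by [].
Qed.

Let part_le C (v : R * R -> R) : (forall p z, cabs (K p z) <= (MX * iota z.1) * (C * kappa z.2)) ->
  (forall z, 0 <= v z <= 1) -> forall p z, cabs (part v p z) <= (MX * iota z.1) * (C * kappa z.2).
Proof.
move=> HK v01 p z; rewrite /part cabsM cabsC; have /andP[v0 v1] := v01 z.
by rewrite ger0_norm// (le_trans _ (HK p z))// ler_piMl ?cabs_ge0.
Qed.

Let v01 z : 0 <= 1 - w z <= 1.
Proof. by have := w01 z; lra. Qed.

Let mv : measurable_fun setT (fun z => 1 - w z). Proof. by mreal. Qed.

Let i_part (v : R * R -> R) p : measurable_fun setT v -> (forall z, 0 <= v z <= 1) ->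
  cintegrable leb2 (part v p).
Proof.
move=> mv' v01'; have [C C0 HK] := K_decay.
apply: (cintegrable_domin _ (iK C) (part_le HK v01' p)).
exact: (cmeasurable_comp (m_part mv') (pair1_measurable p)).
Qed.

Let i_am_part (v : R * R -> R) : measurable_fun setT v -> (forall z, 0 <= v z <= 1) ->
  cintegrable leb2 (fun p => am p * cint leb2 (part v p)).
Proof.
move=> mv' v01'; have [C C0 HK] := K_decay.
have i2 := integrableZl measurableT (2 * \int[leb2]_z ((MX * iota z.1) * (C * kappa z.2))) ig.
apply: (cintegrable_domin _ i2).
  apply: cmeasurableM m_am _.
  exact: m_cint_part.
move=> p /=; rewrite cabsM cabs_am mulrC ler_wpM2r ?mulr_ge0//.
apply: cabs_cint_le; [|exact: iK|exact: part_le].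
exact: (cmeasurable_comp (m_part mv') (pair1_measurable p)).
Qed.

Let kernel_fourier_split : kernel_fourier = cint leb2 (fun p => am p * cint leb2 (part w p)) +
   cint leb2 (fun p => am p * cint leb2 (part (fun z => 1 - w z) p)).
Proof.
rewrite kernel_fourierE -cintD; [|exact: i_am_part|exact: i_am_part].
apply: eq_cint => p; rewrite -mulrDr -cintD; [|exact: i_part|exact: i_part].
congr (_ * _); apply: eq_cint => z; rewrite /part -mulrDl -rmorphD /= addrC subrK.
by rewrite (_ : (1 : R)%:C = 1 :> R[i])// mul1r.
Qed.

(** Moving the integral over x inside completes the product of four chirp
integrals. *)
Let far_le : cabs (cint leb2 (fun p => am p * cint leb2 (part (fun z => 1 - w z) p))) <=
  2 * (MX * (\int[leb2]_z (iota z.1 * kappa z.2))) * B.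
Proof.
have [C C0 HK] := K_decay.
have -> : 2 * (MX * (\int[leb2]_z (iota z.1 * kappa z.2))) * B =
    2 * \int[leb2]_z ((MX * B) * (iota z.1 * kappa z.2)).
  rewrite RintegralZl//; last exact: (integrable_prod iiota integrable_oneDsqrV).
  by ring.
pose f (pz : (R * R) * (R * R)) := am pz.1 * part (fun z => 1 - w z) pz.1 pz.2.
have -> : (fun p => am p * cint leb2 (part (fun z => 1 - w z) p)) =
    fun p => cint leb2 (fun z => f (p, z)).
  by apply/funext => p; rewrite /f /= cintZ//; exact: i_part.
apply: (cint_swap_le ig (iK C)).
- exact: (integrableZl measurableT (MX * B) (integrable_prod iiota integrable_oneDsqrV)).
- apply: cmeasurableM; last exact: m_part.
  exact: (cmeasurable_comp m_am (@measurable_fst _ _ _ _)).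
- move=> [p z] /=; rewrite cabsM cabs_am ler_pM ?mulr_ge0 ?cabs_ge0//.
  exact: part_le.
move=> [s la].
pose D0 := (1 - w (s, la))%:C * (`|la|%:C * chi (bpt s) * source_transform h1 h2 t21 t22 s la) * expi (- (la * s ^+ 2)).
have -> : (fun p => f (p, (s, la))) =
    fun p => D0 * wave g1 g2 (- la) (- t11) (- t12 + 2 * la * s) p.
  apply/funext => -[p1 p2]; rewrite /f /am /part /K /Top_integrand /wave /D0 /= rmorphM /=.
  set b := source_transform _ _ _ _ _ _.
  have -> : forall x1 x2 x3 x4 x5 e1 e2 : R[i],
    x1 * x2 * e1 * (x3 * (x4 * x5 * b * e2)) = x3 * (x4 * x5 * b) * x1 * x2 * (e1 * e2).
    by move=> *; ring.
  rewrite -expiD.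
  have -> : - (p1 * t11 + p2 * t12) - la * (p1 ^+ 2 + (p2 - s) ^+ 2) =
    - (la * s ^+ 2) + (- la * p1 ^+ 2 + - t11 * p1) + (- la * p2 ^+ 2 + (- t12 + 2 * la * s) * p2).
    by ring.
  by rewrite !expiD; ring.
rewrite cintZ; last first.
  apply: (@cintegrable_domin _ _ _ leb2 (wave g1 g2 (- la) (- t11) (- t12 + 2 * la * s)) _ (cmeasurable_wave _ _ _ mg1 mg2) ig) => p.
  by rewrite cabs_wave.
rewrite (cint_wave _ _ _ sg1 sg2 pg1 pg2).
have [sI|sI] := boolP (-1 <= s <= 1); last first.
  by rewrite /D0 X0// !(mulr0, mul0r) cabs0 !mulr_ge0 ?invr_ge0.
have -> : cabs (D0 * (chirp_int g1 (- la) (- t11) * chirp_int g2 (- la) (- t12 + 2 * la * s))) =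
    `|la| * cabs (chi (bpt s)) * ((1 - w (s, la)) * cabs (chirp_int4 s la)).
  rewrite /D0 /chirp_int4 /source_transform !cabsM !cabs_expi !cabsC normr_id ger0_norm; last by case/andP: (v01 (s, la)).
  by ring.
have := HB la sI => HBs.
apply: (@le_trans _ _ (`|la| * (MX * iota s) * (B / (1 + `|la|) ^+ 3))).
  apply: ler_pM; rewrite ?mulr_ge0 ?cabs_ge0//; first by case/andP: (v01 (s, la)).
  by rewrite ler_wpM2l.
have -> : `|la| * (MX * iota s) * (B / (1 + `|la|) ^+ 3) =
   MX * B * iota s * (`|la| / (1 + `|la|) ^+ 3) by ring.
rewrite /= [leRHS]mulrA ler_wpM2l ?mulr_ge0//.
exact: norm_oneDsqr_le.
Qed.

Let hm (y : R * R) : R[i] := (h1 y.1 * h2 y.2)%:C * expi (- (y.1 * t21 + y.2 * t22)).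

Let m_hm : cmeasurable hm.
Proof.
apply: cmeasurableM.
  apply: cmeasurable_real; apply: measurable_funM.
    exact: (measurableT_comp mh1 mfst1).
  exact: (measurableT_comp mh2 mfst2).
by apply: cmeasurable_expi; mreal.
Qed.

Let cabs_hm p : cabs (hm p) = `|h1 p.1| * `|h2 p.2|.
Proof. by rewrite /hm cabsM cabs_expi cabsC mulr1 normrM. Qed.

Let wX (z : R * R) : R[i] := (w z * `|z.2|)%:C * chi (bpt z.1).

Let m_wX : cmeasurable wX.
Proof.
apply: cmeasurableM m_Xz; apply: cmeasurable_real; apply: measurable_funM => //.
Qed.

Let wXle z : cabs (wX z) <= (MX * iota z.1) * (`|La| * \1_`[- `|La|, `|La|] z.2).
Proof.
rewrite /wX cabsM cabsC mulrC; apply: ler_pM; rewrite ?cabs_ge0//.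
have /andP[w0 w1] := w01 z.
have [zL|zL] := ltP La `|z.2|.
  by rewrite wLa// mul0r normr0 mulr_ge0// indicE ler0n.
have zL' : `|z.2| <= `|La| by rewrite (le_trans zL)// ler_norm.
rewrite indicE mem_set/= ?in_itv/= -?ler_norml// mulr1 normrM normr_id ger0_norm//.
by rewrite (le_trans _ zL')// ler_piMl.
Qed.

(** Here the integral over y, hidden in [source_transform], is pulled out; the
compact support of w in la makes this exchange legitimate. *)
Let near_pointwise p : g1 p.1 != 0 -> g2 p.2 != 0 ->
  cabs (cint leb2 (part w p)) <= (2 * \int[leb2]_p (`|h1 p.1| * `|h2 p.2|)) * B'.
Proof.
move=> gp1 gp2.
have -> : (2 * \int[leb2]_p (`|h1 p.1| * `|h2 p.2|)) * B' =
    2 * \int[leb2]_y (B' * (`|h1 y.1| * `|h2 y.2|)).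
  by rewrite RintegralZl//; ring.
pose f (zy : (R * R) * (R * R)) := wX zy.1 * (hm zy.2 * expi (dist_phase p zy.2 zy.1)).
have -> : part w p = fun z => cint leb2 (fun y => f (z, y)).
  apply/funext => -[s la].
  have E : (fun y => f ((s, la), y)) = fun y => (wX (s, la) *
     expi (la * s ^+ 2 - la * (p.1 ^+ 2 + (p.2 - s) ^+ 2))) * wave h1 h2 la (- t21) (- t22 - 2 * la * s) y.
    apply/funext => -[y1 y2]; rewrite /f /hm /dist_phase /wave /= rmorphM /=.
    have -> : forall x1 x2 x3 e1 e2 : R[i], x1 * (x2 * x3 * e1 * e2) = x1 * x2 * x3 * (e1 * e2).
      by move=> *; ring.
    rewrite -expiD.
    have -> : - (y1 * t21 + y2 * t22) + la * (y1 ^+ 2 + (y2 - s) ^+ 2 - (p.1 ^+ 2 + (p.2 - s) ^+ 2)) =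
      la * s ^+ 2 - la * (p.1 ^+ 2 + (p.2 - s) ^+ 2) + (la * y1 ^+ 2 + - t21 * y1) +
      (la * y2 ^+ 2 + (- t22 - 2 * la * s) * y2) by ring.
    by rewrite !expiD; ring.
  rewrite E cintZ; last first.
    apply: (@cintegrable_domin _ _ _ leb2 (wave h1 h2 la (- t21) (- t22 - 2 * la * s)) _ (cmeasurable_wave _ _ _ mh1 mh2) ih) => y.
    by rewrite cabs_wave.
  rewrite (cint_wave _ _ _ sh1 sh2 ph1 ph2) /part /K /Top_integrand /wX /source_transform /= rmorphM /= expiD.
  by ring.
have iLa := integrable_prod imX (@integrable_cst_indic_itv R `|La| (- `|La|) `|La|).
apply: (cint_swap_le iLa ih).
- exact: (integrableZl measurableT B' ih).
- apply: cmeasurableM; first exact: (cmeasurable_comp m_wX (@measurable_fst _ _ _ _)).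
  apply: cmeasurableM; first exact: (cmeasurable_comp m_hm (@measurable_snd _ _ _ _)).
  by apply: cmeasurable_expi; rewrite /dist_phase; mreal.
- move=> [z y]; rewrite /f /= cabsM [cabs (hm _ * _)]cabsM cabs_expi mulr1 cabs_hm.
  by apply: ler_pM; rewrite ?mulr_ge0 ?cabs_ge0//; exact: wXle.
move=> y.
have E : (fun z => f (z, y)) = fun z => hm y * (wX z * expi (dist_phase p y z)).
  by apply/funext => z; rewrite /f /=; ring.
rewrite E cintZ; last first.
  apply: (cintegrable_domin _ iLa) => [|z]; last by rewrite cabsM cabs_expi mulr1; exact: wXle.
  apply: cmeasurableM m_wX _; apply: cmeasurable_expi; rewrite /dist_phase; mreal.
rewrite cabsM cabs_hm /=.
have [->|hy1] := eqVneq (h1 y.1) 0; first by rewrite normr0 !mul0r mulr0.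
have [->|hy2] := eqVneq (h2 y.2) 0; first by rewrite normr0 !(mulr0, mul0r).
rewrite mulrC ler_wpM2r ?mulr_ge0//.
exact: HB'.
Qed.

Lemma kernel_fourier_le : cabs kernel_fourier <= est_const * (B + B').
Proof.
rewrite kernel_fourier_split; apply: le_trans (cabsD _ _) _.
set A1 := 2 * \int[leb2]_p (`|h1 p.1| * `|h2 p.2|).
set A2 := \int[leb2]_p (`|g1 p.1| * `|g2 p.2|).
set A3 := \int[leb2]_z (iota z.1 * kappa z.2).
have k0 z : 0 <= kappa z by rewrite invr_ge0.
have A10 : 0 <= A1 by rewrite mulr_ge0// Rintegral_ge0// => z _; rewrite mulr_ge0.
have A20 : 0 <= A2 by rewrite Rintegral_ge0// => z _; rewrite mulr_ge0.
have A30 : 0 <= A3 by rewrite Rintegral_ge0// => z _; rewrite mulr_ge0.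
have near_le : cabs (cint leb2 (fun p => am p * cint leb2 (part w p))) <= 2 * A2 * A1 * B'.
  have -> : 2 * A2 * A1 * B' = 2 * \int[leb2]_p ((A1 * B') * (`|g1 p.1| * `|g2 p.2|)).
    by rewrite RintegralZl// /A2; ring.
  apply: cabs_cint_le.
  - apply: cmeasurableM m_am _.
    exact: m_cint_part.
  - exact: (integrableZl measurableT (A1 * B') ig).
  - move=> p; rewrite cabsM cabs_am.
    have [->|gp1] := eqVneq (g1 p.1) 0; first by rewrite normr0 !mul0r mulr0.
    have [->|gp2] := eqVneq (g2 p.2) 0; first by rewrite normr0 !(mulr0, mul0r).
    by rewrite mulrC ler_wpM2r ?mulr_ge0//; exact: near_pointwise.
apply: le_trans (lerD near_le far_le) _.
rewrite /est_const -/A1 -/A2 -/A3.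
have := mulr_ge0 (ler0n R 2) (mulr_ge0 MX0 A30).
have := mulr_ge0 (mulr_ge0 (ler0n R 2) A20) A10.
move: (2 * A2 * A1) (2 * (MX * A3)) => u v u0 v0.
by have := mulr_ge0 u0 B0; have := mulr_ge0 v0 B'0; nra.
Qed.

End est.

(** * Away from the critical point *)
Section far.
Context {R : realType}.

(** A lower bound for the derivative at the centre c extends, with half the
constant, to the support as soon as the support is small. *)
Lemma chirp_int_far (N : nat) (g : R -> R) (c e del : R) : smooth1 g ->
  0 < e -> e <= del / 4 -> supp_in (c - e / 2) (c + e / 2) g ->
  exists2 C, 0 <= C & forall al be rho, 0 <= rho -> `|al| <= rho ->
    del * rho <= `|2 * al * c + be| -> cabs (chirp_int g al be) <= C / (1 + rho) ^+ N.
Proof.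
move=> sg e0 ed pg.
have a1 : c - e < c - e / 2 by lra.
have a2 : c + e / 2 < c + e by lra.
have a3 : c - e < c + e by lra.
have d2 : 0 < del / 2 by lra.
have [C C0 H] := chirp_int_decay N sg pg a1 a2 a3 d2.
exists C => // al be rho rho0 alrho Hd; apply: H => // t tce.
have tc : `|t - c| <= e by rewrite ler_distl.
have E : 2 * al * c + be = (2 * al * t + be) - 2 * al * (t - c) by ring.
have : `|2 * al * c + be| <= `|2 * al * t + be| + 2 * (rho * e).
  rewrite E (le_trans (ler_normB _ _))// lerD2l !normrM normr_nat -mulrA ler_pM2l//.
  by rewrite ler_pM.
have : rho * e <= rho * (del / 4) by rewrite ler_wpM2l.
by move=> h1 h2; have := le_trans Hd h2; lra.
Qed.

Variables (g1 g2 h1 h2 : R -> R) (p1 p2 q1 q2 e del : R).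
Hypothesis sg1 : smooth1 g1.
Hypothesis sg2 : smooth1 g2.
Hypothesis sh1 : smooth1 h1.
Hypothesis sh2 : smooth1 h2.
Hypothesis e0 : 0 < e.
Hypothesis ed : e <= del / 4.
Hypothesis pg1 : supp_in (p1 - e / 2) (p1 + e / 2) g1.
Hypothesis pg2 : supp_in (p2 - e / 2) (p2 + e / 2) g2.
Hypothesis ph1 : supp_in (q1 - e / 2) (q1 + e / 2) h1.
Hypothesis ph2 : supp_in (q2 - e / 2) (q2 + e / 2) h2.

(** If the sum of the four derivatives is large, so is one of them; the three
other integrals are bounded. *)
Lemma chirp_int4_far (N : nat) :
  exists2 C, 0 <= C & forall t11 t12 t21 t22 s la rho, 0 <= rho -> `|la| <= rho ->
    4 * del * rho <= `|2 * la * p1 + t11| + `|2 * la * (p2 - s) + t12| +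
      `|2 * la * q1 - t21| + `|2 * la * (q2 - s) - t22| ->
    cabs (chirp_int4 g1 g2 h1 h2 t11 t12 t21 t22 s la) <= C / (1 + rho) ^+ N.
Proof.
have [C1 C10 H1] := chirp_int_far N sg1 e0 ed pg1.
have [C2 C20 H2] := chirp_int_far N sg2 e0 ed pg2.
have [C3 C30 H3] := chirp_int_far N sh1 e0 ed ph1.
have [C4 C40 H4] := chirp_int_far N sh2 e0 ed ph2.
have [M1 M10 B1] := chirp_int_bounded sg1 pg1.
have [M2 M20 B2] := chirp_int_bounded sg2 pg2.
have [M3 M30 B3] := chirp_int_bounded sh1 ph1.
have [M4 M40 B4] := chirp_int_bounded sh2 ph2.
exists (C1 * M2 * (M3 * M4) + M1 * C2 * (M3 * M4) + M1 * M2 * (C3 * M4) + M1 * M2 * (M3 * C4)).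
  by rewrite !addr_ge0 ?mulr_ge0.
move=> t11 t12 t21 t22 s la rho rho0 larho Hd.
have larhoN : `|- la| <= rho by rewrite normrN.
have r0 : 0 <= ((1 + rho) ^+ N)^-1 by rewrite invr_ge0 exprn_ge0// addr_ge0.
rewrite /chirp_int4 !cabsM.
have -> : forall A B C D X : R, (A + B + C + D) / X = A / X + B / X + C / X + D / X.
  by move=> *; ring.
have n1 := B1 (- la) (- t11). have n2 := B2 (- la) (- t12 + 2 * la * s).
have n3 := B3 la (- t21). have n4 := B4 la (- t22 - 2 * la * s).
have F : del * rho <= `|2 * la * p1 + t11| \/ del * rho <= `|2 * la * (p2 - s) + t12| \/
    del * rho <= `|2 * la * q1 - t21| \/ del * rho <= `|2 * la * (q2 - s) - t22|.
  have [k1|k1] := leP (del * rho) `|2 * la * p1 + t11|; first by left.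
  have [k2|k2] := leP (del * rho) `|2 * la * (p2 - s) + t12|; first by right; left.
  have [k3|k3] := leP (del * rho) `|2 * la * q1 - t21|; first by right; right; left.
  by right; right; right; lra.
have pos a b c' d : 0 <= a -> 0 <= b -> 0 <= c' -> 0 <= d -> 0 <= a * b * (c' * d) / (1 + rho) ^+ N.
  by move=> *; rewrite !mulr_ge0.
have P1 := pos _ _ _ _ C10 M20 M30 M40. have P2 := pos _ _ _ _ M10 C20 M30 M40.
have P3 := pos _ _ _ _ M10 M20 C30 M40. have P4 := pos _ _ _ _ M10 M20 M30 C40.
case: F => [F|[F|[F|F]]].
- have k1 := H1 (- la) (- t11) rho rho0 larhoN.
  have {k1} k1 : cabs (chirp_int g1 (- la) (- t11)) <= C1 / (1 + rho) ^+ N.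
    by apply: k1; rewrite (_ : 2 * - la * p1 + - t11 = - (2 * la * p1 + t11)) ?normrN//; ring.
  apply: (@le_trans _ _ (C1 * M2 * (M3 * M4) / (1 + rho) ^+ N)); last by lra.
  have -> : C1 * M2 * (M3 * M4) / (1 + rho) ^+ N = C1 / (1 + rho) ^+ N * M2 * (M3 * M4) by ring.
  by do ! (apply: ler_pM; rewrite ?mulr_ge0 ?cabs_ge0//).
- have k1 := H2 (- la) (- t12 + 2 * la * s) rho rho0 larhoN.
  have {k1} k1 : cabs (chirp_int g2 (- la) (- t12 + 2 * la * s)) <= C2 / (1 + rho) ^+ N.
    by apply: k1; rewrite (_ : 2 * - la * p2 + (- t12 + 2 * la * s) = - (2 * la * (p2 - s) + t12)) ?normrN//; ring.
  apply: (@le_trans _ _ (M1 * C2 * (M3 * M4) / (1 + rho) ^+ N)); last by lra.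
  have -> : M1 * C2 * (M3 * M4) / (1 + rho) ^+ N = M1 * (C2 / (1 + rho) ^+ N) * (M3 * M4) by ring.
  by do ! (apply: ler_pM; rewrite ?mulr_ge0 ?cabs_ge0//).
- have k1 := H3 la (- t21) rho rho0 larho F.
  apply: (@le_trans _ _ (M1 * M2 * (C3 * M4) / (1 + rho) ^+ N)); last by lra.
  have -> : M1 * M2 * (C3 * M4) / (1 + rho) ^+ N = M1 * M2 * (C3 / (1 + rho) ^+ N * M4) by ring.
  by do ! (apply: ler_pM; rewrite ?mulr_ge0 ?cabs_ge0//).
- have k1 := H4 la (- t22 - 2 * la * s) rho rho0 larho.
  have {k1} k1 : cabs (chirp_int h2 la (- t22 - 2 * la * s)) <= C4 / (1 + rho) ^+ N.
    by apply: k1; rewrite (_ : 2 * la * q2 + (- t22 - 2 * la * s) = 2 * la * (q2 - s) - t22)//; ring.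
  apply: (@le_trans _ _ (M1 * M2 * (M3 * C4) / (1 + rho) ^+ N)); last by lra.
  have -> : M1 * M2 * (M3 * C4) / (1 + rho) ^+ N = M1 * M2 * (M3 * (C4 / (1 + rho) ^+ N)) by ring.
  by do ! (apply: ler_pM; rewrite ?mulr_ge0 ?cabs_ge0//).
Qed.

End far.

(** * Near the critical point *)
Section near.
Context {R : realType}.
Notation leb := (@lebesgue_measure R).
Notation leb2 := (pmeas leb leb).

Lemma Rintegral_scale (f : R -> R) (a b t : R) : 0 < t -> a <= b -> continuous f ->
  supp_in a b f -> \int[leb]_x f (x / t) = t * \int[leb]_x f x.
Proof.
move=> t0 ab cf sf.
have ct : continuous (fun x : R => f (x / t)).
  by apply: cont_comp => //; apply: contM; [move=> x; exact: cvg_id|exact: cont_cst].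
have -> : \int[leb]_x f (x / t) = \int[leb]_(x in `[t * a, t * b]) f (x / t).
  apply: Rintegral_eq_supp => x fx; split => // _; rewrite /= in_itv/=.
  have : a <= x / t <= b by apply: contraNT fx => /sf ->.
  by rewrite ler_pdivlMr// ler_pdivrMr// ![_ * t]mulrC.
have -> : \int[leb]_x f x = \int[leb]_(x in `[a, b]) f x.
  apply: Rintegral_eq_supp => x fx; split => // _; rewrite /= in_itv/=.
  by apply: contraNT fx => /sf ->.
rewrite -RintegralZl//; last by apply: integrable_itv => x _; exact: cf.
transitivity (\int[leb]_(x in `[a, b]) (f (t * x / t) * t)); last first.
  by apply: eq_Rintegral => x _; rewrite mulrAC divff ?gt_eqF// mul1r mulrC.
apply: (@Rsubst _ (fun x => t * x) (fun=> t) (fun x => f (x / t)) a b (a - 1) (b + 1)) => //.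
- by lra.
- by lra.
- move=> x _; apply: (is_derive_eq (is_deriveZ t (is_derive_id x 1))).
  by rewrite [_ *: _]mulr1.
- by move=> x _; exact: cst_continuous.
- by move=> x y _ _ xy; rewrite ltr_pM2l.
Qed.

Lemma cint_scale (f : R -> R[i]) (a b t : R) : 0 < t -> a <= b -> ccontinuous f ->
  (forall x, ~~ (a <= x <= b) -> f x = 0) ->
  cint leb (fun x => f (x / t)) = t%:C * cint leb f.
Proof.
move=> t0 ab [c1 c2] sf; apply: complexP; rewrite /cint /cintegral /=.
  rewrite mul0r subr0 -(@Rintegral_scale (fun x => complex.Re (f x)) a b)//.
  by move=> x /sf ->.
rewrite mul0r addr0 -(@Rintegral_scale (fun x => complex.Im (f x)) a b)//.
by move=> x /sf ->.
Qed.

Variables (chi : 'rV[R]_2 -> R[i]) (MX : R).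
Hypothesis mX : cmeasurable (fun s : R => chi (bpt s)).
Hypothesis bX : forall s, cabs (chi (bpt s)) <= MX.
Hypothesis X0 : forall s, ~~ (-1 <= s <= 1) -> chi (bpt s) = 0.

Let iota (s : R) : R := \1_`[-1, 1] s.

Let MX0 : 0 <= MX. Proof. exact: le_trans (cabs_ge0 _) (bX 0). Qed.
Let iota01 s : 0 <= iota s.
Proof. by rewrite /iota indicE ler0n. Qed.

Let bX' s : cabs (chi (bpt s)) <= MX * iota s.
Proof.
rewrite /iota indicE; case: (boolP (s \in _)) => sI; first by rewrite mulr1.
rewrite X0 ?cabs0 ?mulr0//.
by move: sI; rewrite notin_setE/= in_itv/= => /negP.
Qed.

Variables (ls s0 r : R).
Hypothesis r0 : 0 < r.
Hypothesis rls : 4 * r <= `|ls|.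

Definition cut_la : R -> R := sbump ls (2 * r).
Definition cut_s : R -> R := sbump s0 (2 * r).
(** The critical frequency is proportional to theta, so the cut-off in la is
dilated by the size t of theta. *)
Definition cutoff (t : R) (z : R * R) : R := cut_s z.1 * cut_la (z.2 / t).

Let r20 : 0 < 2 * r. Proof. by rewrite mulr_gt0. Qed.
Let Lam : R := `|ls| + 2 * r.
Let Lam0 : 0 < Lam. Proof. by rewrite /Lam ltr_wpDl. Qed.

Lemma cut_la_supp la : cut_la la != 0 -> `|la - ls| < 2 * r.
Proof. by rewrite ltNge; apply: contraNN => h; rewrite /cut_la sbump_out. Qed.

Lemma cut_s_supp s : cut_s s != 0 -> `|s - s0| < 2 * r.
Proof. by rewrite ltNge; apply: contraNN => h; rewrite /cut_s sbump_out. Qed.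

Lemma cut_la_norm la : cut_la la != 0 -> `|ls| / 2 <= `|la| <= Lam.
Proof.
move=> /cut_la_supp h; apply/andP; split.
  have : `|ls| <= `|la| + `|la - ls|.
    by rewrite -[X in `|X| <= _](subrK la) addrC (le_trans (ler_normD _ _))// lerD2l distrC.
  by move: rls; lra.
rewrite /Lam -[X in `|X| <= _](subrK ls) addrC (le_trans (ler_normD _ _))// lerD2l ltW//.
Qed.

Lemma cutoff01 t z : 0 <= cutoff t z <= 1.
Proof.
have /andP[a1 a2] := sbump_itv s0 (2 * r) z.1.
have /andP[b1 b2] := sbump_itv ls (2 * r) (z.2 / t).
by rewrite /cutoff mulr_ge0//= mulr_ile1.
Qed.

Lemma measurable_cutoff t : measurable_fun setT (cutoff t).
Proof.
apply: measurable_funM.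
  exact: (measurableT_comp (smooth1_measurable (smooth1_sbump s0 (2 * r))) mfst1).
apply: (measurableT_comp (smooth1_measurable (smooth1_sbump ls (2 * r)))).
by mreal.
Qed.

Lemma cutoff_La t z : 0 < t -> t * Lam < `|z.2| -> cutoff t z = 0.
Proof.
move=> t0 h; rewrite /cutoff; have [->|/cut_la_norm/andP[_]] := eqVneq (cut_la (z.2 / t)) 0.
  by rewrite mulr0.
by rewrite normrM normfV (gtr0_norm t0) ler_pdivrMr// mulrC leNgt h.
Qed.

Lemma cutoff1 t z : `|z.2 / t - ls| <= r -> `|z.1 - s0| <= r -> cutoff t z = 1.
Proof.
by move=> h1 h2; rewrite /cutoff /cut_la /cut_s !sbump_in ?mulr1// mulrAC divff// mul1r.
Qed.

(** Smooth, since the support of the cut-off does not meet 0. *)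
Definition abs_cut_la (la : R) : R := `|la| * cut_la la.

Let smooth1_cut_la : smooth1 cut_la. Proof. exact: smooth1_sbump. Qed.

Lemma supp_abs_cut_la : supp_in (ls - 2 * r) (ls + 2 * r) abs_cut_la.
Proof.
move=> la h; rewrite /abs_cut_la /cut_la sbump_out ?mulr0//.
by move: h; rewrite -ler_distl -ltNge => /ltW.
Qed.

Lemma smooth1_abs_cut_la : smooth1 abs_cut_la.
Proof.
have -> : abs_cut_la = fun la => Num.sg ls * la * cut_la la.
  apply/funext => la; rewrite /abs_cut_la; have [->|k0] := eqVneq (cut_la la) 0; first by rewrite !mulr0.
  congr (_ * _); have := cut_la_supp k0; have := rls; rewrite ltr_norml.
  have [ls0|ls0|ls0] := sgrP ls.
  - by lra.
  - by move=> h /andP[h1 h2]; rewrite mul1r ger0_norm//; lra.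
  - by move=> h /andP[h1 h2]; rewrite mulN1r ler0_norm//; lra.
apply: smooth1M => //; apply: smooth1M; [exact: smooth1_cst|exact: smooth1_id].
Qed.

Let sqle (t C : R) N : 0 < t -> 0 <= C -> t ^+ 2 * (C / (1 + t) ^+ N.+2) <= C / (1 + t) ^+ N.
Proof.
move=> t0 C0; have p : 0 < 1 + t by rewrite addr_gt0.
have -> : t ^+ 2 * (C / (1 + t) ^+ N.+2) = C / (1 + t) ^+ N * (t / (1 + t)) ^+ 2.
  by rewrite -[N.+2]addn2 exprD expr_div_n invfM; ring.
rewrite ler_piMr ?divr_ge0 ?exprn_ge0 ?(ltW p)//.
rewrite expr_le1// ?divr_ge0 ?(ltW t0) ?(ltW p)// ler_pdivrMr// mul1r lerDr//.
Qed.

Let imX : leb.-integrable setT (EFin \o (fun s => MX * iota s)).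
Proof. exact: integrable_cst_indic_itv. Qed.

Let iLa (L : R) : leb.-integrable setT (EFin \o (fun la => L * \1_`[- L, L] la)).
Proof. exact: integrable_cst_indic_itv. Qed.

Section fixed.
Variables (t : R) (p y : R * R).
Hypothesis t0 : 0 < t.

Let f (z : R * R) : R[i] := (cutoff t z * `|z.2|)%:C * chi (bpt z.1) * expi (dist_phase p y z).

Let m_f : cmeasurable f.
Proof.
apply: cmeasurableM; last by apply: cmeasurable_expi; rewrite /dist_phase; mreal.
apply: cmeasurableM; last exact: (cmeasurable_comp mX mfst1).
apply: cmeasurable_real; apply: measurable_funM; first exact: measurable_cutoff.
apply: (measurableT_comp _ mfst2).
by apply: continuous_measurable_fun; exact: norm_continuous.
Qed.

Let f_le z : cabs (f z) <= (MX * iota z.1) * (t * Lam * \1_`[- (t * Lam), t * Lam] z.2).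
Proof.
have tL : 0 < t * Lam by rewrite mulr_gt0.
rewrite /f !cabsM cabs_expi mulr1 cabsC mulrC; apply: ler_pM; rewrite ?cabs_ge0//.
have /andP[w0 w1] := cutoff01 t z.
have [zL|zL] := ltP (t * Lam) `|z.2|.
  by rewrite cutoff_La// mul0r normr0 mulr_ge0 ?(ltW tL)// indicE ler0n.
rewrite indicE mem_set/= ?in_itv/= -?ler_norml// mulr1 normrM normr_id ger0_norm//.
by rewrite (le_trans _ zL)// ler_piMl.
Qed.

Let fub := cfubini imX (iLa (t * Lam)) m_f f_le.

(** For fixed s the phase is la D with D = |y - z_s|^2 - |x - z_s|^2. After
la = t la', the integral over la' is a chirp integral with al = 0 and
be = t D; the factor t^2, one t from |la| and one from the measure, is absorbed
by asking for the decay of order N + 2. *)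
Lemma near_lambda_fixed (c0 C : R) (N : nat) : 0 <= C ->
  (forall al be rho : R, 0 <= rho -> `|al| <= rho ->
    (forall u, ls - 4 * r <= u <= ls + 4 * r -> c0 * rho <= `|2 * al * u + be|) ->
    cabs (chirp_int abs_cut_la al be) <= C / (1 + rho) ^+ N.+2) ->
  (forall s, `|s - s0| < 2 * r ->
     c0 <= `|y.1 ^+ 2 + (y.2 - s) ^+ 2 - (p.1 ^+ 2 + (p.2 - s) ^+ 2)|) ->
  cabs (cint leb2 f) <= (2 * \int[leb]_s (MX * iota s)) * (C / (1 + t) ^+ N).
Proof.
move=> C0 HC Hc; rewrite -fub.1.
have q0 : 0 <= C / (1 + t) ^+ N by rewrite divr_ge0// exprn_ge0// addr_ge0// ltW.
have -> : 2 * \int[leb]_s (MX * iota s) * (C / (1 + t) ^+ N) =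
   2 * \int[leb]_s ((C / (1 + t) ^+ N) * (MX * iota s)).
  by rewrite [X in _ = 2 * X]RintegralZl//; ring.
apply: cabs_cint_le.
- exact: (@cmeasurable_param_cint _ _ _ _ _ leb f m_f).
- exact: (integrableZl measurableT (C / (1 + t) ^+ N) imX).
move=> s.
pose D := y.1 ^+ 2 + (y.2 - s) ^+ 2 - (p.1 ^+ 2 + (p.2 - s) ^+ 2).
pose F (la : R) : R[i] := (abs_cut_la la)%:C * expi (0 * la ^+ 2 + (t * D) * la).
have E la : f (s, la) = ((cut_s s * t)%:C * chi (bpt s)) * F (la / t).
  rewrite /f /cutoff /dist_phase /F /abs_cut_la /= -/D.
  have -> : `|la| = t * `|la / t|.
    by rewrite normrM normfV (gtr0_norm t0) mulrCA divff ?gt_eqF// mulr1.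
  have -> : la * D = 0 * (la / t) ^+ 2 + t * D * (la / t).
    by field; rewrite gt_eqF.
  by rewrite !rmorphM /=; ring.
have cF : ccontinuous F.
  apply: ccontinuousM; first by apply: ccontinuous_real; exact: smooth1_continuous smooth1_abs_cut_la.
  by apply: ccontinuous_expi; exact: continuous_poly2.
have sF x : ~~ (ls - 2 * r <= x <= ls + 2 * r) -> F x = 0.
  by move=> h; rewrite /F supp_abs_cut_la// mul0r.
have lr : ls - 2 * r <= ls + 2 * r by rewrite lerD2l; move: r20; lra.
have mF : cmeasurable (fun la : R => F (la / t)).
  apply: (@cmeasurable_comp _ _ _ _ _ F (fun la : R => la / t)); last first.
    by apply: measurable_funM => //.
  by apply: cmeasurable_chirp; exact: smooth1_measurable smooth1_abs_cut_la.
under eq_fun do rewrite E.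
have [->|ks] := eqVneq (cut_s s) 0.
  rewrite (_ : (fun _ => _) = fun=> 0); last by apply/funext => la; rewrite !mul0r.
  rewrite (_ : cint leb _ = 0); last first.
    by apply: complexP; rewrite /cint /cintegral /= Rintegral_eq0.
  rewrite cabs0; apply: mulr_ge0 q0 _.
  exact: mulr_ge0 MX0 (iota01 s).
have [M M0 gM] := supp_in_bounded smooth1_abs_cut_la supp_abs_cut_la.
rewrite cintZ; last first.
  have iM : leb.-integrable setT (EFin \o (fun la => M * \1_`[- (t * Lam), t * Lam] la)).
    exact: integrable_cst_indic_itv.
  apply: (@cintegrable_domin _ _ _ leb _ (fun la => M * \1_`[- (t * Lam), t * Lam] la)) => // la; rewrite /F cabsM cabs_expi cabsC mulr1 indicE.
  have [->|k0] := eqVneq (abs_cut_la (la / t)) 0; first by rewrite normr0 mulr_ge0// ler0n.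
  rewrite mem_set ?mulr1//= in_itv/= -ler_norml.
  move: k0; rewrite /abs_cut_la mulf_eq0 negb_or => /andP[_ /cut_la_norm/andP[_]].
  by rewrite normrM normfV (gtr0_norm t0) ler_pdivrMr// mulrC.
rewrite (@cint_scale F _ _ t t0 lr cF sF) -/(chirp_int abs_cut_la 0 (t * D)) !cabsM !cabsC.
have k2b : `|cut_s s * t| <= t.
  have /andP[a1 a2] := sbump_itv s0 (2 * r) s.
  by rewrite normrM (gtr0_norm t0) ger0_norm// ler_piMl// ltW.
have jb : cabs (chirp_int abs_cut_la 0 (t * D)) <= C / (1 + t) ^+ N.+2.
  apply: HC; rewrite ?normr0 ?(ltW t0)// => u _.
  rewrite mulr0 mul0r add0r normrM (gtr0_norm t0) mulrC ler_pM2l//.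
  exact: Hc (cut_s_supp ks).
apply: (@le_trans _ _ (t * (MX * iota s) * (t * (C / (1 + t) ^+ N.+2)))).
  rewrite (gtr0_norm t0); apply: ler_pM; rewrite ?mulr_ge0 ?cabs_ge0 ?(ltW t0)//.
    by apply: ler_pM; rewrite ?cabs_ge0.
  by rewrite ler_pM2l.
have -> : t * (MX * iota s) * (t * (C / (1 + t) ^+ N.+2)) =
  (t ^+ 2 * (C / (1 + t) ^+ N.+2)) * (MX * iota s) by ring.
by rewrite ler_wpM2r ?mulr_ge0// sqle.
Qed.

(** For fixed la the terms la s^2 cancel and the phase is affine in s with slope
- 2 la (y2 - x2), where |la| >= t |ls| / 2 on the support of the cut-off; the
real and the imaginary part of chi are treated separately. *)
Lemma near_s_fixed (c0 C : R) (N : nat) (gr gi : R -> R) (a b : R) : 0 <= C ->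
  gr = (fun s => complex.Re (chi (bpt s)) * cut_s s) ->
  gi = (fun s => complex.Im (chi (bpt s)) * cut_s s) ->
  smooth1 gr -> smooth1 gi ->
  (forall al be rho : R, 0 <= rho -> `|al| <= rho ->
    (forall u, a <= u <= b -> c0 * `|ls| * rho <= `|2 * al * u + be|) ->
    cabs (chirp_int gr al be) <= C / (1 + rho) ^+ N.+2) ->
  (forall al be rho : R, 0 <= rho -> `|al| <= rho ->
    (forall u, a <= u <= b -> c0 * `|ls| * rho <= `|2 * al * u + be|) ->
    cabs (chirp_int gi al be) <= C / (1 + rho) ^+ N.+2) ->
  c0 <= `|y.2 - p.2| ->
  cabs (cint leb2 f) <= 8 * Lam ^+ 2 * (C / (1 + t) ^+ N).
Proof.
move=> C0 grE giE sgr sgi Hr Hi Hc; rewrite -fub.2.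
have tL : 0 < t * Lam by rewrite mulr_gt0.
have q0 : 0 <= C / (1 + t) ^+ N.+2 by rewrite divr_ge0// exprn_ge0// addr_ge0// ltW.
set Q := C / (1 + t) ^+ N.+2 in q0 Hr Hi *.
apply: (@le_trans _ _ (2 * \int[leb]_la (2 * Q * (t * Lam * \1_`[- (t * Lam), t * Lam] la)))); last first.
  rewrite RintegralZl//.
  have -> : \int[leb]_la (t * Lam * \1_`[- (t * Lam), t * Lam] la) = t * Lam * (2 * (t * Lam)).
    under eq_Rintegral do rewrite mulrC.
    rewrite -Rintegral_indic Rintegral_cst//= lebesgue_measure_itv/= lte_fin gtrN//=.
    by ring.
  have -> : 2 * (2 * Q * (t * Lam * (2 * (t * Lam)))) = 8 * Lam ^+ 2 * (t ^+ 2 * Q) by ring.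
  by rewrite ler_wpM2l ?mulr_ge0 ?exprn_ge0 ?(ltW Lam0)// sqle.
apply: cabs_cint_le.
- apply: (@cmeasurable_param_cint _ _ _ _ _ leb (fun z => f (z.2, z.1))).
  exact: (cmeasurable_comp m_f (@measurable_swap _ _ _ _)).
- exact: (integrableZl measurableT (2 * Q) (iLa (t * Lam))).
move=> la.
have [k0|k0] := eqVneq (cut_la (la / t)) 0.
  rewrite (_ : (fun _ => _) = fun=> 0); last first.
    by apply/funext => s; rewrite /f /cutoff /= k0 mulr0 mul0r (rmorph0 (real_complex R)) !mul0r.
  rewrite (_ : cint leb _ = 0) ?cabs0; last first.
    by apply: complexP; rewrite /cint /cintegral /= Rintegral_eq0.
  apply: mulr_ge0; first exact: mulr_ge0 (ler0n _ _) q0.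
  by apply: mulr_ge0 (ltW tL) _; rewrite indicE ler0n.
have /andP[lb lu] := cut_la_norm k0.
have laE : `|la| = t * `|la / t|.
  by rewrite normrM normfV (gtr0_norm t0) mulrCA divff ?gt_eqF// mulr1.
have laL : `|la| <= t * Lam by rewrite laE ler_pM2l.
pose be := - (2 * la * (y.2 - p.2)).
pose Fr (s : R) : R[i] := (gr s)%:C * expi (0 * s ^+ 2 + be * s).
pose Fi (s : R) : R[i] := (gi s)%:C * expi (0 * s ^+ 2 + be * s).
pose A0 : R[i] := (cut_la (la / t) * `|la|)%:C * expi (la * (y.1 ^+ 2 + y.2 ^+ 2 - p.1 ^+ 2 - p.2 ^+ 2)).
have E s : f (s, la) = A0 * (Fr s + 'i * Fi s).
  have -> : Fr s + 'i * Fi s = chi (bpt s) * (cut_s s)%:C * expi (0 * s ^+ 2 + be * s).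
    rewrite /Fr /Fi; set E0 := expi _; rewrite [X in _ + X]mulrA -mulrDl.
    have -> : (gr s)%:C + 'i * (gi s)%:C = chi (bpt s) * (cut_s s)%:C; last by [].
    rewrite grE giE.
    by case: (chi _) => u v /=; apply: complexP => /=; rewrite !(mul0r, mulr0, mul1r, subr0, sub0r, addr0, add0r, oppr0).
  rewrite /f /cutoff /dist_phase /A0 /=.
  have -> : la * (y.1 ^+ 2 + (y.2 - s) ^+ 2 - (p.1 ^+ 2 + (p.2 - s) ^+ 2)) =
    la * (y.1 ^+ 2 + y.2 ^+ 2 - p.1 ^+ 2 - p.2 ^+ 2) + (0 * s ^+ 2 + be * s).
    by rewrite /be; ring.
  by rewrite expiD !rmorphM /=; ring.
have sk2 : supp_in (s0 - 2 * r) (s0 + 2 * r) cut_s.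
  by move=> s h; rewrite /cut_s sbump_out//; move: h; rewrite -ler_distl -ltNge => /ltW.
have sr : supp_in (s0 - 2 * r) (s0 + 2 * r) gr by rewrite grE => s h; rewrite sk2// mulr0.
have si : supp_in (s0 - 2 * r) (s0 + 2 * r) gi by rewrite giE => s h; rewrite sk2// mulr0.
have iF (g : R -> R) : smooth1 g -> supp_in (s0 - 2 * r) (s0 + 2 * r) g ->
    cintegrable leb (fun s => (g s)%:C * expi (0 * s ^+ 2 + be * s)).
  move=> sg pg; apply: (@cintegrable_domin _ _ _ leb _ (fun x => `|g x|)).
  - by apply: cmeasurable_chirp; exact: smooth1_measurable.
  - exact: (integrable_norm (smooth1_integrable sg pg)).
  - by move=> x; rewrite cabsM cabs_expi cabsC mulr1.
have iZ (c : R[i]) (G : R -> R[i]) : cintegrable leb G -> cintegrable leb (fun s => c * G s).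
  move=> [G1 G2]; split.
    under eq_fun do rewrite cReM.
    by apply: (integrableB measurableT (integrableZl measurableT _ G1) (integrableZl measurableT _ G2)).
  under eq_fun do rewrite cImM.
  by apply: (integrableD measurableT (integrableZl measurableT _ G2) (integrableZl measurableT _ G1)).
have -> : (fun s => f (s, la)) = (fun s => A0 * (Fr s + 'i * Fi s)) by apply/funext => s; exact: E.
have iFr := iF _ sgr sr. have iFi := iF _ sgi si.
have iS : cintegrable leb (fun s => Fr s + 'i * Fi s).
  have [a1 a2] := iFr; have [b1 b2] := iZ 'i _ iFi; split.
    by under eq_fun do rewrite cReD; exact: (integrableD measurableT a1 b1).
  by under eq_fun do rewrite cImD; exact: (integrableD measurableT a2 b2).
rewrite cintZ// cintD//; last exact: iZ.
rewrite cintZ// -/(chirp_int gr 0 be) -/(chirp_int gi 0 be).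
have bb : c0 * `|ls| * t <= `|be|.
  rewrite /be normrN !normrM normr_nat laE.
  have c0' : c0 * `|ls| * t <= `|y.2 - p.2| * `|ls| * t by rewrite !ler_wpM2r// ltW.
  apply: (le_trans c0').
  have -> : 2 * (t * `|la / t|) * `|y.2 - p.2| = `|y.2 - p.2| * (2 * `|la / t|) * t by ring.
  by rewrite ler_wpM2r ?(ltW t0)// ler_wpM2l//; lra.
have jr : cabs (chirp_int gr 0 be) <= Q.
  by apply: Hr; rewrite ?normr0 ?(ltW t0)// => u _; rewrite mulr0 mul0r add0r.
have ji : cabs (chirp_int gi 0 be) <= Q.
  by apply: Hi; rewrite ?normr0 ?(ltW t0)// => u _; rewrite mulr0 mul0r add0r.
rewrite cabsM mulrC.
apply: ler_pM; rewrite ?cabs_ge0//.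
  apply: le_trans (cabsD _ _) _; rewrite cabsM.
  have -> : cabs ('i : R[i]) = 1 by rewrite /cabs /= expr0n expr1n add0r sqrtr1.
  by rewrite mul1r mulr2n mulrDl mul1r lerD.
rewrite /A0 cabsM cabs_expi mulr1 cabsC indicE mem_set/= ?in_itv/= -?ler_norml// mulr1.
have /andP[a1 a2] := sbump_itv ls (2 * r) (la / t).
rewrite normrM normr_id ger0_norm// (le_trans _ laL)// ler_piMl//.
Qed.

End fixed.

End near.

(** * Uniform bounds for the derivatives of the phase *)
Section forms.
Context {R : realType}.

(** The sum of the absolute values of the derivatives of the four phases of
[chirp_int4] at the point (p, q). *)
Definition forms (p1 p2 q1 q2 t11 t12 t21 t22 la s : R) : R :=
  `|2 * la * p1 + t11| + `|2 * la * (p2 - s) + t12| +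
  `|2 * la * q1 - t21| + `|2 * la * (q2 - s) - t22|.

Variables (p1 p2 q1 q2 a1 a2 b1 b2 : R).
Hypothesis p10 : 0 < p1.

Let F0 (z : R * R) : R := forms p1 p2 q1 q2 a1 a2 b1 b2 z.1 z.2.

Let continuous_F0 : continuous F0.
Proof.
have c1 : continuous (fun z : R * R => z.1) by move=> z; exact: cvg_fst.
have c2 : continuous (fun z : R * R => z.2) by move=> z; exact: cvg_snd.
have cn (f : R * R -> R) : continuous f -> continuous (fun z => `|f z|).
  by move=> cf z; apply: cvg_norm; exact: cf.
have c2l : continuous (fun z : R * R => 2 * z.1) by apply: contM => //; exact: cont_cst.
have cl (b : R) (g : R * R -> R) : continuous g -> continuous (fun z : R * R => 2 * z.1 * g z + b).
  by move=> cg; apply: contD; [exact: contM|exact: cont_cst].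
have cs (b : R) : continuous (fun z : R * R => b - z.2).
  by apply: contB => //; exact: cont_cst.
by apply: contD; [apply: contD; [apply: contD|]|]; apply: cn; apply: cl => //; exact: cont_cst.
Qed.

(** For large |la| the first form alone is enough, because p1 > 0; for bounded
|la| the minimum over a compact set is positive. *)
Lemma forms_compact_lower (Z : set (R * R)) : open Z ->
  (forall la s, -1 <= s <= 1 -> forms p1 p2 q1 q2 a1 a2 b1 b2 la s = 0 -> Z (la, s)) ->
  exists2 c, 0 < c & forall la s, -1 <= s <= 1 -> ~ Z (la, s) ->
    c * (1 + `|la|) <= forms p1 p2 q1 q2 a1 a2 b1 b2 la s.
Proof.
(* |la| > M forces 2 |la| p1 - |a1| >= |la| p1 + 1 *)
move=> oZ HZ; pose M := (`|a1| + 1) / p1.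
have M0 : 0 < M by rewrite divr_gt0// ltr_wpDl.
have F00 z : 0 <= F0 z by rewrite /F0 /forms !addr_ge0.
pose K : set (R * R) := (`[- M, M] `*` `[-1, 1]) `&` ~` Z.
have cK : compact K.
  apply: compact_closedI; last exact: open_closedC.
  by apply: compact_setX; exact: segment_compact.
have [m m0 mK] : exists2 m, 0 < m & forall z, K z -> m <= F0 z.
  have [/eqP K0|K0] := boolP (K == set0).
    by exists 1 => // z; rewrite K0.
  have [z zK zmin] : exists2 z, z \in K & forall t, t \in K -> F0 z <= F0 t.
    apply: compact_EVT_min => //; first exact/set0P.
    apply: continuous_subspaceT; exact: continuous_F0.
  exists (F0 z) => [|t Kt]; last by apply: zmin; rewrite inE.
  rewrite lt_neqAle F00 andbT eq_sym; apply/eqP => z0.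
  move: zK; rewrite inE => -[[_ /=]]; rewrite in_itv/= => zs; apply.
  by case: z z0 zs {zmin} => la s z0 zs; exact: HZ.
pose c := Num.min (Num.min p1 1) (m / (1 + M)).
have M1 : 0 < 1 + M by rewrite addr_gt0.
have c0 : 0 < c by rewrite !lt_min p10 ltr01 divr_gt0.
have [cp c1 cm] : [/\ c <= p1, c <= 1 & c <= m / (1 + M)].
  by rewrite /c !ge_min !lexx !orbT.
exists c => // la s s1 nZ; have [laM|laM] := leP `|la| M.
  apply: (@le_trans _ _ m).
    apply: (@le_trans _ _ (m / (1 + M) * (1 + M))).
      by apply: ler_pM; rewrite ?(ltW c0) ?addr_ge0// lerD2l.
    by rewrite divfK// gt_eqF.
  apply: (mK (la, s)); split=> //; split => /=; first by rewrite in_itv/= -ler_norml.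
  by rewrite in_itv.
have h1 : `|2 * la * p1 + a1| <= F0 (la, s).
  by rewrite /F0 /forms /= -!addrA lerDl !addr_ge0.
apply: le_trans h1.
have h2 : 2 * `|la| * p1 <= `|2 * la * p1 + a1| + `|a1|.
  have -> : 2 * `|la| * p1 = `|2 * la * p1| by rewrite !normrM normr_nat (gtr0_norm p10).
  rewrite -[X in `|X| <= _](addrK a1) -[X in X <= _]normrN (le_trans _ (ler_normB _ _))//.
  by rewrite normrN.
have h3 : `|a1| + 1 <= `|la| * p1 by rewrite -ler_pdivrMr// ltW.
have h4 : c * `|la| <= `|la| * p1 by rewrite mulrC ler_wpM2l.
by lra.
Qed.

(** The bound survives small changes of the covector (a change by del of each of
the four components costs 4 del, whence the factor 5), and then extends to
the cone by homogeneity. *)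
Lemma forms_lower (Z : set (R * R)) : open Z ->
  (forall la s, -1 <= s <= 1 -> forms p1 p2 q1 q2 a1 a2 b1 b2 la s = 0 -> Z (la, s)) ->
  exists2 del, 0 < del & forall t t11 t12 t21 t22 la s, 0 < t -> -1 <= s <= 1 ->
    `|t11 - t * a1| <= t * del -> `|t12 - t * a2| <= t * del ->
    `|t21 - t * b1| <= t * del -> `|t22 - t * b2| <= t * del ->
    ~ Z (la / t, s) ->
    del * (t + `|la|) <= forms p1 p2 q1 q2 t11 t12 t21 t22 la s.
Proof.
move=> oZ HZ; have [c c0 Hc] := forms_compact_lower oZ HZ.
exists (c / 5); first by rewrite divr_gt0.
move=> t t11 t12 t21 t22 la s t0 s1 h1 h2 h3 h4 nZ.
have := Hc _ _ s1 nZ; rewrite -(ler_pM2l t0).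
have tn0 : t != 0 by rewrite gt_eqF.
have -> : t * (c * (1 + `|la / t|)) = c * (t + `|la|).
  by rewrite normrM normfV (gtr0_norm t0); field.
have sc A b B : `|B - t * b| <= t * (c / 5) ->
    t * `|2 * (la / t) * A + b| <= `|2 * la * A + B| + t * (c / 5).
  move=> h; have -> : t * `|2 * (la / t) * A + b| = `|(2 * la * A + B) - (B - t * b)|.
    by rewrite -{1}(gtr0_norm t0) -normrM; congr `|_|; field.
  by rewrite (le_trans (ler_normB _ _))// lerD2l.
have scN A b B : `|B - t * b| <= t * (c / 5) ->
    t * `|2 * (la / t) * A - b| <= `|2 * la * A - B| + t * (c / 5).
  by move=> h; apply: sc; rewrite mulrN opprK -normrN opprD opprK.
have := sc p1 _ _ h1; have := sc (p2 - s) _ _ h2.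
have := scN q1 _ _ h3; have := scN (q2 - s) _ _ h4.
have : 0 <= c * `|la| by rewrite mulr_ge0// ltW.
by rewrite /forms !mulrDr; lra.
Qed.

End forms.

(** * A criterion for microlocal smoothness *)
Section cone.
Context {R : realType}.

Lemma enorm_le_sum n (x : 'rV[R]_n) : enorm x <= \sum_i `|x 0 i|.
Proof.
rewrite /enorm /dotp.
have [s0 h] : 0 <= \sum_i `|x 0 i| /\ \sum_i x 0 i * x 0 i <= (\sum_i `|x 0 i|) ^+ 2.
  apply: (big_ind2 (fun a b : R => 0 <= a /\ b <= a ^+ 2)) => [|u v u' v' [u0 h] [u0' h']|i _].
  - by rewrite expr0n.
  - split; first exact: addr_ge0.
    by have := mulr_ge0 u0 u0'; rewrite sqrrD mulr2n; lra.
  - by split=> //; rewrite -normrX -expr2 ger0_norm// sqr_ge0.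
by rewrite -[X in _ <= X](ger0_norm s0) -sqrtr_sqr ler_wsqrtr.
Qed.

(** The open cone generated by a ball about v for the sup norm. *)
Definition cone n (v : 'rV[R]_n) (del : R) : set 'rV[R]_n :=
  \bigcup_(t in [set t : R | 0 < t]) ball (t *: v) (t * del).

Lemma open_cone n (v : 'rV[R]_n) del : 0 < del -> open (cone v del).
Proof.
by move=> del0; apply: bigcup_open => t t0; apply: ball_open; rewrite mulr_gt0.
Qed.

Lemma coneP n (v : 'rV[R]_n) del x : 0 < del ->
  cone v del x <-> exists2 t, 0 < t & forall i, `|x 0 i - t * v 0 i| < t * del.
Proof.
move=> del0; split=> -[t t0 h]; exists t => //.
  by case: h => _ h i; have := h 0 i; rewrite /ball /= !mxE distrC.
split=> [|i j]; first exact: mulr_gt0.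
by rewrite /ball /= !mxE distrC !ord1; exact: h.
Qed.

Lemma conic_cone n (v : 'rV[R]_n) del : 0 < del -> conic (cone v del).
Proof.
move=> del0 c x c0 /(coneP _ _ del0)[t t0 h]; apply/(coneP _ _ del0); exists (c * t) => [|i]; first exact: mulr_gt0.
rewrite mxE -!mulrA -mulrBr normrM (gtr0_norm c0) ltr_pM2l//.
Qed.

Lemma cone_mem n (v : 'rV[R]_n) del : 0 < del -> cone v del v.
Proof. by move=> del0; apply/(coneP _ _ del0); exists 1 => // i; rewrite !mul1r subrr normr0. Qed.

(** In the cone, decay in t is decay in |x|. *)
Lemma enorm_cone n (v : 'rV[R]_n) del (x : 'rV[R]_n) t : 0 < t -> 0 < del ->
  (forall i, `|x 0 i - t * v 0 i| < t * del) ->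
  1 + enorm x <= (1 + \sum_i (`|v 0 i| + del)) * (1 + t).
Proof.
move=> t0 del0 h; set S := \sum_i (_ + _).
have S0 : 0 <= S by apply: sumr_ge0 => i _; rewrite addr_ge0 ?(ltW del0).
have : enorm x <= t * S.
  apply: le_trans (enorm_le_sum x) _; rewrite mulr_sumr; apply: ler_sum => i _.
  have := h i; have := ler_normD (x 0 i - t * v 0 i) (t * v 0 i).
  by rewrite subrK normrM (gtr0_norm t0) mulrDr; lra.
by rewrite mulrDl mulrDr !mul1r; lra.
Qed.

End cone.

(** What remains to be proved at a given covector is the estimate [near_le] for
the integral over (s, la) at fixed x and y, and the lower bound [Hdel] away
from the set Z on which the weight is 1. *)
Section criterion.
Context {R : realType}.
Notation leb := (@lebesgue_measure R).
Notation leb2 := (pmeas leb leb).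
Variables (chi : 'rV[R]_2 -> R[i]) (MX : R).
Hypothesis mX : cmeasurable (fun s : R => chi (bpt s)).
Hypothesis bX : forall s, cabs (chi (bpt s)) <= MX.
Hypothesis X0 : forall s, ~~ (-1 <= s <= 1) -> chi (bpt s) = 0.
Variable mu : ('rV[R]_(2 + 2) -> R[i]) -> R[i].
Hypothesis mu_kernel : schwartz_kernel (Omega R) (Top chi) mu.
Variables (p q xi ze : 'rV[R]_2).
Variables (e del : R) (Z : set (R * R)).
Hypothesis e0 : 0 < e.
Hypothesis ep : e <= p 0 0.
Hypothesis eq : e <= q 0 0.
Hypothesis del0 : 0 < del.
Hypothesis edel : e <= del / 16.
Hypothesis Hdel : forall t t11 t12 t21 t22 la s, 0 < t -> -1 <= s <= 1 ->
    `|t11 - t * xi 0 0| <= t * del -> `|t12 - t * xi 0 1| <= t * del ->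
    `|t21 - t * ze 0 0| <= t * del -> `|t22 - t * ze 0 1| <= t * del ->
    ~ Z (la / t, s) ->
    del * (t + `|la|) <= forms (p 0 0) (p 0 1) (q 0 0) (q 0 1) t11 t12 t21 t22 la s.
Variables (w : R -> R * R -> R) (La : R -> R).
Hypothesis mw : forall t, measurable_fun setT (w t).
Hypothesis w01 : forall t z, 0 <= w t z <= 1.
Hypothesis wLa : forall t z, 0 < t -> La t < `|z.2| -> w t z = 0.
Hypothesis wZ : forall t s la, 0 < t -> Z (la / t, s) -> w t (s, la) = 1.
Hypothesis near_le : forall N, exists2 C, 0 <= C & forall t (x y : R * R), 0 < t ->
  `|x.1 - p 0 0| < e -> `|x.2 - p 0 1| < e -> `|y.1 - q 0 0| < e -> `|y.2 - q 0 1| < e ->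
  cabs (cint leb2 (fun z => (w t z * `|z.2|)%:C * chi (bpt z.1) * expi (dist_phase x y z))) <=
    C / (1 + t) ^+ N.

Let e2 : 0 < e / 2. Proof. by rewrite divr_gt0. Qed.

Let bu (c : R) : R -> R := sbump c (e / 2).
Let sbu c : smooth1 (bu c). Proof. exact: smooth1_sbump. Qed.

Let supp_bu c : supp_in (c - e / 2) (c + e / 2) (bu c).
Proof.
move=> s h; apply: sbump_out => //; move: h; rewrite -ler_distl -ltNge; exact: ltW.
Qed.

Let bu_near c s : bu c s != 0 -> `|s - c| < e.
Proof.
move=> h; apply: (@lt_trans _ _ (e / 2)); last by move: e0; lra.
by rewrite ltNge; apply: contraNN h => h; apply/eqP; exact: sbump_out.
Qed.

(* the factor x1 / pi^2 of the operator is absorbed by the cut-off *)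
Let g1 (s : R) : R := s * bu (p 0 0) s / pi ^+ 2.

Let sg1 : smooth1 g1.
Proof.
apply: smooth1M; last exact: smooth1_cst.
by apply: smooth1M => //; exact: smooth1_id.
Qed.

Let supp_g1 : supp_in (p 0 0 - e / 2) (p 0 0 + e / 2) g1.
Proof. by move=> s h; rewrite /g1 supp_bu// mulr0 mul0r. Qed.

Let Phi (z : 'rV[R]_(2 + 2)) : R[i] :=
  tens (bu (p 0 0)) (bu (p 0 1)) (lsubmx z) * tens (bu (q 0 0)) (bu (q 0 1)) (rsubmx z).

Lemma dotp_split m n (x y : 'rV[R]_(m + n)) :
  dotp x y = dotp (lsubmx x) (lsubmx y) + dotp (rsubmx x) (rsubmx y).
Proof.
by rewrite /dotp big_split_ord; congr (_ + _); apply: eq_bigr => i _; rewrite !mxE.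
Qed.

Let fourier_locE (th : 'rV[R]_(2 + 2)) :
  fourier_loc mu Phi th =
  kernel_fourier g1 (bu (p 0 1)) (bu (q 0 0)) (bu (q 0 1)) chi
    (lsubmx th 0 0) (lsubmx th 0 1) (rsubmx th 0 0) (rsubmx th 0 1).
Proof.
rewrite /fourier_loc.
pose phi (x : 'rV[R]_2) := tens (bu (p 0 0)) (bu (p 0 1)) x * expi (- dotp x (lsubmx th)).
pose psi (y : 'rV[R]_2) := tens (bu (q 0 0)) (bu (q 0 1)) y * expi (- dotp y (rsubmx th)).
have -> : (fun z => Phi z * expi (- dotp z th)) =
    (fun z => phi (lsubmx z) * psi (rsubmx z)).
  by apply/funext => z; rewrite /Phi /phi /psi dotp_split opprD expiD; ring.
have ep2 : e / 2 < p 0 0 by move: e0 ep; lra.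
have eq2 : e / 2 < q 0 0 by move: e0 eq; lra.
have tphi : testfun (Omega R) phi by exact: (@testfun_osc _ _ _ _ p (e / 2)).
have tpsi : testfun (Omega R) psi by exact: (@testfun_osc _ _ _ _ q (e / 2)).
rewrite (mu_kernel tphi tpsi) /phi /psi.
rewrite (@plane_Top _ _ _ (q 0 0 - e / 2) (q 0 0 + e / 2) (q 0 1 - e / 2) (q 0 1 + e / 2)
  _ _ _ _ _ _ _ _ _ (p 0 0 - e / 2) (p 0 0 + e / 2))//; rewrite ?subr_gt0//.
by rewrite lerD2l; move: e0; lra.
Qed.

Lemma microlocally_smooth_of_near :
  microlocally_smooth (setsq (Omega R)) mu (row_mx p q) (row_mx xi ze).
Proof.
have ep2 : e / 2 < p 0 0 by move: e0 ep; lra.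
have eq2 : e / 2 < q 0 0 by move: e0 eq; lra.
exists Phi, (cone (row_mx xi ze) del); split.
  split.
  - exact: (@testfun_tens4 _ _ _ _ _ p q (e / 2)).
  - rewrite /Phi row_mxKl row_mxKr /tens /bu.
    rewrite !sbump_in ?subrr ?normr0 ?divr_ge0 ?(ltW e0)// !mulr1.
    by rewrite (rmorph1 (real_complex R)) oner_neq0.
  - exact: open_cone.
  - exact: conic_cone.
  - exact: cone_mem.
move=> N.
have e4 : e <= del / 4 / 4 by rewrite -mulrA -invfM -natrM.
have [C1 C10 far] := chirp_int4_far sg1 (sbu (p 0 1)) (sbu (q 0 0)) (sbu (q 0 1)) e0 e4
  supp_g1 (@supp_bu (p 0 1)) (@supp_bu (q 0 0)) (@supp_bu (q 0 1)) (N + 3).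
have [C2 C20 near] := near_le N.
pose E := est_const g1 (bu (p 0 1)) (bu (q 0 0)) (bu (q 0 1)) MX.
pose A := 1 + \sum_i (`|row_mx xi ze 0 i| + del).
have A0 : 0 < A by rewrite ltr_wpDr// sumr_ge0// => i _; rewrite addr_ge0 ?(ltW del0).
exists (`|E| * (C1 + C2) * A ^+ N) => th /(coneP _ _ del0)[t t0 Ht].
have hl i : `|lsubmx th 0 i - t * xi 0 i| <= t * del.
  by have := Ht (lshift 2 i); rewrite row_mxEl mxE => /ltW.
have hr i : `|rsubmx th 0 i - t * ze 0 i| <= t * del.
  by have := Ht (rshift 2 i); rewrite row_mxEr mxE => /ltW.
have t1 : 0 < 1 + t by rewrite addr_gt0.
rewrite fourier_locE.
have c3 : 0 < q 0 0 - e / 2 by rewrite subr_gt0.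
have c3d3 : q 0 0 - e / 2 <= q 0 0 + e / 2 by rewrite lerD2l; move: e0; lra.
apply: (@le_trans _ _ (E * (C1 / (1 + t) ^+ N + C2 / (1 + t) ^+ N))).
  apply: (@kernel_fourier_le _ _ _ _ _ _ _ _ _ _ _ _ _ sg1 (sbu (p 0 1)) (sbu (q 0 0)) (sbu (q 0 1))
    supp_g1 (@supp_bu (p 0 1)) (@supp_bu (q 0 0)) (@supp_bu (q 0 1)) c3 c3d3 _ _ mX bX X0
    _ _ _ _ (w t) (La t)) => //.
  - by move=> z; exact: wLa.
  - by rewrite divr_ge0// exprn_ge0// ltW.
  - by rewrite divr_ge0// exprn_ge0// ltW.
  - move=> s la s1; have l1 : 0 < 1 + `|la| by rewrite ltr_wpDr.
    have q0 : 0 <= C1 / (1 + t) ^+ N / (1 + `|la|) ^+ 3.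
      by rewrite !divr_ge0// exprn_ge0// ltW.
    have [Zs|nZ] := pselect (Z (la / t, s)); first by rewrite wZ// subrr mul0r.
    have /andP[w0 w1] := w01 t (s, la).
    have tl0 : 0 <= t + `|la| by rewrite addr_ge0// ltW.
    have tl : `|la| <= t + `|la| by rewrite lerDr ltW.
    have := Hdel t0 s1 (hl 0) (hl 1) (hr 0) (hr 1) nZ.
    have {1}-> : del = 4 * (del / 4) by field.
    move=> /(far _ _ _ _ _ _ _ tl0 tl) h.
    apply: (@le_trans _ _ (cabs (chirp_int4 g1 (bu (p 0 1)) (bu (q 0 0)) (bu (q 0 1)) (lsubmx th 0 0)
      (lsubmx th 0 1) (rsubmx th 0 0) (rsubmx th 0 1) s la))).
      by rewrite ler_piMl ?cabs_ge0// gerBl.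
    apply: (le_trans h); rewrite -mulrA -invfM ler_wpM2l// lef_pV2 ?posrE.
    + rewrite exprD; apply: ler_pM; rewrite ?exprn_ge0 ?(ltW t1) ?(ltW l1)//.
        by rewrite lerXn2r// ?nnegrE ?addr_ge0// ?(ltW t0)// addrA lerDl.
      by rewrite lerXn2r ?nnegrE ?lerD2l ?(ltW l1)// addr_ge0.
    + by rewrite exprn_gt0// ltr_wpDr.
    + by rewrite mulr_gt0// exprn_gt0.
  - move=> x y gx1 x2 y1 y2.
    have x1 : bu (p 0 0) x.1 != 0.
      by apply: contraNN gx1 => /eqP bx; rewrite /g1 bx mulr0 mul0r.
    exact: (near t x y t0 (bu_near x1) (bu_near x2) (bu_near y1) (bu_near y2)).
have := enorm_cone t0 del0 Ht; rewrite -/A => hA.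
have en1 : 0 < 1 + enorm th by rewrite ltr_wpDr// sqrtr_ge0.
apply: (@le_trans _ _ (`|E| * (C1 + C2) * ((1 + t) ^+ N)^-1)).
  rewrite -mulrDl mulrA ler_wpM2r ?invr_ge0 ?exprn_ge0 ?(ltW t1)//.
  by rewrite ler_wpM2r ?addr_ge0// ler_norm.
rewrite -[leRHS]mulrA ler_wpM2l ?mulr_ge0 ?addr_ge0//.
rewrite ler_pdivlMr ?exprn_gt0// ler_pdivrMl ?exprn_gt0// mulrC -exprMn.
by rewrite lerXn2r// ?nnegrE ?mulr_ge0 ?(ltW A0) ?(ltW en1) ?(ltW t1).
Qed.

End criterion.

(** * The two cases at the critical point *)
Section perturbation.
Context {R : realType}.

Lemma sqr_perturb (a0 a d : R) : `|a - a0| <= d -> d <= 1 ->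
  `|a ^+ 2 - a0 ^+ 2| <= d * (2 * `|a0| + 1).
Proof.
move=> h d1; have d0 : 0 <= d by apply: le_trans h.
have -> : a ^+ 2 - a0 ^+ 2 = (a - a0) * ((a - a0) + 2 * a0) by ring.
rewrite normrM; apply: ler_pM => //.
by have := ler_normD (a - a0) (2 * a0); rewrite normrM normr_nat; lra.
Qed.

Lemma dist_diff_perturb (p1 p2 q1 q2 s0 : R) :
  q1 ^+ 2 + (q2 - s0) ^+ 2 - (p1 ^+ 2 + (p2 - s0) ^+ 2) != 0 ->
  exists d c, [/\ 0 < d, 0 < c & forall x1 x2 y1 y2 s,
    `|x1 - p1| <= d -> `|x2 - p2| <= d -> `|y1 - q1| <= d -> `|y2 - q2| <= d ->
    `|s - s0| <= d ->
    c <= `|y1 ^+ 2 + (y2 - s) ^+ 2 - (x1 ^+ 2 + (x2 - s) ^+ 2)|].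
Proof.
set D0 := _ - _ => D0n; have D00 : 0 < `|D0| by rewrite normr_gt0.
pose S := (2 * `|q1| + 1) + (2 * `|q2 - s0| + 1) + ((2 * `|p1| + 1) + (2 * `|p2 - s0| + 1)).
have S0 : 0 < S.
  have h (a : R) : 0 < 2 * `|a| + 1 by rewrite ltr_wpDl// mulr_ge0.
  by rewrite /S; move: (h q1) (h (q2 - s0)) (h p1) (h (p2 - s0)); lra.
pose d := Num.min 1 (`|D0| / (2 * S)).
have d0 : 0 < d by rewrite lt_min ltr01 divr_gt0// mulr_gt0.
have d1 : d <= 1 by rewrite ge_min lexx.
have dS : d * S <= `|D0| / 2.
  apply: (@le_trans _ _ (`|D0| / (2 * S) * S)).
    by rewrite ler_wpM2r ?(ltW S0)// ge_min lexx orbT.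
  by rewrite invfM mulrA divfK// gt_eqF.
exists (d / 2), (`|D0| / 2); split; rewrite ?divr_gt0// => x1 x2 y1 y2 s hx1 hx2 hy1 hy2 hs.
have w (a b : R) : `|a - b| <= d / 2 -> `|a - b| <= d by move: d0; lra.
have w2 (a b : R) : `|a - b| <= d / 2 -> `|(a - s) - (b - s0)| <= d.
  move=> h; have -> : (a - s) - (b - s0) = (a - b) - (s - s0) by ring.
  by have := ler_normB (a - b) (s - s0); move: h hs; lra.
have h1 := sqr_perturb (w _ _ hy1) d1.
have h2 := sqr_perturb (w2 _ _ hy2) d1.
have h3 := sqr_perturb (w _ _ hx1) d1.
have h4 := sqr_perturb (w2 _ _ hx2) d1.
set D := (X in _ <= `|X|).
have E : D0 = D - (((y1 ^+ 2 - q1 ^+ 2) + ((y2 - s) ^+ 2 - (q2 - s0) ^+ 2)) -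
    ((x1 ^+ 2 - p1 ^+ 2) + ((x2 - s) ^+ 2 - (p2 - s0) ^+ 2))).
  by rewrite /D /D0; ring.
have H : `|D0| <= `|D| + d * S.
  rewrite {1}E (le_trans (ler_normB _ _))// lerD2l (le_trans (ler_normB _ _))//.
  by rewrite /S mulrDr lerD// mulrDr (le_trans (ler_normD _ _))// lerD.
by lra.
Qed.

Lemma bpt_inj : injective (@bpt R).
Proof. by move=> s s' /(congr1 (fun v : 'rV[R]_2 => v 0 1)); rewrite !mxE. Qed.

End perturbation.

Section geometry.
Context {R : realType}.
Notation leb := (@lebesgue_measure R).
Notation leb2 := (pmeas leb leb).
Variable chi : 'rV[R]_2 -> R[i].
Hypothesis chi_smooth : smooth_on (-1) 1 (fun t => chi (bpt t)).
Hypothesis chi_out : forall z, hplane R z -> ~ Gam R z -> chi z = 0.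
Variable mu : ('rV[R]_(2 + 2) -> R[i]) -> R[i].
Hypothesis mu_kernel : schwartz_kernel (Omega R) (Top chi) mu.

Let Xre (s : R) : R := complex.Re (chi (bpt s)).
Let Xim (s : R) : R := complex.Im (chi (bpt s)).

Let X0 s : ~~ (-1 <= s <= 1) -> chi (bpt s) = 0.
Proof.
move=> h; apply: chi_out; first by exists s.
by move=> [s' /=]; rewrite in_itv/= => s1 /bpt_inj ss; move: h; rewrite -ss s1.
Qed.

Let mX : cmeasurable (fun s : R => chi (bpt s)).
Proof.
have [h1 h2] := chi_smooth; split.
  by apply: (rsmooth_on_measurable h1) => t /X0 ->.
by apply: (rsmooth_on_measurable h2) => t /X0 ->.
Qed.

Let bX : exists MX, forall s, cabs (chi (bpt s)) <= MX.
Proof.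
have [h1 h2] := chi_smooth.
have [M1 M10 H1] := rsmooth_on_bounded h1.
have [M2 M20 H2] := rsmooth_on_bounded h2.
exists (M1 + M2) => s; have [s1|/X0 ->] := boolP (-1 <= s <= 1); last by rewrite cabs0 addr_ge0.
by apply: le_trans (cabs_le _) _; apply: lerD; [exact: H1|exact: H2].
Qed.

Variables (p q xi ze : 'rV[R]_2).
Hypothesis Op : 0 < p 0 0.
Hypothesis Oq : 0 < q 0 0.

Let F := forms (p 0 0) (p 0 1) (q 0 0) (q 0 1) (xi 0 0) (xi 0 1) (ze 0 0) (ze 0 1).

(** Without a critical point the weight 0 will do. *)
Lemma microlocally_smooth_no_zero :
  (forall la s, -1 <= s <= 1 -> F la s != 0) ->
  microlocally_smooth (setsq (Omega R)) mu (row_mx p q) (row_mx xi ze).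
Proof.
move=> Fn0; have [MX bMX] := bX.
have [del del0 Hdel] := @forms_lower _ (p 0 0) (p 0 1) (q 0 0) (q 0 1) (xi 0 0) (xi 0 1)
  (ze 0 0) (ze 0 1) Op set0 open0 (fun la s s1 F0 => negP (Fn0 la s s1) (introT eqP F0)).
pose e := Num.min (del / 16) (Num.min (p 0 0) (q 0 0)).
have e0 : 0 < e by rewrite !lt_min Op Oq divr_gt0.
have [ed ep eq] : [/\ e <= del / 16, e <= p 0 0 & e <= q 0 0].
  by rewrite !ge_min !lexx !orbT.
apply: (microlocally_smooth_of_near mX bMX X0 mu_kernel e0 ep eq del0 ed Hdel
  (w := fun _ => cst 0) (La := fun=> 0)) => //.
- by move=> t z; rewrite lexx ler01.
- move=> N; exists 0 => // t x y _ _ _ _ _; rewrite mul0r.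
  rewrite (_ : cint _ _ = 0) ?cabs0//.
  apply: complexP; rewrite /cint /cintegral /= Rintegral_eq0// => z.
    by rewrite mul0r (rmorph0 (real_complex R)) !mul0r.
  by rewrite mul0r (rmorph0 (real_complex R)) !mul0r.
Qed.

Variables (tau s0 : R).
Hypothesis tau0 : tau != 0.
Hypothesis xi0 : xi 0 0 = tau * p 0 0.
Hypothesis xi1 : xi 0 1 = tau * (p 0 1 - s0).

(* the critical frequency: 2 la p1 + xi1 = 0 at la = ls *)
Let ls : R := - tau / 2.
Let ls0 : 0 < `|ls|.
Proof. by rewrite normr_gt0 mulf_neq0// oppr_eq0. Qed.

(* the first two forms already determine la and s *)
Let forms_zero la s : F la s = 0 -> la = ls /\ s = s0.
Proof.
move=> /eqP; rewrite /F /forms !paddr_eq0 ?addr_ge0// !normr_eq0 xi0 xi1.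
move=> /andP[/andP[/andP[h1 h2] _] _].
have lE : la = ls.
  have : (2 * la + tau) * p 0 0 == 0 by rewrite mulrDl.
  by rewrite mulf_eq0 (gt_eqF Op) orbF /ls => /eqP; lra.
split=> //; have : tau * (s - s0) == 0.
  by move: h2; rewrite lE /ls => /eqP h2; apply/eqP; rewrite -h2; field.
by rewrite mulf_eq0 (negPf tau0)/= subr_eq0 => /eqP.
Qed.

Lemma microlocally_smooth_of_cutoff (r d : R) : 0 < r -> 4 * r <= `|ls| -> 0 < d ->
  (forall N, exists2 C, 0 <= C & forall t (x y : R * R), 0 < t ->
    `|x.1 - p 0 0| < d -> `|x.2 - p 0 1| < d -> `|y.1 - q 0 0| < d -> `|y.2 - q 0 1| < d ->
    cabs (cint leb2 (fun z => (cutoff ls s0 r t z * `|z.2|)%:C * chi (bpt z.1) *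
      expi (dist_phase x y z))) <= C / (1 + t) ^+ N) ->
  microlocally_smooth (setsq (Omega R)) mu (row_mx p q) (row_mx xi ze).
Proof.
move=> r0 rls d0 near_le; have [MX bMX] := bX.
pose Z : set (R * R) := [set z | ball ls r z.1 /\ ball s0 r z.2].
have oZ : open Z.
  have -> : Z = (fst @^-1` ball ls r) `&` (snd @^-1` ball s0 r) by [].
  apply: openI; apply: open_comp; try exact: ball_open.
    by move=> z _; exact: cvg_fst.
  by move=> z _; exact: cvg_snd.
have HZ la s : -1 <= s <= 1 -> F la s = 0 -> Z (la, s).
  by move=> _ /forms_zero[-> ->]; split; exact: ballxx.
have [del del0 Hdel] := forms_lower Op oZ HZ.
pose e := Num.min (Num.min d (del / 16)) (Num.min (p 0 0) (q 0 0)).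
have e0 : 0 < e by rewrite !lt_min Op Oq d0 divr_gt0.
have [ed edel ep eq] : [/\ e <= d, e <= del / 16, e <= p 0 0 & e <= q 0 0].
  by rewrite !ge_min !lexx !orbT.
apply: (microlocally_smooth_of_near mX bMX X0 mu_kernel e0 ep eq del0 edel Hdel
  (w := cutoff ls s0 r) (La := fun t => t * (`|ls| + 2 * r))).
- by move=> t; exact: measurable_cutoff.
- by move=> t z; exact: cutoff01.
- by move=> t z t0 h; exact: cutoff_La.
- move=> t s la t0 [/= h1 h2]; apply: cutoff1 => //=; rewrite distrC; exact: ltW.
- move=> N; have [C C0 H] := near_le N; exists C => // t x y t0 h1 h2 h3 h4.
  by apply: H => //; [exact: lt_le_trans h1 ed|exact: lt_le_trans h2 ed
    |exact: lt_le_trans h3 ed|exact: lt_le_trans h4 ed].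
Qed.

Lemma microlocally_smooth_dist_neq : enorm (p - bpt s0) != enorm (q - bpt s0) ->
  microlocally_smooth (setsq (Omega R)) mu (row_mx p q) (row_mx xi ze).
Proof.
move=> dn; have [MX bMX] := bX.
have : q 0 0 ^+ 2 + (q 0 1 - s0) ^+ 2 - (p 0 0 ^+ 2 + (p 0 1 - s0) ^+ 2) != 0.
  apply: contraNN dn; rewrite subr_eq0 /enorm !dotp2 !mxE /= !subr0 -!expr2.
  by move=> /eqP ->.
move=> /dist_diff_perturb[d [c [d0 c0 Hc]]].
pose r := Num.min (d / 2) (`|ls| / 4).
have r0 : 0 < r by rewrite lt_min !divr_gt0.
have [rd rls] : r <= d / 2 /\ r <= `|ls| / 4 by rewrite !ge_min !lexx !orbT.
have rls' : 4 * r <= `|ls| by lra.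
apply: (microlocally_smooth_of_cutoff r0 rls' d0) => N.
have [|||C C0 H] := @chirp_int_decay _ N.+2 (abs_cut_la ls r) (ls - 2 * r) (ls + 2 * r) (ls - 4 * r) (ls + 4 * r)
  c (smooth1_abs_cut_la r0 rls') (supp_abs_cut_la r0) _ _ _ c0; [by lra..|].
exists ((2 * \int[leb]_s (MX * \1_`[-1, 1] s)) * C).
  by rewrite mulr_ge0// mulr_ge0// Rintegral_ge0// => s _; rewrite mulr_ge0 ?(le_trans _ (bMX 0)) ?cabs_ge0// indicE.
move=> t x y t0 h1 h2 h3 h4; rewrite -[leRHS]mulrA.
apply: (near_lambda_fixed mX bMX X0 r0 rls' t0 C0 H) => s hs.
apply: Hc; rewrite ltW//; apply: (lt_le_trans hs); lra.
Qed.

(** The support of the cut-off in s stays inside (-1, 1), where chi is smooth in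
the two-sided sense. *)
Lemma microlocally_smooth_interior : -1 < s0 < 1 -> p 0 1 != q 0 1 ->
  microlocally_smooth (setsq (Omega R)) mu (row_mx p q) (row_mx xi ze).
Proof.
move=> /andP[sl su] pq; have [MX bMX] := bX.
have c0 : 0 < `|q 0 1 - p 0 1| by rewrite normr_gt0 subr_eq0 eq_sym.
set c := `|q 0 1 - p 0 1| in c0.
pose r := Num.min (Num.min ((1 - s0) / 4) ((s0 + 1) / 4)) (`|ls| / 4).
have r0 : 0 < r by rewrite !lt_min !divr_gt0//; lra.
have [r1 r2 rls] : [/\ r <= (1 - s0) / 4, r <= (s0 + 1) / 4 & r <= `|ls| / 4].
  by rewrite !ge_min !lexx !orbT.
have rls' : 4 * r <= `|ls| by lra.
have c4 : 0 < c / 4 by rewrite divr_gt0.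
apply: (microlocally_smooth_of_cutoff r0 rls' c4) => N.
have sk2 : supp_in (s0 - 2 * r) (s0 + 2 * r) (cut_s s0 r).
  move=> s h; rewrite /cut_s sbump_out ?mulr_gt0//.
  by move: h; rewrite -ler_distl -ltNge => /ltW.
have [h1 h2] := chi_smooth.
have sgr : smooth1 (fun s => Xre s * cut_s s0 r s).
  apply: (rsmooth_on_mul_smooth1 h1 _ _ (smooth1_sbump s0 (2 * r)) sk2); lra.
have sgi : smooth1 (fun s => Xim s * cut_s s0 r s).
  apply: (rsmooth_on_mul_smooth1 h2 _ _ (smooth1_sbump s0 (2 * r)) sk2); lra.
have cl0 : 0 < c / 2 * `|ls| by rewrite mulr_gt0// divr_gt0.
have dec (g : R -> R) : smooth1 (fun s => g s * cut_s s0 r s) ->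
    exists2 C, 0 <= C & forall al be rho, 0 <= rho -> `|al| <= rho ->
    (forall u, s0 - 4 * r <= u <= s0 + 4 * r -> c / 2 * `|ls| * rho <= `|2 * al * u + be|) ->
    cabs (chirp_int (fun s => g s * cut_s s0 r s) al be) <= C / (1 + rho) ^+ N.+2.
  move=> sg; apply: (@chirp_int_decay _ N.+2 _ (s0 - 2 * r) (s0 + 2 * r)) => //; try lra.
  by move=> s h; rewrite sk2// mulr0.
have [C1 C10 H1] := dec _ sgr; have [C2 C20 H2] := dec _ sgi.
have up (C a b : R) (n : nat) : 0 <= C -> 0 <= b -> a <= C / (1 + b) ^+ n ->
    C <= C1 + C2 -> a <= (C1 + C2) / (1 + b) ^+ n.
  move=> C0 b0 h CC; apply: (le_trans h); rewrite ler_wpM2r// invr_ge0 exprn_ge0// addr_ge0//.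
exists (8 * (`|ls| + 2 * r) ^+ 2 * (C1 + C2)).
  by rewrite mulr_ge0 ?addr_ge0// mulr_ge0 ?sqr_ge0.
move=> t x y t0 hx1 hx2 hy1 hy2; rewrite -[leRHS]mulrA.
apply: (@near_s_fixed _ _ _ mX bMX X0 _ _ _ r0 rls' _ _ _ t0 (c / 2) (C1 + C2) N
  (fun s => Xre s * cut_s s0 r s) (fun s => Xim s * cut_s s0 r s) (s0 - 4 * r) (s0 + 4 * r)) => //.
- exact: addr_ge0.
- by move=> al be rho rho0 ar Hu; apply: (up C1) => //; [exact: H1|rewrite lerDl].
- by move=> al be rho rho0 ar Hu; apply: (up C2) => //; [exact: H2|rewrite lerDr].
- have -> : y.2 - x.2 = (q 0 1 - p 0 1) - ((x.2 - p 0 1) - (y.2 - q 0 1)) by ring.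
  have := ler_normB (x.2 - p 0 1) (y.2 - q 0 1).
  have := lerB_dist (q 0 1 - p 0 1) ((x.2 - p 0 1) - (y.2 - q 0 1)).
  by rewrite -/c; lra.
Qed.

End geometry.

Theorem proposition2p1 (R : realType) (k : nat) (chi : 'rV[R]_2 -> R[i])
  (chi_smooth : smooth_on (-1) 1 (fun t => chi (bpt t)))
  (chi_out : forall z, hplane R z -> ~ Gam R z -> chi z = 0)
  (chi_plus : vanishes_to_order (-1) 1 (fun t => chi (bpt t)) k 1)
  (chi_minus : vanishes_to_order (-1) 1 (fun t => chi (bpt t)) k (-1))
  (mu : ('rV[R]_(2 + 2) -> R[i]) -> R[i])
  (mu_distr : distribution_on (setsq (Omega R)) mu)
  (mu_kernel : schwartz_kernel (Omega R) (Top chi) mu) :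
  WFprime (Omega R) mu `<=`
    DeltaV R `|` Lambda (bpt 1) `|` Lambda (bpt (-1)).
Proof.
move=> -[[p xi] [q eta]]; rewrite /WFprime /WF /= => -[[]].
rewrite row_mxKl row_mxKr /Omega /= => Op Oq th0 nsm.
apply: contrapT => nU; apply: nsm.
(* is there a critical point, that is, a common zero of the four forms? *)
have [[tau [s [s1 xiE etaE]]]|nz] := pselect (exists tau s, [/\ -1 <= s <= 1,
    xi = tau *: (p - bpt s) & eta = tau *: (q - bpt s)]); last first.
  apply: (microlocally_smooth_no_zero chi_smooth chi_out mu_kernel Op) => // la s s1.
  apply/eqP => F0; apply: nz; exists (- (2 * la)), s.
  move: F0 => /eqP; rewrite /forms !paddr_eq0 ?addr_ge0// !normr_eq0 !mxE.
  rewrite !opprK => /andP[/andP[/andP[/eqP h1 /eqP h2] /eqP h3] /eqP h4].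
  split=> //; apply/rowP; apply: forall_ord2; rewrite !mxE /=; lra.
have tau0 : tau != 0.
  apply: contra_neq th0 => t0; rewrite xiE etaE t0 !scale0r oppr0.
  by rewrite row_mx0.
have xi0 : xi 0 0 = tau * p 0 0 by rewrite xiE !mxE /= subr0.
have xi1 : xi 0 1 = tau * (p 0 1 - s) by rewrite xiE !mxE.
have cp : cotangent0 (p, xi).
  split=> //=; apply/eqP => /(congr1 (fun v : 'rV[R]_2 => v 0 0)) /eqP.
  by rewrite xi0 mxE mulf_eq0 (negPf tau0) (gt_eqF Op).
have cq : cotangent0 (q, eta).
  split=> //=; apply/eqP => /(congr1 (fun v : 'rV[R]_2 => v 0 0)) /eqP.
  by rewrite etaE !mxE /= subr0 mulf_eq0 (negPf tau0) (gt_eqF Oq).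
(* the two covectors point to the same z_s; compare the distances *)
have [dE|dn] := eqVneq (enorm (p - bpt s)) (enorm (q - bpt s)); last first.
  exact: (microlocally_smooth_dist_neq chi_smooth chi_out mu_kernel (- eta) Op Oq tau0 xi0 xi1 dn).
have LE : Lambda (bpt s) ((p, xi), (q, eta)) by split=> //; exists tau.
have s_lt : -1 < s < 1.
  move: s1 => /andP[sl su]; rewrite !lt_neqAle sl su !andbT; apply/andP; split.
    by apply/eqP => sE; apply: nU; right; rewrite sE.
  by apply/eqP => sE; apply: nU; left; right; rewrite -sE.
apply: (microlocally_smooth_interior chi_smooth chi_out mu_kernel (- eta) Op Oq tau0 xi0 xi1 s_lt).
apply/eqP => pq1; apply: nU; left; left; split.
  split=> //; exists (bpt s); split; last by exists s => //=; rewrite in_itv.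
  (* the line through p along xi meets the boundary at z_s *)
  by exists (- tau^-1) => //=; rewrite xiE scalerA mulNr mulVf// scaleN1r opprB addrC subrK.
have pq : p = q.
  apply/rowP; apply: forall_ord2 => //; apply/eqP.
  rewrite -(@eqrXn2 _ 2)// ?ltW//; move: dE; rewrite /enorm !dotp2 !mxE /= !subr0 pq1.
  move=> /eqP; rewrite eqr_sqrt ?addr_ge0 ?sqr_ge0 -?expr2 ?sqr_ge0//.
  by rewrite (inj_eq (addIr _)).
by rewrite /= etaE xiE pq.
Qed.
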